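(* Let $T=(T_h)_{h\ge0}$ be a locally finite polynomial action. Assume that $\mathbb F=\mathbb R$, $\mathcal P_1\cdot\mathcal P_1\subseteq \mathcal P_2$ and at least one of the following holds: (1) $\mathcal P_2\cdot\mathcal P_2\subseteq \mathcal P$; (2) every element of $\mathcal P_2$ can be written as a finite linear combination of positive (i.e. pointwise $\ge 0$) elements of $\mathcal P_2$. Let $X$ be an $E$-valued $\mathcal P$-polynomial process with action $T$. Then $\mathbb E\left[\int_0^t|\mathcal Gp(X_r)|\,dr\right]<\infty$ for all $t\ge0$, $p\in\mathcal L$. Let $p,q\in\mathcal L$, let $$M_t(r):=r(X_t)-r(X_0)-\int_0^t\mathcal Gr(X_s)\,ds,\qquad t\ge0,\ r\in\mathcal L,$$ and define $$a_{p,q}(x):= \mathcal G(pq)(x)-p(x)\mathcal Gq(x)-q(x)\mathcal Gp(x),\quad x\in E.$$ Then $$ \langle M_{(\cdot)}(p),M_{(\cdot)}(q)\rangle_t = \int_0^t a_{p,q}(X_s)\, ds$$ for any $t\geq0$, where $\langle M_{(\cdot)}(p),M_{(\cdot)}(q)\rangle$ denotes the compensator of the quadratic covariation between $M_{(\cdot)}(p)$ and $M_{(\cdot)}(q)$.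
   Context: $\mathbb F$ is the scalar field, $\mathbb N=\{0,1,2,\dots\}$, $\mathbb R_+=[0,\infty)$. $(\Omega,\mathfrak A,(\mathcal F_t)_{t\ge 0},P)$ is a filtered probability space and $E$ is a non-empty set. Polynomials: $\mathcal P$ is a vector space of functions $E\to\mathbb F$ containing all constant functions, together with a degree function $\deg:\mathcal P\to\mathbb N$ such that $\deg(p+q)\le\max\{\deg(p),\deg(q)\}$, $\deg(\lambda p)=\deg(p)$ for $p,q\in\mathcal P$, $\lambda\in\mathbb F\setminus\{0\}$, and $\deg(p)=0$ iff $p$ is constant. $\mathcal P_n:=\{p\in\mathcal P:\deg(p)\le n\}$. $\mathcal L$ is a fixed vector space complement of $\mathcal P_0$ in $\mathcal P_1$. $\mathcal P_i\cdot\mathcal P_j$ is the set of pointwise products. Polynomial action: a family $T=(T_h)_{h\ge0}$ of linear operators on $\mathcal P$ with $\deg(T_hp)\le\deg(p)$, $T_0p=p$, $T_hT_k=T_{h+k}$ for $h,k\ge0$, and $h\mapsto (T_hp)(x)$ right-continuous for all $p\in\mathcal P$, $x\in E$. Its generator $\mathcal G$ has domain $\mathcal D$ consisting of all $p\in\mathcal P$ for which there is $q\in\mathcal P$ with $\lim_{h\searrow0}\frac{T_hp(x)-p(x)}{h}=q(x)$ for all $x\in E$, and then $\mathcal Gp:=q$. $T$ is locally finite if for any $p\in\mathcal P$ there is $d\in\mathbb N$ such that for any $h>0$ the family $\{T_h^kp:k=0,\dots,d\}$ is linearly dependent ($T_h^k$ is the $k$-fold composition); in this case $\mathcal D=\mathcal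 P$. Polynomial process: a function $X:\Omega\times\mathbb R_+\to E$ is an $E$-valued $\mathcal P$-polynomial process with action $T$ if for all $p\in\mathcal P$: $\mathbb E[|p(X_t)|]<\infty$ for $t\ge0$; $\mathbb E[p(X_{t+h})|\mathcal F_t]=T_hp(X_t)$ for $t,h\ge0$; $t\mapsto p(X_t)$ has càdlàg paths; $p(X_t)$ is $\mathcal F_t$-measurable for $t\ge0$. *)

(* Defs.v *)
From HB Require Import structures.
From mathcomp Require Import all_boot all_order all_algebra.
From mathcomp Require Import all_classical all_reals all_analysis.

Set Implicit Arguments.
Unset Strict Implicit.
Unset Printing Implicit Defensive.

Import Order.TTheory GRing.Theory Num.Theory.
Import numFieldNormedType.Exports.

Local Open Scope classical_set_scope.
Local Open Scope ring_scope.

(* Polynomials are a set [PP] of functions [E -> R] with the pointwise ring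
   and module structure of [E -> R].  Time is the half-line [0, +oo) of [R]:
   time-indexed families are functions on [R] of which only the values at
   nonnegative times are constrained or used. *)

Definition polynomial_space (R : realType) (E : Type)
    (PP : set (E -> R)) (deg : (E -> R) -> nat) : Prop :=
  [/\ (forall c : R, PP (cst c)),
      (forall p q, PP p -> PP q -> PP (p + q)) &
      (forall (a : R) p, PP p -> PP (a *: p))] /\
  [/\ (forall p q, PP p -> PP q -> (deg (p + q)%R <= maxn (deg p) (deg q))%N),
      (forall (a : R) p, PP p -> a != 0 -> deg (a *: p) = deg p) &
      (forall p, PP p -> (deg p = 0%N <-> exists c : R, p = cst c))].

Definition poly_le (R : realType) (E : Type)
    (PP : set (E -> R)) (deg : (E -> R) -> nat) (n : nat) : set (E -> R) :=
  [set p | PP p /\ (deg p <= n)%N].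

Definition products (R : realType) (E : Type) (A B : set (E -> R)) :
    set (E -> R) :=
  [set r | exists p q, [/\ A p, B q & r = p * q]].

Definition is_subspace (R : realType) (V : lmodType R) (L : set V) : Prop :=
  [/\ L 0, (forall u v, L u -> L v -> L (u + v)) &
      (forall (a : R) u, L u -> L (a *: u))].

Definition is_complement (R : realType) (V : lmodType R) (L A B : set V) :
    Prop :=
  [/\ is_subspace L, L `<=` B, L `&` A = [set 0] &
      forall v, B v -> exists l a, [/\ L l, A a & v = l + a]].

Definition spanned_by_positive (R : realType) (E : Type) (A : set (E -> R)) :
    Prop :=
  forall p, A p -> exists (n : nat) (c : 'I_n -> R) (f : 'I_n -> E -> R),
    (forall i, A (f i) /\ forall x, 0 <= f i x) /\
    p = \sum_(i < n) c i *: f i.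

Definition polynomial_action (R : realType) (E : Type)
    (PP : set (E -> R)) (deg : (E -> R) -> nat)
    (T : R -> (E -> R) -> (E -> R)) : Prop :=
  [/\ (forall h, 0 <= h -> forall p, PP p -> PP (T h p)),
      (forall h, 0 <= h -> forall (a : R) p q, PP p -> PP q ->
         T h (a *: p + q) = a *: T h p + T h q) &
      (forall h, 0 <= h -> forall p, PP p -> (deg (T h p) <= deg p)%N)] /\
  [/\ (forall p, PP p -> T 0 p = p),
      (forall h k, 0 <= h -> 0 <= k -> forall p, PP p ->
         T h (T k p) = T (h + k) p) &
      (forall p x h, PP p -> 0 <= h -> T k p x @[k --> h^'+] --> T h p x)].

Definition generator_graph (R : realType) (E : Type) (PP : set (E -> R))
    (T : R -> (E -> R) -> (E -> R)) (p q : E -> R) : Prop :=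
  [/\ PP p, PP q &
      forall x, (T h p x - p x) / h @[h --> 0^'+] --> q x].

(* The image is unique on the domain; off the domain the value is the junk
   value 0. *)
Definition generator (R : realType) (E : Type) (PP : set (E -> R))
    (T : R -> (E -> R) -> (E -> R)) (p : E -> R) : E -> R :=
  xget 0 [set q | generator_graph PP T p q].

Definition locally_finite_action (R : realType) (E : Type) (PP : set (E -> R))
    (T : R -> (E -> R) -> (E -> R)) : Prop :=
  forall p, PP p -> exists d : nat, forall h, 0 < h ->
    exists c : 'I_d.+1 -> R,
      (exists k, c k != 0) /\ \sum_(k < d.+1) c k *: iter k (T h) p = 0.

(* The usual conditions (completeness, right-continuity) are not assumed. *)
Definition is_filtration (R : realType) d (Omega : measurableType d)
    (F : R -> set (set Omega)) : Prop :=
  [/\ (forall t, 0 <= t -> sigma_algebra setT (F t)),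
      (forall t, 0 <= t -> F t `<=` measurable) &
      (forall s t, 0 <= s -> s <= t -> F s `<=` F t)].

Definition measurable_wrt (R : realType) (Omega : Type) (G : set (set Omega))
    (f : Omega -> R) : Prop :=
  forall B : set R, measurable B -> G (f @^-1` B).

Definition adapted (R : realType) (Omega : Type) (F : R -> set (set Omega))
    (Y : R -> Omega -> R) : Prop :=
  forall t, 0 <= t -> measurable_wrt (F t) (Y t).

Definition is_cond_exp (R : realType) d (Omega : measurableType d)
    (Pr : probability Omega R) (G : set (set Omega)) (Z Y : Omega -> R) :
    Prop :=
  [/\ measurable_wrt G Y, Pr.-integrable setT (EFin \o Y) &
      forall A, G A ->
        (\int[Pr]_(w in A) (Y w)%:E = \int[Pr]_(w in A) (Z w)%:E)%E].

Definition cadlag (R : realType) (f : R -> R) : Prop :=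
  (forall t, 0 <= t -> f s @[s --> t^'+] --> f t) /\
  (forall t, 0 < t -> cvg (f s @[s --> t^'-])).

Definition polynomial_process (R : realType) d (Omega : measurableType d)
    (Pr : probability Omega R) (F : R -> set (set Omega)) (E : Type)
    (PP : set (E -> R)) (T : R -> (E -> R) -> (E -> R))
    (X : R -> Omega -> E) : Prop :=
  forall p, PP p ->
  [/\ (forall t, 0 <= t -> Pr.-integrable setT (fun w => (p (X t w))%:E)),
      (forall t h, 0 <= t -> 0 <= h ->
         is_cond_exp Pr (F t) (fun w => p (X (t + h) w))
                              (fun w => T h p (X t w))),
      (forall w, cadlag (fun t => p (X t w))) &
      (forall t, 0 <= t -> measurable_wrt (F t) (fun w => p (X t w)))].

Definition is_martingale (R : realType) d (Omega : measurableType d)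
    (Pr : probability Omega R) (F : R -> set (set Omega))
    (Y : R -> Omega -> R) : Prop :=
  [/\ adapted F Y,
      (forall t, 0 <= t -> Pr.-integrable setT (EFin \o Y t)) &
      (forall s t, 0 <= s -> s <= t -> is_cond_exp Pr (F s) (Y t) (Y s))].

Definition is_stopping_time (R : realType) (Omega : Type)
    (F : R -> set (set Omega)) (tau : Omega -> \bar R) : Prop :=
  (forall w, (0 <= tau w)%E) /\
  (forall t, 0 <= t -> F t [set w | (tau w <= t%:E)%E]).

Definition stopped (R : realType) (Omega : Type) (tau : Omega -> \bar R)
    (Y : R -> Omega -> R) : R -> Omega -> R :=
  fun t w => Y (fine (Order.min t%:E (tau w))) w.

Definition is_local_martingale (R : realType) d (Omega : measurableType d)
    (Pr : probability Omega R) (F : R -> set (set Omega))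
    (Y : R -> Omega -> R) : Prop :=
  [/\ adapted F Y,
      {ae Pr, forall w, cadlag (fun t => Y t w)} &
      exists tau : nat -> Omega -> \bar R,
        [/\ (forall n, is_stopping_time F (tau n)),
            {ae Pr, forall w,
               (forall m n, (m <= n)%N -> (tau m w <= tau n w)%E) /\
               tau n w @[n --> \oo] --> +oo%E} &
            (forall n, is_martingale Pr F (stopped (tau n) Y))]].

Definition predictable_sets (R : realType) (Omega : Type)
    (F : R -> set (set Omega)) : set (set (R * Omega)) :=
  <<s `[0, +oo[%classic `*` setT,
      [set C | (exists A, F 0 A /\ C = [set 0] `*` A) \/
               (exists s t A, [/\ 0 <= s, s <= t, F s A &
                                  C = `]s, t]%classic `*` A])] >>.

Definition predictable (R : realType) (Omega : Type)
    (F : R -> set (set Omega)) (Y : R -> Omega -> R) : Prop :=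
  forall B : set R, measurable B ->
    predictable_sets F [set z | 0 <= z.1 /\ B (Y z.1 z.2)].

(* [s] lists the points after 0 of a partition of [0,t], so the partition
   points are the items of [0 :: s]. *)
Definition covariation_sum (R : realType) (Omega : Type)
    (M N : R -> Omega -> R) (t : R) (s : seq R) (w : Omega) : R :=
  let u := nth t (0 :: s) in
  \sum_(0 <= i < size s)
    (M (u i.+1) w - M (u i) w) * (N (u i.+1) w - N (u i) w).

Definition mesh_lt (R : realType) (t : R) (s : seq R) (delta : R) : Prop :=
  forall i, (i < size s)%N ->
    nth t (0 :: s) i.+1 - nth t (0 :: s) i < delta.

(* The quadratic covariation [M,N], started at 0, as the limit in probability
   of the sums of products of increments as the mesh tends to 0.  It is
   determined up to indistinguishability, whence a relation; as the filtration
   need not be complete, regularity of paths is only asked almost surely. *)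
Definition is_quadratic_covariation (R : realType) d
    (Omega : measurableType d) (Pr : probability Omega R)
    (F : R -> set (set Omega)) (M N Q : R -> Omega -> R) : Prop :=
  [/\ adapted F Q,
      {ae Pr, forall w, cadlag (fun t => Q t w)} &
      forall t, 0 <= t -> forall eps eta, 0 < eps -> 0 < eta ->
        exists2 delta, 0 < delta &
          forall s, itv_partition 0 t s -> mesh_lt t s delta ->
            (Pr [set w | (eps <= `|covariation_sum M N t s w - Q t w|)%R]
               <= eta%:E)%E].

(* [A] is the compensator of [Q]: the predictable process of finite variation
   started at 0 such that [Q - A] is a local martingale. *)
Definition is_compensator (R : realType) d (Omega : measurableType d)
    (Pr : probability Omega R) (F : R -> set (set Omega))
    (Q A : R -> Omega -> R) : Prop :=
  [/\ predictable F A,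
      {ae Pr, forall w, A 0 w = 0},
      {ae Pr, forall w, cadlag (fun t => A t w)},
      {ae Pr, forall w, forall t, 0 <= t ->
         bounded_variation 0 t (fun s => A s w)} &
      is_local_martingale Pr F (fun t w => Q t w - A t w)].

(* [A] is a version of <M,N>; in particular [M,N] has to exist. *)
Definition is_compensated_covariation (R : realType) d
    (Omega : measurableType d) (Pr : probability Omega R)
    (F : R -> set (set Omega)) (M N A : R -> Omega -> R) : Prop :=
  exists Q, is_quadratic_covariation Pr F M N Q /\ is_compensator Pr F Q A.

Definition M_process (R : realType) (Omega E : Type) (PP : set (E -> R))
    (T : R -> (E -> R) -> (E -> R)) (X : R -> Omega -> E) (r : E -> R) :
    R -> Omega -> R :=
  fun t w => r (X t w) - r (X 0 w) -
    \int[lebesgue_measure]_(s in `[0, t]) generator PP T r (X s w).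

Definition carre_du_champ (R : realType) (E : Type) (PP : set (E -> R))
    (T : R -> (E -> R) -> (E -> R)) (p q : E -> R) : E -> R :=
  fun x => generator PP T (p * q) x - p x * generator PP T q x
           - q x * generator PP T p x.

(* Main.v *)
Require Import Defs.
From HB Require Import structures.
From mathcomp Require Import all_boot all_order all_algebra.
From mathcomp Require Import all_classical all_reals all_analysis.
From mathcomp Require Import measurable_realfun ring lra.

Set Implicit Arguments.
Unset Strict Implicit.
Unset Printing Implicit Defensive.

Import Order.TTheory GRing.Theory Num.Theory.
Import numFieldNormedType.Exports.

Local Open Scope classical_set_scope.
Local Open Scope ring_scope.

(** Local finiteness and right-continuity make the span of the orbit of a
    polynomial finite-dimensional, with [T] acting on it as a matrix semigroup,
    so the generator is defined everywhere and Dynkin's formula holds.  For [p]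
    of degree at most 1 this makes [M p] a square integrable martingale with
      [E[(M_t - M_s)^2 ; A] = E[int_s^t a_{p,p}(X_v) dv ; A]]  for [A] in [F_s],
    where either of the hypotheses (1) and (2) provides an element of [P]
    dominating [|a_{p,p}|].  Since
      [sum (M_{u_{i+1}} - M_{u_i})^2 = M_t^2 - 2 sum M_{u_i} (M_{u_{i+1}} - M_{u_i})],
    it suffices that the left-point sums converge in [L^1] as the mesh tends
    to 0.  If [M_u] is replaced by 0 once [sup |M|] exceeds [K], the isometry of
    elementary stochastic integrals and dominated convergence make them Cauchy
    in [L^2]; the truncation error is controlled, uniformly in the partition,
    by the expectation over [{sup |M| > K}] of the integrated bound of
    [|a_{p,p}|].  Doob's maximal inequality along a fast subsequence of grids
    yields a limit [Q] with almost surely cadlag paths, and [Q - int a_{p,p}]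
    is a true martingale because the left-point sums are.  Polarization then
    treats [p] and [q]. *)

(** * Paths *)

(** Local finiteness gives a relation for each step [h] separately, with coefficients depending on
    [h]. Vanishing determinants of the values [T_s p (x)] do not mention these coefficients, and
    sampling at times with a common denominator lets one [h] serve; a nonzero determinant of maximal
    size then interpolates the whole orbit.

    The integrand alone is truncated, which avoids stopping [M]. The removed part runs over the
    indices after [K] is exceeded, and summation by parts expresses it through [M_t] and sums
    bounded independently of the partition.

    The filtration need not be complete, so an adapted process cannot be modified on null sets: [Q]
    comes from an upper limit, measurable at each time, and its paths are cadlag almost surely. A
    bound of [|a_{p,p}|] is sought inside P because expectations of its nonnegative elements are
    locally bounded in time, which Fubini requires. *)

Section joint_measurability.
Context (R : realType).
Implicit Types f : R -> R.

Definition right_continuous f := forall t, f s @[s --> t^'+] --> f t.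

(** Paths are constrained at nonnegative times only; clamping time to [[a, b]] makes them
    right-continuous on the whole line. *)
Definition clamp (a b t : R) := Num.max a (Num.min t b).

Lemma clamp_itv a b t : a <= b -> a <= clamp a b t <= b.
Proof. by move=> ab; rewrite /clamp le_max lexx/= ge_max ab ge_min lexx orbT. Qed.

Lemma clamp_id a b t : a <= t <= b -> clamp a b t = t.
Proof. by move=> /andP[at_ tb]; rewrite /clamp min_l// max_r. Qed.

Lemma right_continuous_clamp f a b : 0 <= a -> a <= b -> cadlag f ->
  right_continuous (fun t => f (clamp a b t)).
Proof.
move=> a0 ab [rf _] t.
have [ta|at_] := ltP t a.
  apply: cvg_near_cst; near=> s; congr f; rewrite /clamp; have sa : s < a by near: s; exact: nbhs_right_lt.
  by rewrite !max_l// ge_min ltW// orbT// ltW.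
have [tb|bt] := ltP t b.
  rewrite [in X in _ --> X]clamp_id ?at_ ?ltW//.
  apply: cvg_trans (rf t (le_trans a0 at_)); apply: near_eq_cvg; near=> s; rewrite clamp_id//.
  apply/andP; split; first by rewrite (le_trans at_)// ltW//; near: s; exact: nbhs_right_gt.
  by apply: ltW; near: s; exact: nbhs_right_lt.
apply: cvg_near_cst; near=> s; congr f; rewrite /clamp; have sa : t < s by near: s; exact: nbhs_right_gt.
by rewrite !min_r// (le_trans bt)// ltW.
Unshelve. all: by end_near. Qed.

(** Floor plus 1 rather than ceiling: the value is strictly above [t] even when [t] is a grid point,
    so right limits at [t] apply to the sequence. *)
Definition next_grid (n : nat) (t : R) : R :=
  (Num.floor (t * n.+1%:R) + 1)%:~R / n.+1%:R.

Lemma next_grid_gt n t : t < next_grid n t.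
Proof. by rewrite /next_grid ltr_pdivlMr// floorD1_gt. Qed.

Lemma next_grid_le n t : next_grid n t <= t + n.+1%:R^-1.
Proof.
rewrite /next_grid ler_pdivrMr// mulrDl mulVf ?pnatr_eq0// intrD lerD2r.
exact: floor_le.
Qed.

Lemma cvg_next_grid t : next_grid n t @[n --> \oo] --> t.
Proof.
apply: (squeeze_cvgr (f := cst t) (h := fun n => t + n.+1%:R^-1)).
- by near=> n; rewrite next_grid_le ltW// next_grid_gt.
- exact: cvg_cst.
- rewrite -[X in _ --> X]addr0; apply: cvgD; first exact: cvg_cst.
  exact: cvg_harmonic.
Unshelve. all: by end_near. Qed.

(** A right-continuous process is the pointwise limit of [Y (next_grid n t)], whose preimages are
    countable unions of measurable rectangles. *)
Lemma measurable_joint d (T : measurableType d) (Y : R -> T -> R) :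
  (forall t, measurable_fun setT (Y t)) ->
  (forall w, right_continuous (Y ^~ w)) ->
  measurable_fun setT (fun z : T * measurableTypeR R => Y z.2 z.1).
Proof.
move=> mY rY.
apply: (@measurable_fun_cvg _ _ _ _
  (fun n (z : T * measurableTypeR R) => Y (next_grid n z.2) z.1)); last first.
  move=> [w t] _ /=; have /cvg_at_rightP := rY w t; apply; split.
    by move=> n; exact: next_grid_gt.
  exact: cvg_next_grid.
move=> n _ B mB; rewrite setTI.
pose q (k : int) : R := (k + 1)%:~R / n.+1%:R.
rewrite [X in measurable X](_ : _ = \bigcup_(k : int)
  ((Y (q k) @^-1` B) `*` `[k%:~R / n.+1%:R, q k[ : set (T * measurableTypeR R))).
  apply: countable_bigcupT_measurable => // k; apply: measurableX => //.
  by rewrite -[X in measurable X]setTI; exact: mY.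
apply/seteqP; split => [[w t] /= BY|[w t] [k _ [/= BY]]].
  exists (Num.floor (t * n.+1%:R)) => //=; split => //.
  by rewrite in_itv/= ler_pdivrMr// floor_le/= ltr_pdivlMr// floorD1_gt.
rewrite in_itv/= ler_pdivrMr// ltr_pdivlMr// => kt.
by rewrite /next_grid (floor_def kt).
Qed.

End joint_measurability.

Section cadlag_paths.
Context (R : realType).
Implicit Types f g : R -> R.
Local Notation mu := (@lebesgue_measure R).

(** The one-sided limits bound [f] near each point of [[0, t]]; compactness, in its near-covering
    form, makes one large [K] serve all points. *)
Lemma cadlag_bounded f t : cadlag f ->
  exists2 K, 0 <= K & forall s, 0 <= s <= t -> `|f s| <= K.
Proof.
move=> [rf lf].
have := @segment_compact R 0 t; rewrite compact_near_coveringP => cov.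
have /= := cov R +oo%R (fun K x => 0 <= x -> `|f x| <= K) _.
move=> /(_ _)[x|K [Kr KP]].
  rewrite /= in_itv/= => /andP[x0 xt].
  have rx : \forall s \near x, x < s -> `|f s - f x| <= 1.
    have /cvgrPdist_le /(_ 1 ltr01) := rf x x0.
    by apply: filterS => s; rewrite distrC.
  have [l lx] : exists l : R, \forall s \near x, s < x -> 0 <= s -> `|f s - l| <= 1.
    move: x0; rewrite le_eqVlt => /predU1P[<-|x0].
      (* At time 0 there is no left limit, and none is needed: no [s >= 0] lies to its left. *)
      by exists 0; near=> s => s0; rewrite leNgt s0.
    have /cvg_ex[/= l fl] := lf x x0; exists l.
    have /cvgrPdist_le /(_ 1 ltr01) := fl.
    by apply: filterS => s; rewrite distrC.
  exists ([set s | (x < s -> `|f s - f x| <= 1) /\ (s < x -> 0 <= s -> `|f s - l| <= 1)],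
    [set K | `|f x| + `|l| + 1 <= K]) => /=.
    split; first by near=> s; split; near: s.
    exact: nbhs_pinfty_ge.
  move=> [s K] /= [[rs ls] xK] s0.
  apply: le_trans xK; have [sx|xs|->] := ltgtP s x.
  - have := ls sx s0.
    move: (f s) (f x) => y z h; rewrite -(subrK l y) (le_trans (ler_normD _ _))//.
    by have := normr_ge0 z; lra.
  - have := rs xs; move: (f s) (f x) => y z h.
    rewrite -(subrK z y) (le_trans (ler_normD _ _))//.
    by have := normr_ge0 l; lra.
  - by have := normr_ge0 l; lra.
exists (Num.max 0 (K + 1)); first by rewrite le_max lexx.
move=> s s0t; rewrite le_max; apply/orP; right.
apply: (KP (K + 1) _ s) => /=; first by rewrite ltrDl.
- by rewrite in_itv.
- by case/andP: s0t.
Unshelve. all: by end_near. Qed.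

Lemma cadlag_cst (c : R) : cadlag (cst c).
Proof. by split=> t _; [exact: cvg_cst|exact: is_cvg_cst]. Qed.

Lemma cadlagD f g : cadlag f -> cadlag g -> cadlag (fun t => f t + g t).
Proof.
move=> [rf lf] [rg lg]; split=> t t0; first by apply: cvgD; auto.
by apply: is_cvgD; auto.
Qed.

Lemma cadlagM f g : cadlag f -> cadlag g -> cadlag (fun t => f t * g t).
Proof.
move=> [rf lf] [rg lg]; split=> t t0; first by apply: cvgM; auto.
by apply: is_cvgM; auto.
Qed.

Lemma cadlagZ f (c : R) : cadlag f -> cadlag (fun t => c * f t).
Proof. by move=> cf; apply: cadlagM => //; exact: cadlag_cst. Qed.

Lemma cadlagN f : cadlag f -> cadlag (fun t => - f t).
Proof.
by move=> /cadlagZ -/(_ (-1)); under eq_fun do rewrite mulN1r.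
Qed.

Lemma cadlagB f g : cadlag f -> cadlag g -> cadlag (fun t => f t - g t).
Proof. by move=> cf cg; apply: cadlagD => //; exact: cadlagN. Qed.

Lemma cadlag_norm f : cadlag f -> cadlag (fun t => `|f t|).
Proof.
move=> [rf lf]; split=> t t0; first by apply: cvg_norm; exact: rf.
by apply: is_cvg_norm; exact: lf.
Qed.

Lemma cadlag_sum (I : Type) (s : seq I) (F : I -> R -> R) :
  (forall i, cadlag (F i)) -> cadlag (fun t => \sum_(i <- s) F i t).
Proof.
move=> cF; elim: s => [|i s ih].
  by under eq_fun do rewrite big_nil; exact: cadlag_cst.
by under eq_fun do rewrite big_cons; exact: cadlagD.
Qed.

End cadlag_paths.

(** * Measurability and Fubini for integrals along paths *)

Section path_integrals.
Context (R : realType) d (T : measurableType d).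
Variables (Y : R -> T -> R) (a b : R).
Local Notation mu := (@lebesgue_measure R).
Hypotheses (a0 : 0 <= a) (ab : a <= b) (cY : forall w, cadlag (Y ^~ w))
  (mY : forall t, a <= t <= b -> measurable_fun setT (Y t)).

(** Clamping gives joint measurability on the full product, and the indicator cuts back to [[a, b]];
    Fubini can then be applied without restricting the domain. *)
Let g (z : T * measurableTypeR R) : R := Y (clamp a b z.2) z.1 * \1_`[a, b] z.2.

Let mg : measurable_fun setT g.
Proof.
apply: measurable_funM.
  apply: (measurable_joint (Y := fun t => Y (clamp a b t))) => [t|w].
    by apply: mY; exact: clamp_itv.
  exact: (right_continuous_clamp a0 ab (cY w)).
apply: (measurableT_comp (f := \1_`[a, b] : measurableTypeR R -> R)) => //.
Qed.

Let gE w s : g (w, s) = ((Y ^~ w) \_ `[a, b]) s.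
Proof.
rewrite /g /= /patch indicE; case: ifPn => [|_]; last by rewrite mulr0.
by rewrite inE/= in_itv/= => ?; rewrite mulr1 clamp_id.
Qed.

Lemma cadlag_measurable w : measurable_fun `[a, b] (Y ^~ w).
Proof.
apply: (measurable_restrictT (Y ^~ w) (measurable_itv `[a, b])).2.
rewrite (_ : _ \_ _ = fun s : measurableTypeR R => g (w, s)); first exact: measurableT_comp.
by apply/funext => s; rewrite gE.
Qed.

Lemma cadlag_integrable w : mu.-integrable `[a, b] (EFin \o Y ^~ w).
Proof.
have [K _ YK] := cadlag_bounded b (cY w).
apply: measurable_bounded_integrable => //.
- by rewrite /= lebesgue_measure_itv/=; case: ifP => _ //; rewrite -EFinB ltry.
- exact: cadlag_measurable.
- exists K; split; first exact: num_real.
  move=> x Kx y /=; rewrite in_itv/= => /andP[ay yb].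
  by apply: (le_trans _ (ltW Kx)); apply: YK; rewrite yb andbT (le_trans a0).
Qed.

Let intE w : (\int[mu]_(s in `[a, b]) Y s w)%:E = (\int[mu]_s (g (w, s))%:E)%E.
Proof.
rewrite /Rintegral fineK; last exact: integrable_fin_num (cadlag_integrable w).
rewrite [LHS]integral_mkcond; apply: eq_integral => s _.
by rewrite gE restrict_EFin.
Qed.

Lemma measurable_path_integral :
  measurable_fun setT (fun w => \int[mu]_(s in `[a, b]) Y s w).
Proof.
apply/measurable_EFinP.
rewrite (_ : _ \o _ = (fun w => \int[mu]_s (EFin \o g)^\+ (w, s)
  - \int[mu]_s (EFin \o g)^\- (w, s))%E); last first.
  apply/funext => w /=; rewrite intE [LHS]integralE.
  by congr (_ - _)%E; apply: eq_integral => s _; rewrite ?funeposE ?funenegE.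
have mEg : measurable_fun setT (EFin \o g) by exact/measurable_EFinP.
apply: emeasurable_funB.
  apply: (measurable_fun_fubini_tonelli_F (m2 := mu) (EFin \o g)^\+%E).
    exact: measurable_funepos.
  by move=> z; exact: funepos_ge0.
apply: (measurable_fun_fubini_tonelli_F (m2 := mu) (EFin \o g)^\-%E).
  exact: measurable_funeneg.
by move=> z; exact: funeneg_ge0.
Qed.

Variables (P : {sigma_finite_measure set T -> \bar R}) (C : R).
Hypothesis YC : forall t, a <= t <= b -> (\int[P]_w `|Y t w|%:E <= C%:E)%E.

(** By Tonelli, the uniform bound [C] on [[a, b]] bounds the double integral by that of [C] over the
    interval. *)
Let ig : (P \x mu)%E.-integrable setT (EFin \o g).
Proof.
apply/integrable21ltyP; first exact/measurable_EFinP.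
pose h (s : measurableTypeR R) := C * \1_`[a, b] s.
have mh : measurable_fun setT h.
  by apply: measurable_funM => //; exact: measurable_indic.
apply: (@le_lt_trans _ _ (\int[mu]_s (h s)%:E)%E).
  apply: ge0_le_integral => //.
  - by move=> s _; exact: integral_ge0.
  - have := @measurable_fun_fubini_tonelli_G _ _ _ _ R P (fun z => `|g z|%:E)%E.
    by apply => //; apply/measurable_EFinP; exact: measurableT_comp.
  - exact/measurable_EFinP.
  - move=> s _; rewrite /h.
    rewrite (eq_integral (fun w => (`|((Y ^~ w) \_ `[a, b]) s|%R)%:E)); last first.
      by move=> w _ /=; rewrite gE.
    rewrite /patch indicE; have [|_] := boolP (s \in _); last first.
      under eq_integral do rewrite normr0.
      by rewrite mulr0 integral_cst// mul0e.
    by rewrite inE/= in_itv/= mulr1 => ?; exact: YC.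
have h1 := @integrable_indic_itv R a b true false.
have /integrableP[_] := integrableZl measurableT C h1.
apply: le_lt_trans; apply: le_trans (le_abse_integral _ _ _) => //.
  exact: lee_abs.
exact/measurable_EFinP.
Qed.

Lemma integrable_path_integral :
  P.-integrable setT (fun w => (\int[mu]_(s in `[a, b]) Y s w)%:E).
Proof.
have := integrable_fubini_F ig.
by congr (_.-integrable _ _); apply/funext => w; rewrite intE.
Qed.

Lemma Rintegral_path_integral :
  \int[P]_w \int[mu]_(s in `[a, b]) Y s w =
  \int[mu]_(s in `[a, b]) \int[P]_w Y s w.
Proof.
rewrite /Rintegral; congr fine.
under eq_integral do rewrite [X in X%:E]/= -/(Rintegral _ _ _) intE.
have /= -> := Fubini ig; rewrite [RHS]integral_mkcond.
apply: eq_integral => s _; under eq_integral do rewrite gE.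
rewrite /patch; have [|_] := boolP (s \in _); last by rewrite integral_cst// mul0e.
rewrite inE/= in_itv/= => sab; rewrite fineK//.
apply: integrable_fin_num => //; apply/integrableP; split.
  by apply/measurable_EFinP; exact: mY.
exact: (le_lt_trans (YC sab) (ltry _)).
Qed.

End path_integrals.

Lemma Rintegral_lincomb (R : realType) d (T : measurableType d)
    (m : {measure set T -> \bar R}) (D : set T) (I : Type) (s : seq I)
    (k : I -> R) (f : I -> T -> R) : measurable D ->
  (forall i, m.-integrable D (EFin \o f i)) ->
  m.-integrable D (EFin \o (fun x => \sum_(i <- s) k i * f i x)) /\
  \int[m]_(x in D) (\sum_(i <- s) k i * f i x) =
  \sum_(i <- s) k i * \int[m]_(x in D) f i x.
Proof.
move=> mD lf; elim: s => [|i s [ih1 ih2]].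
  split.
    rewrite (_ : _ \o _ = cst 0%E); first exact: integrable0.
    by apply/funext => x /=; rewrite big_nil.
  under eq_Rintegral do rewrite big_nil.
  by rewrite big_nil Rintegral_cst// mul0r.
have lk : m.-integrable D (EFin \o (fun x => k i * f i x)).
  exact: (integrableZl mD (k i) (lf i)).
split.
  pose g x := k i * f i x; pose h x := \sum_(i <- s) k i * f i x.
  rewrite (_ : _ \o _ = ((EFin \o g) \+ (EFin \o h))%E); first exact: integrableD.
  by apply/funext => x /=; rewrite big_cons.
under eq_Rintegral do rewrite big_cons.
by rewrite big_cons -ih2 RintegralD// RintegralZl.
Qed.

Section cadlag_integrals.
Context (R : realType).
Implicit Types (f g : R -> R) (a b c : R).
Local Notation mu := (@lebesgue_measure R).

Lemma cadlag_integrable_itv f a b : 0 <= a -> cadlag f ->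
  mu.-integrable `[a, b] (EFin \o f).
Proof.
move=> a0 cf; have [ab|ba] := leP a b; last first.
  by rewrite set_itv_ge ?bnd_simp -?ltNge//; exact: integrable_set0.
exact: (@cadlag_integrable R _ (measurableTypeR R) (fun t _ => f t) a b a0 ab
  (fun=> cf) (fun t _ => measurable_cst _) 0).
Qed.

Lemma cadlag_Rintegral_itvD f a b c : 0 <= a -> a <= b -> b <= c -> cadlag f ->
  \int[mu]_(s in `[a, c]) f s =
  \int[mu]_(s in `[a, b]) f s + \int[mu]_(s in `[b, c]) f s.
Proof.
move=> a0 ab bc cf; have := Rintegral_itvB (x := b) (cadlag_integrable_itv c a0 cf).
rewrite !bnd_simp => /(_ ab bc) h; rewrite -[X in _ + X]Rintegral_itv_obnd_cbnd.
  by rewrite -h addrC subrK.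
apply: integrableS (cadlag_integrable_itv c (le_trans a0 ab) cf) => //.
by apply: subset_itvr; rewrite bnd_simp.
Qed.

Lemma cadlag_Rintegral_sum (I : Type) (s : seq I) (k : I -> R) (f : I -> R -> R) a b :
  0 <= a -> (forall i, cadlag (f i)) ->
  \int[mu]_(x in `[a, b]) (\sum_(i <- s) k i * f i x) =
  \sum_(i <- s) k i * \int[mu]_(x in `[a, b]) f i x.
Proof.
by move=> a0 cf; apply: (Rintegral_lincomb _ _ _ _).2 => // i; exact: cadlag_integrable_itv.
Qed.

Lemma cadlag_RintegralZ (k : R) f a b : 0 <= a -> cadlag f ->
  \int[mu]_(x in `[a, b]) (k * f x) = k * \int[mu]_(x in `[a, b]) f x.
Proof. by move=> a0 cf; rewrite RintegralZl//; exact: cadlag_integrable_itv. Qed.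

Lemma cadlag_RintegralD f g a b : 0 <= a -> cadlag f -> cadlag g ->
  \int[mu]_(x in `[a, b]) (f x + g x) =
  \int[mu]_(x in `[a, b]) f x + \int[mu]_(x in `[a, b]) g x.
Proof. by move=> a0 cf cg; rewrite RintegralD//; exact: cadlag_integrable_itv. Qed.

Lemma cadlag_RintegralB f g a b : 0 <= a -> cadlag f -> cadlag g ->
  \int[mu]_(x in `[a, b]) (f x - g x) =
  \int[mu]_(x in `[a, b]) f x - \int[mu]_(x in `[a, b]) g x.
Proof. by move=> a0 cf cg; rewrite RintegralB//; exact: cadlag_integrable_itv. Qed.

Lemma Rintegral_itv_cst k a b : a <= b -> \int[mu]_(x in `[a, b]) k = k * (b - a).
Proof.
rewrite le_eqVlt Rintegral_cst//= lebesgue_measure_itv/= lte_fin.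
by move=> /predU1P[->|->]; rewrite ?ltxx ?subrr// -EFinB.
Qed.

Lemma Rintegral_itv11 f a : \int[mu]_(x in `[a, a]) f x = 0.
Proof. by rewrite set_itv1 Rintegral_set1. Qed.

Lemma cadlag_le_Rintegral f g a b : 0 <= a -> cadlag f -> cadlag g ->
  (forall x, a <= x <= b -> f x <= g x) ->
  \int[mu]_(x in `[a, b]) f x <= \int[mu]_(x in `[a, b]) g x.
Proof.
move=> a0 cf cg fg; apply: le_Rintegral => //; exact: cadlag_integrable_itv.
Qed.

Lemma cadlag_normr_Rintegral f a b : 0 <= a -> cadlag f ->
  `|\int[mu]_(x in `[a, b]) f x| <= \int[mu]_(x in `[a, b]) `|f x|.
Proof. by move=> a0 cf; apply: le_normr_Rintegral => //; exact: cadlag_integrable_itv. Qed.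

Lemma cadlag_Rintegral_le f k a b : 0 <= a -> a <= b -> cadlag f ->
  (forall x, a <= x <= b -> `|f x| <= k) ->
  `|\int[mu]_(x in `[a, b]) f x| <= k * (b - a).
Proof.
move=> a0 ab cf fk; rewrite (le_trans (cadlag_normr_Rintegral _ _ _))//.
rewrite -Rintegral_itv_cst//; apply: cadlag_le_Rintegral => //.
- exact: cadlag_norm.
- exact: cadlag_cst.
Qed.

Lemma cvg_Rintegral_avg f : cadlag f ->
  h^-1 * \int[mu]_(x in `[0, h]) f x @[h --> 0^'+] --> f 0.
Proof.
move=> cf; apply/cvgrPdist_le => e e0.
have [rf _] := cf; have /cvgrPdist_le/(_ e e0) := rf 0 (lexx _).
move=> /nbhs_right0P [d /= d0 fd]; near=> h.
have h0 : 0 < h by near: h; exact: nbhs_right_gt.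
have -> : f 0 - h^-1 * \int[mu]_(x in `[0, h]) f x =
    h^-1 * \int[mu]_(x in `[0, h]) (f 0 - f x).
  rewrite cadlag_RintegralB//; last exact: cadlag_cst.
  by rewrite Rintegral_itv_cst ?ltW// subr0; field; rewrite gt_eqF.
rewrite normrM gtr0_norm ?invr_gt0// ler_pdivrMl// mulrC.
rewrite -[X in e * X]subr0; apply: cadlag_Rintegral_le => //.
  by apply: cadlagB => //; exact: cadlag_cst.
move=> x /andP[]; rewrite le_eqVlt => /predU1P[<- _|x0 xh].
  by rewrite subrr normr0 ltW.
have := fd x; rewrite add0r; apply => //=.
rewrite sub0r normrN gtr0_norm// (le_lt_trans xh)//.
Unshelve. all: by end_near. Qed.

End cadlag_integrals.

Section translation.
Context (R : realType).
Local Notation mu := (@lebesgue_measure R).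

(** Uniqueness of Lebesgue measure: the pushforward has the same values on half-open intervals. *)
Lemma lebesgue_measure_translation (c : R) (A : set R) : measurable A ->
  pushforward mu (fun x => x + c : measurableTypeR R) A = mu A.
Proof.
move=> mA; apply/esym.
have mc : measurable_fun setT (fun x : measurableTypeR R => x + c : measurableTypeR R).
  exact: measurable_funD.
apply: (@lebesgue_measure_unique _ (pushforward mu (fun x => x + c : measurableTypeR R)))
  => //= _ [[a b]] _ <-.
rewrite /pushforward (_ : _ @^-1` _ = `]a - c, b - c]%classic); last first.
  by apply/seteqP; split=> x /=; rewrite !in_itv/= ltrBlDr lerBrDr.
rewrite !lebesgue_measure_itv/= !lte_fin ltrD2r.
by case: ifP => // _; rewrite -!EFinB; congr EFin; ring.
Qed.

Lemma Rintegral_shift (f : R -> R) (a b c : R) :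
  mu.-integrable `[a + c, b + c] (EFin \o f) ->
  \int[mu]_(x in `[a + c, b + c]) f x = \int[mu]_(x in `[a, b]) f (x + c).
Proof.
move=> intf; congr fine.
pose phi (x : measurableTypeR R) : measurableTypeR R := x + c.
have mc : measurable_fun setT phi by exact: measurable_funD.
rewrite [LHS]integral_mkcond [RHS]integral_mkcond.
set h := (fun x => (f x)%:E) \_ _.
transitivity (\int[pushforward mu phi]_x h x)%E.
  apply: eq_measure_integral => A mA _; exact/esym/lebesgue_measure_translation.
have ih : mu.-integrable setT h by rewrite -integrable_mkcond.
have mh := measurable_int _ ih.
rewrite integral_pushforward//.
- rewrite preimage_setT; apply: eq_integral => x _; rewrite /h /= /patch.
  by rewrite !mem_setE !in_itv/= !lerD2r.
- rewrite preimage_setT; apply/integrableP; split; first exact: measurableT_comp.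
  have /integrableP[_] := ih; congr (_ < _)%E.
  transitivity (\int[pushforward mu phi]_x `|h x|)%E.
    apply: eq_measure_integral => A mA _; exact/esym/lebesgue_measure_translation.
  by rewrite ge0_integral_pushforward//; exact: measurableT_comp.
Qed.

End translation.

(** * Primitives of cadlag functions *)

Section primitives.
Context (R : realType).
Implicit Types f g : R -> R.
Local Notation mu := (@lebesgue_measure R).

(** Cauchy-Schwarz against the constant 1: with [L = b - a] and [m] the integral of [f], the
    integral of [(L f - m)^2] equals [L] times the right-hand side minus the left-hand side. *)
Lemma sqr_Rintegral_le f (a b : R) : 0 <= a -> a <= b -> cadlag f ->
  (\int[mu]_(x in `[a, b]) f x) ^+ 2 <= (b - a) * \int[mu]_(x in `[a, b]) (f x ^+ 2).
Proof.
move=> a0; rewrite le_eqVlt => /predU1P[<-|ab] cf.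
  by rewrite !Rintegral_itv11 subrr mul0r expr0n.
set m := \int[mu]_(x in _) f x; set L := b - a.
have L0 : 0 < L by rewrite subr_gt0.
have cf2 : cadlag (fun x => f x ^+ 2) by exact: cadlagM.
have : 0 <= \int[mu]_(x in `[a, b]) (L * f x - m) ^+ 2.
  by apply: Rintegral_ge0 => x _; rewrite sqr_ge0.
rewrite (_ : \int[mu]_(x in _) _ =
    \int[mu]_(x in `[a, b]) (L ^+ 2 * f x ^+ 2 + (m ^+ 2 - (2 * L * m) * f x))); last first.
  by apply: eq_Rintegral => x _; ring.
rewrite cadlag_RintegralD//; last 2 first.
- exact: cadlagZ.
- by apply: cadlagB; [exact: cadlag_cst|exact: cadlagZ].
rewrite cadlag_RintegralB//; last 2 first.
- exact: cadlag_cst.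
- exact: cadlagZ.
rewrite Rintegral_itv_cst ?(ltW ab)// !cadlag_RintegralZ// -/m -/L.
set q := \int[mu]_(x in _) _ => h.
rewrite -(ler_pM2l L0) -subr_ge0; apply: le_trans h _.
by rewrite le_eqVlt; apply/orP; left; apply/eqP; ring.
Qed.

Lemma primitive_lipschitz f (t : R) : cadlag f -> exists2 K : R, 0 <= K &
  forall u v, 0 <= u -> u <= v -> v <= t ->
  `|\int[mu]_(x in `[0, v]) f x - \int[mu]_(x in `[0, u]) f x| <= K * (v - u).
Proof.
move=> cf; have [K K0 fK] := cadlag_bounded t cf; exists K => // u v u0 uv vt.
rewrite (@cadlag_Rintegral_itvD _ f 0 u v)// addrAC subrr add0r.
apply: cadlag_Rintegral_le => // x /andP[ux xv].
by apply: fK; rewrite (le_trans u0 ux) (le_trans xv vt).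
Qed.

Lemma primitive_cvg_left f (t : R) : cadlag f -> 0 < t ->
  \int[mu]_(x in `[0, s]) f x @[s --> t^'-] --> \int[mu]_(x in `[0, t]) f x.
Proof.
move=> cf t0; have [K K0 fK] := primitive_lipschitz t cf.
apply/cvgrPdist_le => e e0; near=> s.
have st : s <= t by near: s; exact: nbhs_left_le.
have s0 : 0 <= s by near: s; exact: nbhs_left_ge.
apply: (le_trans (fK s t s0 st (lexx _))).
have : t - s <= e / (K + 1).
  by apply: ltW; near: s; apply: nbhs_left_ltBl; rewrite divr_gt0// ltr_wpDl.
move=> /(ler_wpM2l K0)/le_trans; apply.
by rewrite mulrA ler_pdivrMr ?ltr_wpDl// mulrC ler_wpM2l ?ltW// ltrDl.
Unshelve. all: by end_near. Qed.

Lemma primitive_cvg_right f (t : R) : cadlag f -> 0 <= t ->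
  \int[mu]_(x in `[0, s]) f x @[s --> t^'+] --> \int[mu]_(x in `[0, t]) f x.
Proof.
move=> cf t0; have [K K0 fK] := primitive_lipschitz (t + 1) cf.
apply/cvgrPdist_le => e e0; near=> s.
have ts : t <= s by near: s; exact: nbhs_right_ge.
have st : s <= t + 1 by near: s; apply: nbhs_right_le; rewrite ltrDl.
rewrite distrC; apply: (le_trans (fK t s t0 ts st)).
have : s - t <= e / (K + 1).
  by apply: ltW; near: s; apply: nbhs_right_ltDr; rewrite divr_gt0// ltr_wpDl.
move=> /(ler_wpM2l K0)/le_trans; apply.
by rewrite mulrA ler_pdivrMr ?ltr_wpDl// mulrC ler_wpM2l ?ltW// ltrDl.
Unshelve. all: by end_near. Qed.

Lemma primitive_cadlag f : cadlag f -> cadlag (fun t => \int[mu]_(x in `[0, t]) f x).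
Proof.
move=> cf; split=> t t0; first exact: primitive_cvg_right.
by apply/cvg_ex; exists (\int[mu]_(x in `[0, t]) f x); exact: primitive_cvg_left.
Qed.

Lemma cadlag_indic_ge (u : R) : cadlag (\1_`[u, +oo[ : R -> R).
Proof.
have geE s : (\1_`[u, +oo[ : R -> R) s = (u <= s)%R%:R.
  by rewrite indicE mem_setE in_itv/= andbT.
split=> t t0.
  rewrite geE; have [ut|tu] := leP u t.
    apply: cvg_near_cst; near=> s; have ts : t < s by near: s; exact: nbhs_right_gt.
    by rewrite geE (le_trans ut)// ltW.
  apply: cvg_near_cst; near=> s; have su : s < u by near: s; exact: nbhs_right_lt.
  by rewrite geE leNgt su.
apply/cvg_ex; have [ut|tu] := ltP u t.
  exists 1; apply: cvg_near_cst; near=> s; have us : u < s by near: s; exact: nbhs_left_gt.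
  by rewrite geE ltW.
exists 0; apply: cvg_near_cst; near=> s; have st : s < t by near: s; exact: nbhs_left_lt.
by rewrite geE leNgt (lt_le_trans st).
Unshelve. all: by end_near. Qed.

(* Fubini over the triangle [a <= u <= v <= b], so that no differentiability of
   the primitive is needed. *)
Lemma Rintegral_primitive f (a b : R) : 0 <= a -> a <= b -> cadlag f ->
  2 * \int[mu]_(v in `[a, b]) (f v * \int[mu]_(u in `[a, v]) f u) =
  (\int[mu]_(v in `[a, b]) f v) ^+ 2.
Proof.
move=> a0 ab cf; pose h (u : measurableTypeR R) := f u * \1_`[a, b] u.
(* The triangle is read as a process in time [v] on the space of the points [u], with Lebesgue
   measure there, so that the exchange of integrals for path integrals applies. *)
pose Y (v : R) (u : measurableTypeR R) := h u * (f v * \1_`[u, +oo[ v).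
have mh : measurable_fun setT h.
  have ih : mu.-integrable setT ((fun u => (f u)%:E) \_ `[a, b]).
    by rewrite -integrable_mkcond//; exact: cadlag_integrable_itv.
  apply/measurable_EFinP; rewrite (_ : EFin \o h = (fun u => (f u)%:E) \_ `[a, b]).
    exact: measurable_int ih.
  by apply/funext => u; rewrite /h /patch /= indicE; case: ifP; rewrite ?mulr1 ?mulr0.
have cY u : cadlag (Y ^~ u).
  by apply: cadlagZ; apply: cadlagM => //; exact: cadlag_indic_ge.
have mY v : a <= v <= b -> measurable_fun setT (Y v).
  move=> _; apply: measurable_funM => //; apply: measurable_funM => //.
  rewrite (_ : (fun x => _) = \1_`]-oo, v]); first exact: measurable_indic.
  by apply/funext => u; rewrite !indicE !mem_setE !in_itv/= andbT.
have [K K0 fK] := cadlag_bounded b cf.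
have hK u : `|h u| <= K * \1_`[a, b] u.
  rewrite /h normrM [X in _ * X]ger0_norm; last by rewrite indicE.
  rewrite indicE; have [|_] := boolP (u \in _); last by rewrite !mulr0.
  by rewrite inE/= in_itv/= !mulr1 => /andP[au ub]; apply: fK; rewrite ub (le_trans a0).
have YC v : a <= v <= b -> (\int[mu]_u `|Y v u|%:E <= (K * K * (b - a))%:E)%E.
  move=> /andP[av vb].
  have -> : (K * K * (b - a))%:E = (\int[mu]_u (K * K * \1_`[a, b] u)%:E)%E.
    under eq_integral do rewrite EFinM; rewrite ge0_integralZl//.
    - rewrite integral_indic// setIT /= lebesgue_measure_itv/= lte_fin -EFinB.
      by case: ltgtP ab => // -> _; rewrite subrr mulr0 mule0.
    - by apply/measurable_EFinP; exact: measurable_indic.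
    - by rewrite lee_fin mulr_ge0.
  apply: ge0_le_integral => //.
  - do 2 apply: measurableT_comp => //; apply: mY; exact/andP.
  - apply/measurable_EFinP; apply: measurable_funM => //; exact: measurable_indic.
  - move=> u _; rewrite lee_fin /Y normrM (_ : K * K * _ = K * \1_`[a, b] u * K); last by ring.
    rewrite ler_pM// normrM -[X in _ <= X]mulr1 ler_pM//.
      by apply: fK; rewrite vb (le_trans a0).
    by rewrite indicE; case: (_ \in _); rewrite ?normr1 ?normr0.
have [P [cP PE]] : exists P : R -> R, cadlag P /\ forall u v, 0 <= u -> u <= v ->
    \int[mu]_(x in `[u, v]) f x = P v - P u.
  exists (fun u => \int[mu]_(x in `[0, u]) f x); split; first exact: primitive_cadlag.
  by move=> u v u0 uv; rewrite (@cadlag_Rintegral_itvD _ f 0 u v)// addrAC subrr add0r.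
have indE u v : (\1_`[u, +oo[ : R -> R) v = (u <= v)%R%:R.
  by rewrite indicE mem_setE in_itv/= andbT.
have E1 u : \int[mu]_(v in `[a, b]) Y v u = ((fun u => f u * (P b - P u)) \_ `[a, b]) u.
  rewrite /Y /h /patch indicE; have [|_] := boolP (u \in _); last first.
    rewrite mulr0; under eq_Rintegral do rewrite mul0r.
    by rewrite Rintegral_itv_cst// mul0r.
  rewrite inE/= in_itv/= mulr1 => /andP[au ub]; have u0 := le_trans a0 au.
  rewrite cadlag_RintegralZ//; last by apply: cadlagM => //; exact: cadlag_indic_ge.
  congr (_ * _); rewrite -PE// Rintegral_mkcond [RHS]Rintegral_mkcond.
  apply: eq_Rintegral => v _; rewrite /patch !mem_setE !in_itv/= indE.
  have [uv|vu] := leP u v; last by rewrite mulr0; case: ifP.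
  by rewrite mulr1 (le_trans au uv).
have E2 v : v \in `[a, b]%classic -> \int[mu]_u Y v u = f v * (P v - P a).
  rewrite inE/= in_itv/= => /andP[av vb].
  rewrite -PE// -cadlag_RintegralZ// [RHS]Rintegral_mkcond.
  apply: eq_Rintegral => u _; rewrite /Y /h /patch indicE !mem_setE !in_itv/= indE.
  have [uv|vu] := leP u v; last by rewrite !mulr0 andbF.
  rewrite (le_trans uv vb) andbT; case: (a <= u); rewrite !mulr1 ?mulr0 ?mul0r//.
  by rewrite mulrC.
have H : \int[mu]_(u in `[a, b]) (f u * (P b - P u)) =
    \int[mu]_(v in `[a, b]) (f v * (P v - P a)).
  transitivity (\int[mu]_u \int[mu]_(v in `[a, b]) Y v u).
    by rewrite [LHS]Rintegral_mkcond; apply: eq_Rintegral => u _; rewrite E1.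
  have -> : \int[mu]_u \int[mu]_(v in `[a, b]) Y v u =
      \int[mu]_(v in `[a, b]) \int[mu]_u Y v u.
    exact: (Rintegral_path_integral a0 ab cY mY YC).
  by apply: eq_Rintegral => v vab; rewrite E2.
have -> : \int[mu]_(v in `[a, b]) (f v * \int[mu]_(u in `[a, v]) f u) =
    \int[mu]_(v in `[a, b]) (f v * (P v - P a)).
  apply: eq_Rintegral => v; rewrite inE/= in_itv/= => /andP[av _].
  by rewrite PE.
have cB : cadlag (fun v => f v * (P v - P a)).
  by apply: cadlagM => //; apply: cadlagB => //; exact: cadlag_cst.
have cC : cadlag (fun v => f v * (P b - P v)).
  by apply: cadlagM => //; apply: cadlagB => //; exact: cadlag_cst.
(* By [H] the double is the sum of the integrals over both triangles, whose integrands add up to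
   [(P b - P a) * f v]. *)
have -> : 2 * \int[mu]_(v in `[a, b]) (f v * (P v - P a)) =
    \int[mu]_(v in `[a, b]) (f v * (P b - P v)) + \int[mu]_(v in `[a, b]) (f v * (P v - P a)).
  by rewrite H mulr_natl mulr2n.
rewrite -cadlag_RintegralD//.
transitivity (\int[mu]_(v in `[a, b]) ((P b - P a) * f v)).
  by apply: eq_Rintegral => v _; rewrite -mulrDr addrA subrK mulrC.
by rewrite cadlag_RintegralZ// PE// expr2.
Qed.

End primitives.

(** * The generator of a locally finite action *)

Section local_finiteness.
Context (R : realType) (E : Type) (PP : set (E -> R)) (deg : (E -> R) -> nat)
  (T : R -> (E -> R) -> (E -> R)).
Hypotheses (HPP : polynomial_space PP deg) (HT : polynomial_action PP deg T).

Lemma poly_sum (I : Type) (s : seq I) (c : I -> R) (f : I -> E -> R) :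
  (forall i, PP (f i)) -> PP (\sum_(i <- s) c i *: f i).
Proof.
move: HPP => [[PPc PPD PPZ] _] PPf.
elim/big_ind : _ => [|p q|i _]; [exact: (PPc 0)|exact: PPD|exact: PPZ].
Qed.

Lemma action_sum (I : Type) (s : seq I) (c : I -> R) (f : I -> E -> R) h :
  0 <= h -> (forall i, PP (f i)) ->
  T h (\sum_(i <- s) c i *: f i) = \sum_(i <- s) c i *: T h (f i).
Proof.
move: HPP HT => [[PPc PPD PPZ] _] [[TP Tl Td] _] h0 PPf.
elim: s => [|i s ih]; last first.
  by rewrite !big_cons Tl// ?ih//; exact: poly_sum.
rewrite !big_nil; have := Tl h h0 1 0 0 (PPc 0) (PPc 0).
by rewrite !scale1r addr0 -[LHS]addr0 => /addrI <-.
Qed.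

Lemma iter_action h p k : 0 <= h -> PP p -> iter k (T h) p = T (k%:R * h) p.
Proof.
move: HT => [_ [T0 TD _]] h0 PPp; elim: k => [|k ih]; first by rewrite mul0r T0.
by rewrite iterS ih TD// ?mulr_ge0// -natr1 mulrDl mul1r addrC.
Qed.

(** With [e] the last index carrying a nonzero coefficient, [T_h^e p] is a combination of the
    earlier iterates; applying [T_h] again and again keeps the whole orbit in their span. As [e] is
    an ordinal below [d.+1], at most [d] vectors are used. *)
Lemma dependent_orbit_span h p d (c : 'I_d.+1 -> R) : 0 <= h -> PP p ->
  (exists k, c k != 0) -> \sum_(k < d.+1) c k *: iter k (T h) p = 0 ->
  exists e : 'I_d.+1, forall n, exists b : 'I_e -> R,
    iter n (T h) p = \sum_(i < e) b i *: iter i (T h) p.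
Proof.
move=> h0 PPp [k0 ck0] c0.
have PPi n : PP (iter n (T h) p).
  by move: HT => [[TP _ _] _]; rewrite iter_action//; apply: TP => //; rewrite mulr_ge0.
pose e := [arg max_(i > k0 | (c i != 0)%R) (i : nat)]%N.
have [ce emax] : c e != 0 /\ forall i, c i != 0 -> (i <= e)%N.
  by rewrite /e; case: arg_maxnP.
exists e; pose Sp f := exists b : 'I_e -> R, f = \sum_(i < e) b i *: iter i (T h) p.
have SpD f g : Sp f -> Sp g -> Sp (f + g).
  move=> [a ->] [b ->]; exists (fun i => a i + b i).
  by rewrite -big_split; apply: eq_bigr => i _; rewrite scalerDl.
have SpZ a f : Sp f -> Sp (a *: f).
  move=> [b ->]; exists (fun i => a * b i).
  by rewrite scaler_sumr; apply: eq_bigr => i _; rewrite scalerA.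
have Splt n : (n < e)%N -> Sp (iter n (T h) p).
  move=> ne; exists (fun i => (i == Ordinal ne)%:R).
  rewrite (bigD1 (Ordinal ne))//= eqxx scale1r big1 ?addr0// => i /negbTE ->.
  by rewrite scale0r.
have Spe : Sp (iter e (T h) p).
  have -> : iter e (T h) p = - (c e)^-1 *: \sum_(k < d.+1 | k != e) c k *: iter k (T h) p.
    move: c0; rewrite (bigD1 e)//= => /eqP; rewrite addr_eq0 => /eqP ce0.
    by rewrite scaleNr -scalerN -ce0 scalerA mulVf// scale1r.
  apply: (SpZ); apply: (big_ind Sp) => [|//|i ie].
    by exists (cst 0); rewrite big1// => i _; rewrite scale0r.
  have [ci0|ci0] := eqVneq (c i) 0.
    by exists (cst 0); rewrite big1 ?ci0 ?scale0r// => j _; rewrite scale0r.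
  by apply: SpZ; apply: Splt; rewrite ltn_neqAle ie emax.
have SpS n : (n <= e)%N -> Sp (iter n (T h) p).
  by rewrite leq_eqVlt => /predU1P[->//|/Splt].
elim => [|n [b bE]]; first exact: SpS.
rewrite iterS bE action_sum//; apply: (big_ind Sp) => [|f g|i _].
- by exists (cst 0); rewrite big1// => i _; rewrite scale0r.
- exact: SpD.
- by apply: SpZ; rewrite -iterS; apply: SpS.
Qed.

(** The matrix factors through dimension [e < d.+1], so it is singular. The conclusion no longer
    mentions the coefficients of the relation, which vary with [h]. *)
Lemma dependent_orbit_det h p d (c : 'I_d.+1 -> R) (n : 'I_d.+1 -> nat)
    (x : 'I_d.+1 -> E) : 0 <= h -> PP p ->
  (exists k, c k != 0) -> \sum_(k < d.+1) c k *: iter k (T h) p = 0 ->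
  \det (\matrix_(i, j) T ((n i)%:R * h) p (x j)) = 0.
Proof.
move=> h0 PPp c0 cT; have [e eP] := dependent_orbit_span h0 PPp c0 cT.
have /choice[b bP] := fun i => eP (n i).
set A := \matrix_(i, j) _.
pose B : 'M[R]_(d.+1, e) := \matrix_(i, k) b i k.
pose C : 'M[R]_(e, d.+1) := \matrix_(k, j) iter k (T h) p (x j).
have AE : A = B *m C.
  apply/matrixP => i j; rewrite !mxE -iter_action// bP fct_sumE.
  by apply: eq_bigr => k _; rewrite !mxE.
apply/eqP; apply: contraTT (ltn_ord e) => detA; rewrite -leqNgt.
have := mulmx_max_rank B C; rewrite -AE mxrank_unit//.
by rewrite unitmxE unitfE.
Qed.

Hypothesis HTfin : locally_finite_action PP T.

(** The common denominator makes all times multiples of the single step [1 / N.+1], to which local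
    finiteness is applied. *)
Definition rational_orbit_mx p k N (n : 'I_k -> nat) (x : 'I_k -> E) :=
  \matrix_(i, j) T ((n i)%:R / N.+1%:R) p (x j).

(** Size 0 has the empty determinant 1 and size [d.+1] has only zero determinants, so somewhere in
    between a nonzero determinant exists at size [k] and none at [k.+1]. *)
Lemma maximal_orbit_mx p : PP p -> exists k,
  (exists N n x, \det (@rational_orbit_mx p k N n x) != 0) /\
  (forall N n x, \det (@rational_orbit_mx p k.+1 N n x) = 0).
Proof.
move=> PPp; have [d dP] := HTfin PPp.
pose P k := exists N n x, \det (@rational_orbit_mx p k N n x) != 0.
have P0 : P 0%N.
  exists 0%N, (fun=> 0%N), (fun i : 'I_0 => False_rect E (notF (ltn_ord i))).
  by rewrite det_mx00 oner_eq0.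
have Pd : ~ P d.+1.
  move=> [N [n [x]]]; have [|c [c0 cT]] := dP N.+1%:R^-1; first by rewrite invr_gt0.
  by rewrite (dependent_orbit_det _ _ _ PPp c0 cT) ?eqxx// invr_ge0.
have [k [Pk Pk1]] : exists k, P k /\ ~ P k.+1.
  apply: contrapT => h; apply: Pd; elim: d.+1 => // k Pk.
  by apply: contrapT => Pk1; apply: h; exists k.
exists k; split => // N n x; apply/eqP/negPn/negP => D0.
by apply: Pk1; exists N, n, x.
Qed.

(** Bordering the matrix of maximal size by one more time and one more point makes it singular, so
    its Schur complement vanishes. This interpolates [T_s p y], for every rational [s] and every
    [y], from the sampled points and times. *)
Lemma orbit_border p k N (n : 'I_k -> nat) (x : 'I_k -> E) :
  \det (rational_orbit_mx p N n x) != 0 ->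
  (forall N n x, \det (@rational_orbit_mx p k.+1 N n x) = 0) ->
  forall N' m y, T (m%:R / N'.+1%:R) p y =
   ((\row_j T (m%:R / N'.+1%:R) p (x j)) *m invmx (rational_orbit_mx p N n x) *m
     (\col_i T ((n i)%:R / N.+1%:R) p y)) 0 0.
Proof.
set W := rational_orbit_mx _ _ _ _ => W0 max N' m y.
have uW : W \in unitmx by rewrite unitmxE unitfE.
(* The new time has another denominator; over [NN.+1 = N.+1 * N'.+1] all times are multiples of one
   step. *)
pose NN := (N.+1 * N'.+1).-1.
have NNE : NN.+1%:R = N.+1%:R * N'.+1%:R :> R by rewrite /NN prednK// natrM.
pose n1 (i : 'I_(1 + k)) : nat :=
  match fintype.split i with inl _ => (m * N.+1)%N | inr i => (n i * N'.+1)%N end.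
pose x1 (i : 'I_(1 + k)) : E := match fintype.split i with inl _ => y | inr i => x i end.
set s := m%:R / _; set a := \row_j _; set c := \col_i _.
have D0 : \det (block_mx (T s p y)%:M a c W) = 0.
  rewrite -(max NN n1 x1); congr (\det _); apply/matrixP => i j.
  have t1 : (m * N.+1)%:R / NN.+1%:R = s.
    by rewrite NNE natrM /s; field; rewrite !nat1r !pnatr_eq0.
  have t2 l : (n l * N'.+1)%:R / NN.+1%:R = (n l)%:R / N.+1%:R :> R.
    by rewrite NNE natrM; field; rewrite !nat1r !pnatr_eq0.
  rewrite !mxE /n1 /x1; case: fintype.split => i'; rewrite !mxE; case: fintype.split => j'; rewrite !mxE ?t1 ?t2//.
  by rewrite !ord1 mulr1n.
have /eqP/det0P[v v0] := D0.
rewrite -[v]hsubmxK mul_row_block -row_mx0 => /eq_row_mx[].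
set v1 := lsubmx v; set v2 := rsubmx v => e1 e2.
have v2E : v2 = - (v1 *m a *m invmx W).
  by apply/eqP; rewrite -subr_eq0 opprK -[v2](mulmxK uW) -mulmxDl addrC e2 mul0mx.
(* If the first coordinate of the null vector vanished, invertibility of [W] would force the others
   to vanish too. *)
have v10 : v1 0 0 != 0.
  apply: contraNN v0 => /eqP v10; have v1E : v1 = 0.
    by apply/matrixP => i j; rewrite !ord1 v10 mxE.
  by rewrite -[v]hsubmxK -/v1 -/v2 v2E v1E !mul0mx oppr0 row_mx0.
move: e1; rewrite v2E mulNmx => /eqP; rewrite subr_eq0 => /eqP/matrixP/(_ 0 0).
rewrite mul_mx_scalar -!mulmxA mxE [RHS]mxE big_ord1 mulrC => /(mulfI v10) ->.
by rewrite mulmxA.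
Qed.

End local_finiteness.

(** * Right-continuous matrix semigroups *)

Section matrix_semigroup.
Context (R : realType) (k : nat) (S : R -> 'M[R]_k).
Local Notation mu := (@lebesgue_measure R).
Hypotheses (S0 : S 0 = 1%:M)
  (SD : forall s t, 0 <= s -> 0 <= t -> S (s + t) = S s *m S t)
  (rS : forall i j t, 0 <= t -> S s i j @[s --> t^'+] --> S t i j).

Lemma semigroup_bounded_near0 : exists2 e : R, 0 < e &
  forall s, 0 <= s <= e -> forall i j, `|S s i j| <= 2.
Proof.
have h : \forall s \near 0^'+, forall ij : 'I_k * 'I_k, `|S 0 ij.1 ij.2 - S s ij.1 ij.2| <= 1.
  apply: filter_forall => -[i j].
  by have /cvgrPdist_le/(_ 1 ltr01) := @rS i j 0 (lexx 0).
move: h => /nbhs_right0P[d /= d0 dP].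
exists (d / 2); first by rewrite divr_gt0.
have S0le i j : `|S 0 i j| <= 1 by rewrite S0 mxE; case: eqP => _; rewrite ?normr1 ?normr0.
move=> s /andP[]; rewrite le_eqVlt => /predU1P[<- _ i j|s0 sd i j].
  by rewrite (le_trans (S0le i j))// ler1n.
have := dP s; rewrite /= sub0r normrN gtr0_norm// add0r.
have sd' : s < d by rewrite (le_lt_trans sd)// ltr_pdivrMr// ltr_pMr// ltr1n.
move=> /(_ sd' s0 (i, j)) /= h1; have := S0le i j.
rewrite -[S s i j](subrK (S 0 i j)) => h2.
by rewrite (le_trans (ler_normD _ _))// distrC -[2](natrD R 1 1) lerD.
Qed.

Lemma normr_mulmx_le (A B : 'M[R]_k) (a b : R) i j :
  (forall i j, `|A i j| <= a) -> (forall i j, `|B i j| <= b) ->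
  `|(A *m B) i j| <= k%:R * (a * b).
Proof.
move=> Aa Bb; rewrite mxE (le_trans (ler_norm_sum _ _ _))//.
rewrite mulr_natl -[X in _ *+ X]card_ord -sumr_const; apply: ler_sum => l _.
by rewrite normrM ler_pM.
Qed.

Lemma semigroup_bounded (b : R) : exists2 C : R, 0 <= C &
  forall s, 0 <= s <= b -> forall i j, `|S s i j| <= C.
Proof.
have [e e0 eP] := semigroup_bounded_near0.
have h n : exists2 C : R, 0 <= C & forall s, 0 <= s <= n%:R * e -> forall i j, `|S s i j| <= C.
  elim: n => [|n [C C0 ih]].
    exists 2 => // s; rewrite mul0r => /andP[s0 s0'] i j; apply: eP.
    by rewrite s0 (le_trans s0')// ltW.
  exists (2 + k%:R * (2 * C)); first by rewrite addr_ge0 ?mulr_ge0.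
  move=> s /andP[s0 sn] i j; have [se|es] := leP s e.
    by rewrite (le_trans (eP s _ i j)) ?s0// lerDl !mulr_ge0.
  have -> : S s = S e *m S (s - e) by rewrite -SD ?subr_ge0 ?ltW// addrC subrK.
  apply: (@le_trans _ _ (k%:R * (2 * C))); last by rewrite lerDr.
  apply: normr_mulmx_le; first by apply: eP; rewrite lexx ltW.
  apply: ih; rewrite subr_ge0 ltW//= lerBlDr.
  by rewrite -[X in _ + X]mul1r -mulrDl natr1.
have [C C0 CP] := h (Num.truncn (b / e)).+1.
exists C => // s /andP[s0 sb] i j; apply: CP; rewrite s0/= (le_trans sb)//.
by rewrite -ler_pdivrMr// ltW// truncnS_gt.
Qed.

(** [S t - S s = S s *m (S (t - s) - S 0)]: the first factor is bounded on [[0, t]], and the second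
    tends to 0 by right-continuity at 0. *)
Lemma semigroup_cvg_left i j t : 0 < t -> S s i j @[s --> t^'-] --> S t i j.
Proof.
move=> t0; have [C C0 CP] := semigroup_bounded t.
have h : \sum_l C * `|S (t - s) l j - S 0 l j| @[s --> t^'-] --> 0.
  rewrite [X in _ --> X](_ : 0 = \sum_(l < k) C * `|S 0 l j - S 0 l j|); last first.
    by rewrite big1// => l _; rewrite subrr normr0 mulr0.
  apply: (@cvg_big _ _ (@GRing.add R) 0) => [|l _].
    exact: add_continuous.
  apply: cvgMr; apply: cvg_norm; apply: cvgB; last exact: cvg_cst.
  apply/cvgrPdist_le => e e0; apply/nbhs_left0P.
  have /cvgrPdist_le/(_ e e0) := @rS l j 0 (lexx 0).
  by apply: filterS => s; rewrite subKr.
apply/cvgrPdist_le => e e0.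
have /cvgrPdist_le/(_ e e0) := h.
apply: filter_app; near=> s; rewrite sub0r normrN.
have s0 : 0 <= s by near: s; exact: nbhs_left_ge.
have st : s <= t by near: s; exact: nbhs_left_le.
rewrite ger0_norm ?sumr_ge0// => [|l _]; last by rewrite mulr_ge0.
apply: le_trans; have -> : S t = S s *m S (t - s).
  by rewrite -SD// ?subr_ge0// addrC subrK.
have -> : S s i j = (S s *m S 0) i j by rewrite S0 mulmx1.
rewrite !mxE -sumrB (le_trans (ler_norm_sum _ _ _))//; apply: ler_sum => l _.
by rewrite -mulrBr normrM ler_wpM2r// CP// s0.
Unshelve. all: by end_near. Qed.

Lemma semigroup_cadlag i j : cadlag (fun t => S t i j).
Proof.
split=> t t0; first exact: rS.
by apply/cvg_ex; exists (S t i j); exact: semigroup_cvg_left.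
Qed.

Lemma semigroup_shift i j (d t : R) : 0 <= t ->
  \int[mu]_(u in `[0, d]) S (u + t) i j = \int[mu]_(u in `[t, t + d]) S u i j.
Proof.
move=> t0; have := @Rintegral_shift R (fun u => S u i j) 0 d t; rewrite add0r addrC => ->//.
by apply: cadlag_integrable_itv => //; exact: semigroup_cadlag.
Qed.

Definition integral_mx (a b : R) : 'M[R]_k :=
  \matrix_(i, j) \int[mu]_(u in `[a, b]) S u i j.

Lemma integral_mx_mulr (A : 'M[R]_k) a b i j : 0 <= a ->
  (integral_mx a b *m A) i j = \int[mu]_(u in `[a, b]) (S u *m A) i j.
Proof.
move=> a0; under eq_Rintegral do rewrite mxE; rewrite mxE.
under [in RHS]eq_Rintegral do under eq_bigr do rewrite mulrC.
rewrite cadlag_Rintegral_sum// => [|l]; last exact: semigroup_cadlag.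
by apply: eq_bigr => l _; rewrite mxE mulrC.
Qed.

Lemma integral_mx_mull m (A : 'M[R]_(m, k)) a b i j : 0 <= a ->
  (A *m integral_mx a b) i j = \int[mu]_(u in `[a, b]) (A *m S u) i j.
Proof.
move=> a0; under eq_Rintegral do rewrite mxE; rewrite mxE.
rewrite cadlag_Rintegral_sum// => [|l]; last exact: semigroup_cadlag.
by apply: eq_bigr => l _; rewrite mxE.
Qed.

Lemma integral_mxD a b c : 0 <= a -> a <= b -> b <= c ->
  integral_mx a c = integral_mx a b + integral_mx b c.
Proof.
move=> a0 ab bc; apply/matrixP => i j; rewrite !mxE.
by apply: cadlag_Rintegral_itvD => //; exact: semigroup_cadlag.
Qed.

Lemma cvg_integral_mx i j : h^-1 * integral_mx 0 h i j @[h --> 0^'+] --> S 0 i j.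
Proof. by under eq_fun do rewrite mxE; apply: cvg_Rintegral_avg; exact: semigroup_cadlag. Qed.

(** The averages [h^-1 *: integral_mx 0 h] tend to the identity, hence their determinants tend to
    1. *)
Lemma integral_mx_unit : exists2 d : R, 0 < d & integral_mx 0 d \in unitmx.
Proof.
have h : \det (h^-1 *: integral_mx 0 h) @[h --> 0^'+] --> \det (S 0).
  apply: (@cvg_big _ _ (@GRing.add R) 0) => [|s _]; first exact: add_continuous.
  apply: cvgMr; apply: (@cvg_big _ _ (@GRing.mul R) 1) => [|l _].
    exact: mul_continuous.
  by under eq_fun do rewrite mxE; exact: cvg_integral_mx.
move: h; rewrite S0 det1 => /cvgr_gt/(_ 0 ltr01) h.
have [d [d0 dd]] : exists d : R, 0 < d /\ 0 < \det (d^-1 *: integral_mx 0 d).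
  near (0 : R)^'+ => d; exists d; split; first by near: d; exact: nbhs_right_gt.
  by near: d.
exists d => //; rewrite unitmxE unitfE; apply: contraTneq dd.
by rewrite detZ => ->; rewrite mulr0 ltxx.
Unshelve. all: by end_near. Qed.

(** For invertible [B = integral_mx 0 d], both [B *m (S t - 1)] and [(S d - 1) *m integral_mx 0 t]
    equal the integral over [[t, t + d]] minus that over [[0, d]]. Hence [G = B^-1 (S d - 1)], and
    the generator appears in integrated form without differentiating [S]. *)
Lemma semigroup_generator : exists G : 'M[R]_k, forall t, 0 <= t ->
  S t = 1%:M + G *m integral_mx 0 t.
Proof.
have [d d0 uB] := integral_mx_unit; set B := integral_mx 0 d in uB.
exists (invmx B *m (S d - 1%:M)) => t t0.
rewrite -[LHS](mulKmx uB) -[X in X + _](mulVmx uB) -mulmxA -mulmxDr; congr (_ *m _).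
have -> : B *m S t = integral_mx t (t + d).
  apply/matrixP => i j; rewrite integral_mx_mulr// mxE -semigroup_shift ?(ltW d0)//.
  by apply: eq_Rintegral => u; rewrite inE/= in_itv/= => /andP[u0 _]; rewrite SD.
rewrite mulmxBl mul1mx.
have -> : S d *m integral_mx 0 t = integral_mx d (d + t).
  apply/matrixP => i j; rewrite integral_mx_mull// mxE -semigroup_shift ?(ltW d0)//.
  apply: eq_Rintegral => u; rewrite inE/= in_itv/= => /andP[u0 _].
  by rewrite addrC SD// ltW.
apply: (addrI (integral_mx 0 t)); rewrite -integral_mxD ?lerDl ?(ltW d0)//.
rewrite [t + d]addrC (@integral_mxD 0 d) ?lerDl ?(ltW d0)// -/B.
by rewrite [RHS]addrC -addrA subrK.
Qed.

End matrix_semigroup.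

(** * The generator in orbit coordinates *)

Section generator.
Context (R : realType) (E : Type) (PP : set (E -> R)) (deg : (E -> R) -> nat)
  (T : R -> (E -> R) -> (E -> R)).
Hypotheses (HPP : polynomial_space PP deg) (HT : polynomial_action PP deg T)
  (HTfin : locally_finite_action PP T).
Local Notation mu := (@lebesgue_measure R).

(** The interpolation formula of [orbit_border] passes from rational to real times: the points
    [next_grid m s] are rational and decrease to [s], and both sides are right-continuous in [s]. *)
Lemma orbit_coordinates p : PP p -> exists k (a : 'I_k -> R) (x : 'I_k -> E),
  let W := \matrix_(i, j) T (a i) p (x j) in
  [/\ forall i, 0 <= a i, W \in unitmx & forall s, 0 <= s -> forall y,
  T s p y = ((\row_j T s p (x j)) *m invmx W *m (\col_i T (a i) p y)) 0 0].
Proof.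
move=> PPp; have [k [[N [n [x W0]]] max]] := maximal_orbit_mx HPP HT HTfin PPp.
exists k, (fun i => (n i)%:R / N.+1%:R), x => W; split => [i||s s0 y].
- by rewrite divr_ge0.
- by rewrite unitmxE unitfE.
have [_ [_ _ rT]] := HT.
pose u m := next_grid m s.
have uT z : T (u m) p z @[m --> \oo] --> T s p z.
  have /cvg_at_rightP := rT p z s PPp s0; apply; split; last exact: cvg_next_grid.
  by move=> m; exact: next_grid_gt.
have uE m : u m = (absz (Num.floor (s * m.+1%:R) + 1))%:R / m.+1%:R.
  rewrite /u /next_grid natr_absz ger0_norm// addr_ge0// floor_ge0 mulr_ge0//.
have sumE (g : E -> R) : ((\row_j g (x j)) *m invmx W *m
      (\col_i T ((n i)%:R / N.+1%:R) p y)) 0 0 =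
    \sum_i (\sum_j g (x j) * invmx W j i) * T ((n i)%:R / N.+1%:R) p y.
  rewrite mxE; apply: eq_bigr => i _; rewrite !mxE; congr (_ * _).
  by apply: eq_bigr => j _; rewrite !mxE.
have h : T (u m) p y @[m --> \oo] -->
    ((\row_j T s p (x j)) *m invmx W *m (\col_i T ((n i)%:R / N.+1%:R) p y)) 0 0.
  under eq_fun do rewrite uE (orbit_border W0 max) -uE sumE; rewrite sumE.
  apply: (@cvg_big _ _ (@GRing.add R) 0) => [|i _]; first exact: add_continuous.
  apply: cvgMl; apply: (@cvg_big _ _ (@GRing.add R) 0) => [|j _].
    exact: add_continuous.
  exact: cvgMl.
exact: (cvg_unique _ (uT y) h).
Qed.

Lemma generator_graph_unique p q q' :
  generator_graph PP T p q -> generator_graph PP T p q' -> q = q'.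
Proof.
by move=> [_ _ h] [_ _ h']; apply/funext => x; exact: (cvg_unique _ (h x) (h' x)).
Qed.

Lemma generatorE p q : generator_graph PP T p q -> generator PP T p = q.
Proof.
move=> pq; apply: xget_unique => // q' pq'; exact: generator_graph_unique pq' pq.
Qed.

(** The sampled polynomials [f i = T_(a i) p] span the orbit, and on them [T] acts by a matrix
    semigroup with generator [G]. If the row [r] holds the coordinates of [p], those of [T_s p] are
    [r S_s], those of the generator are [r G], and the last clause is the integrated semigroup
    equation. The coordinates are part of the conclusion because they reduce Dynkin's formula to
    scalar integrals. *)
Lemma generator_total p : PP p -> generator_graph PP T p (generator PP T p) /\
  exists k (f : 'I_k -> E -> R) (c e : 'I_k -> R -> R),
  [/\ forall i, PP (f i) /\ (deg (f i) <= deg p)%N,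
      forall i, cadlag (c i) /\ cadlag (e i),
      forall s, 0 <= s -> T s p = \sum_i c i s *: f i,
      forall s, 0 <= s -> T s (generator PP T p) = \sum_i e i s *: f i &
      forall i t, 0 <= t -> c i t = c i 0 + \int[mu]_(s in `[0, t]) e i s].
Proof.
move=> PPp; have [k [a [x [a0 uW TE]]]] := orbit_coordinates PPp.
have [[TP Tl Td] [T0 TD rT]] := HT.
set W := \matrix_(i, j) _ in uW TE.
pose f i := T (a i) p.
have PPf i : PP (f i) by exact: TP.
(* Row [i] holds the coordinates of [T_s (f i)] in the family [f], read off the interpolation
   formula at time [s + a i]. *)
pose S s := (\matrix_(i, j) T (s + a i) p (x j)) *m invmx W.
have SE s i j : S s i j = \sum_l T (s + a i) p (x l) * invmx W l j.
  by rewrite /S mxE; apply: eq_bigr => l _; rewrite mxE.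
have TS s i : 0 <= s -> T s (f i) = \sum_j S s i j *: f j.
  move=> s0; apply/funext => y; rewrite /f TD// TE ?addr_ge0// mxE fct_sumE.
  apply: eq_bigr => j _; rewrite SE !mxE; congr (_ * _).
  by apply: eq_bigr => l _; rewrite !mxE.
have SW s : S s *m W = \matrix_(i, j) T (s + a i) p (x j) by rewrite mulmxKV.
have S0 : S 0 = 1%:M.
  by rewrite -(mulmxV uW); congr (_ *m _); apply/matrixP => i j; rewrite !mxE add0r.
have SD s t : 0 <= s -> 0 <= t -> S (s + t) = S s *m S t.
  (* Multiplication by the invertible [W] turns coordinates into values at the points [x j], where
     the semigroup law of [T] can be used. The family [f] is not known to be free, so coordinates
     cannot be compared directly. *)
  move=> s0 t0; rewrite -[LHS](mulmxK uW) -[RHS](mulmxK uW); congr (_ *m _).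
  rewrite SW -mulmxA SW.
  apply/matrixP => i j; rewrite mxE [RHS]mxE.
  have -> : T (s + t + a i) p = T t (T s (f i)).
    by rewrite [s + t]addrC -addrA -!TD ?addr_ge0.
  rewrite TS// (action_sum HPP HT)// fct_sumE; apply: eq_bigr => l _.
  by congr (_ * _); rewrite mxE /f TD.
have rS i j t : 0 <= t -> S s i j @[s --> t^'+] --> S t i j.
  move=> t0; under eq_fun do rewrite SE; rewrite SE.
  apply: (@cvg_big _ _ (@GRing.add R) 0) => [|l _]; first exact: add_continuous.
  apply: cvgMl.
  apply/cvgrPdist_le => e e0; apply/nbhs_right0P.
  have /cvgrPdist_le/(_ e e0)/nbhs_right0P := rT p (x l) (t + a i) PPp (addr_ge0 t0 (a0 i)).
  by apply: filterS => s; rewrite addrAC.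
have [G SG] := semigroup_generator S0 SD rS.
have cS i j := semigroup_cadlag S0 SD rS i j.
(* Coordinates of [p] itself: the interpolation formula at time 0. *)
pose r : 'rV_k := (\row_j T 0 p (x j)) *m invmx W.
have clin (v : 'rV_k) i : cadlag (fun t => (v *m S t) 0 i).
  by under eq_fun do rewrite mxE; apply: cadlag_sum => j; apply: cadlagZ.
pose lin (v : 'rV_k) := \sum_i v 0 i *: f i.
have PPlin v : PP (lin v) by apply: (poly_sum HPP).
have Tlin v s : 0 <= s -> T s (lin v) = \sum_i (v *m S s) 0 i *: f i.
  move=> s0; rewrite (action_sum HPP HT)//.
  under eq_bigr do rewrite TS// scaler_sumr.
  rewrite exchange_big; apply: eq_bigr => j _; rewrite mxE scaler_suml.
  by apply: eq_bigr => i _; rewrite scalerA.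
have pE : p = lin r.
  apply/funext => y; rewrite -[in LHS](T0 p PPp) TE// mxE /lin fct_sumE.
  by apply: eq_bigr => i _; congr (_ * _); rewrite mxE.
have cE t i : 0 <= t -> (r *m S t) 0 i = (r *m S 0) 0 i +
    \int[mu]_(s in `[0, t]) ((r *m G) *m S s) 0 i.
  move=> t0; rewrite -(integral_mx_mull S0 SD rS)//.
  by rewrite S0 mulmx1 {1}SG// mulmxDr mulmx1 mxE mulmxA.
have gq : generator_graph PP T p (lin (r *m G)).
  split=> // y; rewrite /lin fct_sumE.
  have key : \sum_i (h^-1 * \int[mu]_(s in `[0, h]) ((r *m G) *m S s) 0 i)
      * f i y @[h --> 0^'+] --> \sum_i (r *m G) 0 i * f i y.
    apply: (@cvg_big _ _ (@GRing.add R) 0) => [|i _]; first exact: add_continuous.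
    apply: cvgMl; have := cvg_Rintegral_avg (clin (r *m G) i).
    by rewrite S0 mulmx1.
  apply: cvg_trans key; apply: near_eq_cvg; near=> h.
  have h0 : 0 <= h by apply: ltW; near: h; exact: nbhs_right_gt.
  have pE0 : p y = T 0 (lin r) y by rewrite -pE T0.
  rewrite [X in _ - X]pE0 pE !Tlin// !fct_sumE -sumrB mulr_suml; apply: eq_bigr => i _.
  rewrite cE//; have -> u v : ((u + v) *: f i) y = (u + v) * f i y by [].
  have -> u : (u *: f i) y = u * f i y by [].
  by rewrite -mulrBl addrAC subrr add0r -[LHS]mulrA mulrC.
split; first by rewrite (generatorE gq).
exists k, f, (fun i t => (r *m S t) 0 i), (fun i t => (r *m G *m S t) 0 i); split => //.
- by move=> i; split => //; apply: Td.
- by move=> s s0; rewrite [in LHS]pE Tlin.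
- by move=> s s0; rewrite (generatorE gq) Tlin.
- by move=> i t t0; exact: cE.
Unshelve. all: by end_near. Qed.

End generator.

(** * Expectation and adaptedness *)

Section expectation.
Context (R : realType) d (Omega : measurableType d) (Pr : probability Omega R).
Implicit Types (f g h : Omega -> R).

Definition L1 f := Pr.-integrable setT (EFin \o f).
Definition Ex f := \int[Pr]_w f w.
(** Measurability of [f] is included since it does not follow from that of its square. *)
Definition L2 f := measurable_fun setT f /\ L1 (fun w => f w ^+ 2).

Lemma L1_measurable f : L1 f -> measurable_fun setT f.
Proof. by move=> /integrableP[/measurable_EFinP]. Qed.

Lemma L1_le f g : measurable_fun setT f -> L1 g -> (forall w, `|f w| <= `|g w|) -> L1 f.
Proof.
move=> mf ig fg; apply: (le_integrable measurableT _ _ ig); first exact/measurable_EFinP.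
by move=> w _ /=; rewrite lee_fin.
Qed.

Lemma L1_cst (c : R) : L1 (fun=> c).
Proof. exact: finite_measure_integrable_cst. Qed.

Lemma L1D f g : L1 f -> L1 g -> L1 (fun w => f w + g w).
Proof. by move=> lf lg; exact: (integrableD measurableT lf lg). Qed.

Lemma L1B f g : L1 f -> L1 g -> L1 (fun w => f w - g w).
Proof. by move=> lf lg; exact: (integrableB measurableT lf lg). Qed.

Lemma L1Z (c : R) f : L1 f -> L1 (fun w => c * f w).
Proof. by move=> lf; exact: (integrableZl measurableT c lf). Qed.

Lemma L1_norm f : L1 f -> L1 (fun w => `|f w|).
Proof. exact: integrable_norm. Qed.

Lemma L1_sum (I : Type) (s : seq I) (f : I -> Omega -> R) :
  (forall i, L1 (f i)) -> L1 (fun w => \sum_(i <- s) f i w).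
Proof.
move=> lf; elim: s => [|i s ih].
  by under [X in L1 X]eq_fun do rewrite big_nil; exact: L1_cst.
by under [X in L1 X]eq_fun do rewrite big_cons; exact: L1D.
Qed.

Lemma ExD f g : L1 f -> L1 g -> Ex (fun w => f w + g w) = Ex f + Ex g.
Proof. by move=> lf lg; exact: RintegralD. Qed.

Lemma ExB f g : L1 f -> L1 g -> Ex (fun w => f w - g w) = Ex f - Ex g.
Proof. by move=> lf lg; exact: RintegralB. Qed.

Lemma ExZ (c : R) f : L1 f -> Ex (fun w => c * f w) = c * Ex f.
Proof. by move=> lf; exact: RintegralZl. Qed.

Lemma Ex_cst (c : R) : Ex (fun=> c) = c.
Proof. by rewrite /Ex Rintegral_cst// [X in fine X](@probability_setT _ _ _ Pr) mulr1. Qed.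

Lemma eq_Ex f g : f =1 g -> Ex f = Ex g.
Proof. by move=> fg; congr Ex; apply/funext. Qed.

Lemma Ex_sum (I : Type) (s : seq I) (f : I -> Omega -> R) : (forall i, L1 (f i)) ->
  Ex (fun w => \sum_(i <- s) f i w) = \sum_(i <- s) Ex (f i).
Proof.
move=> lf; elim: s => [|i s ih].
  by under [X in Ex X]eq_fun do rewrite big_nil; rewrite Ex_cst big_nil.
under [X in Ex X]eq_fun do rewrite big_cons.
by rewrite ExD// ?ih ?big_cons//; exact: L1_sum.
Qed.

Lemma le_Ex f g : L1 f -> L1 g -> (forall w, f w <= g w) -> Ex f <= Ex g.
Proof. by move=> lf lg fg; apply: le_Rintegral. Qed.

Lemma Ex_ge0 f : (forall w, 0 <= f w) -> 0 <= Ex f.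
Proof. by move=> f0; apply: Rintegral_ge0. Qed.

Lemma normr_Ex f : L1 f -> `|Ex f| <= Ex (fun w => `|f w|).
Proof. by move=> lf; apply: le_normr_Rintegral. Qed.

Lemma ExE f : L1 f -> (Ex f)%:E = (\int[Pr]_w (f w)%:E)%E.
Proof. by move=> lf; rewrite /Ex /Rintegral fineK//; exact: integrable_fin_num lf. Qed.

Lemma Ex_dominated (f_ : nat -> Omega -> R) f g :
  (forall n, measurable_fun setT (f_ n)) -> L1 g ->
  (forall n w, `|f_ n w| <= g w) -> (forall w, f_ n w @[n --> \oo] --> f w) ->
  L1 f /\ Ex (f_ n) @[n --> \oo] --> Ex f.
Proof.
move=> mf_ lg fg cf.
have mf : measurable_fun setT f.
  by apply: (measurable_fun_cvg mf_) => w _; exact: cf.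
have [| | | | |lf _ h] := @dominated_convergence _ _ _ Pr setT measurableT
    (fun n => EFin \o f_ n) (EFin \o f) (EFin \o g).
- by move=> n; exact/measurable_EFinP.
- exact/measurable_EFinP.
- by apply: aeW => w _; apply: cvg_EFin; [exact: nearW|exact: cf].
- exact: lg.
- by apply: aeW => w n _ /=; rewrite lee_fin.
split => //; have := fine_cvg (f := fun n => (\int[Pr]_w (f_ n w)%:E)%E).
by move=> /(_ _ _ (Ex f)); apply; rewrite ExE.
Qed.

Lemma L1_indic_mul f (A : set Omega) : measurable A -> L1 f -> L1 (fun w => \1_A w * f w).
Proof.
move=> mA lf; apply: (L1_le _ lf); last first.
  by move=> w; rewrite normrM ler_piMl// indicE; case: (_ \in _); rewrite ?normr1 ?normr0.
by apply: measurable_funM; [exact: measurable_indic|exact: L1_measurable].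
Qed.

Lemma L1_indic (A : set Omega) : measurable A -> L1 \1_A.
Proof. by move=> /L1_indic_mul/(_ (L1_cst 1)); under eq_fun do rewrite mulr1. Qed.

Lemma Ex_indic f (A : set Omega) : measurable A -> L1 f ->
  (\int[Pr]_(w in A) (f w)%:E)%E = (Ex (fun w => \1_A w * f w))%:E.
Proof.
move=> mA lf; rewrite ExE; last exact: L1_indic_mul.
rewrite integral_mkcond; apply: eq_integral => w _.
by rewrite restrict_EFin /= /patch indicE; case: ifP; rewrite ?mul1r ?mul0r.
Qed.

Lemma Ex_indicE (A : set Omega) : measurable A -> (Ex \1_A)%:E = Pr A.
Proof.
move=> mA; have := Ex_indic mA (L1_cst 1); rewrite integral_cst// mul1e => ->.
by congr EFin; apply: eq_Ex => w; rewrite mulr1.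
Qed.

Lemma L2_mul f g : L2 f -> L2 g -> L1 (fun w => f w * g w).
Proof.
move=> [mf lf] [mg lg]; apply: (L1_le (measurable_funM mf mg) (L1D lf lg)) => w.
rewrite [X in _ <= X]ger0_norm ?addr_ge0 ?sqr_ge0// normrM.
rewrite -(real_normK (num_real (f w))) -(real_normK (num_real (g w))).
by have := sqr_ge0 (`|f w| - `|g w|); have := sqr_ge0 (`|f w| + `|g w|); nra.
Qed.

Lemma L2D f g : L2 f -> L2 g -> L2 (fun w => f w + g w).
Proof.
move=> lf lg; have [mf lf2] := lf; have [mg lg2] := lg.
split; first exact: measurable_funD.
under [X in L1 X]eq_fun do rewrite sqrrD.
by apply: L1D => //; apply: L1D => //; under [X in L1 X]eq_fun do rewrite mulr2n;
  apply: L1D; exact: L2_mul.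
Qed.

Lemma L2Z (c : R) f : L2 f -> L2 (fun w => c * f w).
Proof.
move=> [mf lf]; split; first by apply: measurable_funM.
by under [X in L1 X]eq_fun do rewrite exprMn; exact: L1Z.
Qed.

Lemma L2B f g : L2 f -> L2 g -> L2 (fun w => f w - g w).
Proof.
move=> lf /(L2Z (-1)) lg; have := L2D lf lg.
by under [X in L2 X -> _]eq_fun do rewrite mulN1r.
Qed.

Lemma L2_L1 f : L2 f -> L1 f.
Proof.
move=> lf; have lc : L2 (fun=> 1 : R) by split => //; exact: L1_cst.
by have := L2_mul lf lc; under [X in L1 X -> _]eq_fun do rewrite mulr1.
Qed.

Lemma L2_le f g : measurable_fun setT f -> L2 g -> (forall w, `|f w| <= `|g w|) -> L2 f.
Proof.
move=> mf [_ lg] fg; split => //; apply: (L1_le _ lg); first exact: measurable_funX.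
by move=> w; rewrite !normrX lerXn2r ?nnegrE.
Qed.

Lemma L1_bounded_mul f g (C : R) : measurable_fun setT f -> (forall w, `|f w| <= C) ->
  L1 g -> L1 (fun w => f w * g w).
Proof.
move=> mf fC lg; apply: (L1_le _ (L1Z C lg)).
  by apply: measurable_funM => //; exact: L1_measurable.
move=> w; rewrite !normrM ler_wpM2r//; exact: le_trans (fC w) (ler_norm _).
Qed.

Lemma L2_bounded_mul f g (C : R) : measurable_fun setT f -> (forall w, `|f w| <= C) ->
  L2 g -> L2 (fun w => f w * g w).
Proof.
move=> mf fC lg; apply: L2_le (L2Z C lg) _ => [|w].
  by apply: measurable_funM => //; case: lg.
by rewrite !normrM ler_wpM2r// (le_trans (fC w))// ler_norm.
Qed.

Lemma L2_indic_mul f (A : set Omega) : measurable A -> L2 f -> L2 (fun w => \1_A w * f w).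
Proof.
move=> mA; apply: (@L2_bounded_mul _ _ 1) => [|w]; first exact: measurable_indic.
by rewrite indicE; case: (_ \in _); rewrite ?normr1 ?normr0.
Qed.

End expectation.

(** * Measurability and orthogonality with respect to a sub-sigma-algebra *)

Section sub_sigma_algebra.
Context (R : realType) d (Omega : measurableType d) (Pr : probability Omega R)
  (G : set (set Omega)).
Hypotheses (sG : sigma_algebra setT G) (Gm : G `<=` measurable).
Implicit Types (f g Z : Omega -> R).
Local Notation L1 := (L1 Pr).
Local Notation Ex := (Ex Pr).

(** Passage to the measurable type generated by [G], where the closure properties of measurable
    functions are available. *)
Lemma measurable_wrtP f : measurable_wrt G f <->
  measurable_fun setT (f : g_sigma_algebraType G -> R).
Proof.
have GE : <<s G >> = G by exact: sigma_algebra_id.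
split=> [mf _ B mB|mf B mB].
  by rewrite setTI /measurable/= GE; exact: mf.
by have := mf measurableT B mB; rewrite setTI /measurable/= GE.
Qed.

Lemma measurable_wrt_measurable f : measurable_wrt G f -> measurable_fun setT f.
Proof. by move=> mf _ B mB; rewrite setTI; apply: Gm; exact: mf. Qed.

Lemma measurable_wrt_cst (c : R) : measurable_wrt G (fun=> c).
Proof. by apply/measurable_wrtP. Qed.

Lemma measurable_wrtD f g : measurable_wrt G f -> measurable_wrt G g ->
  measurable_wrt G (fun w => f w + g w).
Proof.
by move=> /measurable_wrtP mf /measurable_wrtP mg; apply/measurable_wrtP; exact: measurable_funD.
Qed.

Lemma measurable_wrtM f g : measurable_wrt G f -> measurable_wrt G g ->
  measurable_wrt G (fun w => f w * g w).
Proof.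
by move=> /measurable_wrtP mf /measurable_wrtP mg; apply/measurable_wrtP; exact: measurable_funM.
Qed.

Lemma measurable_wrtB f g : measurable_wrt G f -> measurable_wrt G g ->
  measurable_wrt G (fun w => f w - g w).
Proof.
by move=> /measurable_wrtP mf /measurable_wrtP mg; apply/measurable_wrtP; exact: measurable_funB.
Qed.

Lemma measurable_wrt_sum (I : Type) (s : seq I) (f : I -> Omega -> R) :
  (forall i, measurable_wrt G (f i)) -> measurable_wrt G (fun w => \sum_(i <- s) f i w).
Proof.
move=> mf; elim: s => [|i s ih].
  by under [X in measurable_wrt G X]eq_fun do rewrite big_nil; exact: measurable_wrt_cst.
by under [X in measurable_wrt G X]eq_fun do rewrite big_cons; exact: measurable_wrtD.
Qed.

Lemma measurable_wrt_indic (A : set Omega) : G A -> measurable_wrt G (\1_A : Omega -> R).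
Proof.
move=> GA; apply/measurable_wrtP; apply: measurable_indic.
by rewrite /measurable/= sigma_algebra_id.
Qed.

Import HBNNSimple.

(** Simple functions increasing to [z] are finite combinations of indicators of sets of [G];
    [|z * Z|] dominates their products with [Z]. *)
Let orthogonal_nneg Z z : L1 Z -> (forall A, G A -> Ex (fun w => \1_A w * Z w) = 0) ->
  measurable_wrt G z -> (forall w, 0 <= z w) -> L1 (fun w => z w * Z w) ->
  Ex (fun w => z w * Z w) = 0.
Proof.
move=> lZ ZG /measurable_wrtP mz z0 lzZ.
pose T' : measurableType _ := g_sigma_algebraType G.
have mEz : measurable_fun setT (EFin \o (z : T' -> R)) by exact/measurable_EFinP.
pose h := nnsfun_approx (@measurableT _ T') mEz.
have mh n : measurable_wrt G (h n : Omega -> R) by apply/measurable_wrtP.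
have hz n w : h n w <= z w.
  rewrite -lee_fin /h nnsfun_approxE.
  by apply: (@le_approx _ T' R setT (EFin \o z)) => // x _; rewrite lee_fin.
have ch w : h n w @[n --> \oo] --> z w.
  have z0E x : setT x -> (0 <= (EFin \o z) x)%E by rewrite lee_fin.
  by have /fine_cvgP[] := cvg_nnsfun_approx (@measurableT _ T') mEz z0E (x := w) I.
have Eh n : Ex (fun w => h n w * Z w) = 0.
  have hE w : h n w * Z w =
      \sum_(y <- finmap.enum_fset (fset_set (range (h n)))) y * (\1_(h n @^-1` [set y]) w * Z w).
    rewrite fimfunE fsbig_finite//= mulr_suml.
    by apply: eq_bigr => y _; rewrite mulrA.
  have GA y : G (h n @^-1` [set y]) by apply: mh; exact: measurable_set1.
  rewrite (eq_Ex Pr hE) Ex_sum ?big1// => [y _|y]; last first.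
    by apply: L1Z; apply: L1_indic_mul => //; exact: Gm.
  by rewrite ExZ ?ZG ?mulr0//; apply: L1_indic_mul => //; exact: Gm.
have [|||_ cE] := @Ex_dominated _ _ _ Pr (fun n w => h n w * Z w)
    (fun w => z w * Z w) _ _ (L1_norm lzZ).
- move=> n; apply: measurable_funM; last exact: L1_measurable lZ.
  exact: measurable_wrt_measurable.
- move=> n w; rewrite !normrM ler_wpM2r// !ger0_norm//; exact: hz.
- by move=> w; apply: cvgMl; exact: ch.
have c0 : Ex (fun w => h n w * Z w) @[n --> \oo] --> (0 : R).
  by rewrite (funext Eh); exact: cvg_cst.
exact: (cvg_unique _ cE c0).
Qed.

(** The nonnegative case is applied to the positive and negative parts of [z]. The lemma does the
    work of pulling a known factor out of a conditional expectation, asking only that the product be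
    integrable. *)
Lemma orthogonal_ext Z z : L1 Z -> (forall A, G A -> Ex (fun w => \1_A w * Z w) = 0) ->
  measurable_wrt G z -> L1 (fun w => z w * Z w) -> Ex (fun w => z w * Z w) = 0.
Proof.
move=> lZ ZG mz lzZ.
have mz1 := measurable_wrt_measurable mz.
have mZ := L1_measurable lZ.
pose zp w := Num.max (z w) 0; pose zn w := Num.max (- z w) 0.
have zE w : z w = zp w - zn w.
  by rewrite /zp /zn /Num.max; case: ifPn; case: ifPn; lra.
have mzp : measurable_wrt G zp.
  apply/measurable_wrtP; apply: measurable_maxr => //; exact/measurable_wrtP.
have mzn : measurable_wrt G zn.
  by apply/measurable_wrtP; apply: measurable_maxr => //; apply: measurableT_comp => //;
    exact/measurable_wrtP.
have zpz w : `|zp w| <= `|z w|.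
  by rewrite /zp /Num.max; case: ifP; rewrite ?normr0.
have znz w : `|zn w| <= `|z w|.
  by rewrite /zn /Num.max; case: ifP; rewrite ?normr0 ?normrN.
have lp : L1 (fun w => zp w * Z w).
  apply: (L1_le _ lzZ) => [|w]; last by rewrite !normrM ler_wpM2r.
  by apply: measurable_funM => //; exact: measurable_wrt_measurable.
have ln : L1 (fun w => zn w * Z w).
  apply: (L1_le _ lzZ) => [|w]; last by rewrite !normrM ler_wpM2r.
  by apply: measurable_funM => //; exact: measurable_wrt_measurable.
rewrite (@eq_Ex _ _ _ _ _ (fun w => zp w * Z w - zn w * Z w)) => [|w]; last first.
  by rewrite -mulrBl -zE.
rewrite ExB// !orthogonal_nneg ?subr0// => w; by rewrite le_max lexx orbT.
Qed.

End sub_sigma_algebra.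

(** * The martingale part of a polynomial process *)

Section expectation_path_integral.
Context (R : realType) d (Omega : measurableType d) (Pr : probability Omega R).
Local Notation mu := (@lebesgue_measure R).
Local Notation Ex := (Ex Pr).
Local Notation L1 := (L1 Pr).

Lemma Ex_path_integral (Y : R -> Omega -> R) (a b C : R) : 0 <= a -> a <= b ->
  (forall w, cadlag (Y ^~ w)) ->
  (forall v, a <= v <= b -> L1 (Y v) /\ Ex (fun w => `|Y v w|) <= C) ->
  L1 (fun w => \int[mu]_(v in `[a, b]) Y v w) /\
  Ex (fun w => \int[mu]_(v in `[a, b]) Y v w) = \int[mu]_(v in `[a, b]) Ex (Y v).
Proof.
move=> a0 ab cY YC.
have mY v : a <= v <= b -> measurable_fun setT (Y v).
  by move=> /YC[/L1_measurable].
have YC' v : a <= v <= b -> (\int[Pr]_w `|Y v w|%:E <= C%:E)%E.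
  by move=> /YC[lY YvC]; rewrite -ExE ?lee_fin//; exact: L1_norm.
split; first exact: (integrable_path_integral a0 ab cY mY YC').
exact: (Rintegral_path_integral a0 ab cY mY YC').
Qed.

Lemma measurable_wrt_path_integral (G : set (set Omega)) (Y : R -> Omega -> R) (a b : R) :
  sigma_algebra setT G -> 0 <= a -> a <= b -> (forall w, cadlag (Y ^~ w)) ->
  (forall v, a <= v <= b -> measurable_wrt G (Y v)) ->
  measurable_wrt G (fun w => \int[mu]_(v in `[a, b]) Y v w).
Proof.
move=> sG a0 ab cY mY; apply/measurable_wrtP => //.
apply: (measurable_path_integral (Y := Y : R -> g_sigma_algebraType G -> R)) => // v vab.
by apply/measurable_wrtP => //; exact: mY.
Qed.

End expectation_path_integral.

Section polynomial_process.
Context (R : realType) d (Omega : measurableType d) (Pr : probability Omega R)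
  (F : R -> set (set Omega)) (HF : is_filtration F) (E : Type)
  (PP : set (E -> R)) (deg : (E -> R) -> nat) (HPP : polynomial_space PP deg)
  (T : R -> (E -> R) -> (E -> R)) (HT : polynomial_action PP deg T)
  (HTfin : locally_finite_action PP T)
  (X : R -> Omega -> E) (HX : polynomial_process Pr F PP T X).
Local Notation mu := (@lebesgue_measure R).
Local Notation Ex := (Ex Pr).
Local Notation L1 := (L1 Pr).
Local Notation L2 := (L2 Pr).
Local Notation gen := (generator PP T).

Lemma filtration_measurable t A : 0 <= t -> F t A -> measurable A.
Proof. by move: HF => [_ Fm _] t0; exact: Fm. Qed.

Lemma filtration_sigma t : 0 <= t -> sigma_algebra setT (F t).
Proof. by move: HF => [sF _ _]; exact: sF. Qed.

Lemma filtration_le s t A : 0 <= s -> s <= t -> F s A -> F t A.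
Proof. by move: HF => [_ _ Fst] s0 st; exact: Fst. Qed.

Lemma measurable_wrt_filtration s t (f : Omega -> R) : 0 <= s -> s <= t ->
  measurable_wrt (F s) f -> measurable_wrt (F t) f.
Proof. by move: HF => [_ _ Fst] s0 st mf B mB; apply: (Fst s t s0 st); exact: mf. Qed.

Lemma process_cadlag p w : PP p -> cadlag (fun t => p (X t w)).
Proof. by move=> /HX[]. Qed.

Lemma process_wrt p t : PP p -> 0 <= t -> measurable_wrt (F t) (fun w => p (X t w)).
Proof. by move=> /HX[_ _ _ h] t0; exact: h. Qed.

Lemma process_L1 p t : PP p -> 0 <= t -> L1 (fun w => p (X t w)).
Proof. by move=> /HX[h _ _ _] t0; exact: h. Qed.

Lemma Ex_action p t h A : PP p -> 0 <= t -> 0 <= h -> F t A ->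
  Ex (fun w => \1_A w * p (X (t + h) w)) = Ex (fun w => \1_A w * T h p (X t w)).
Proof.
move=> PPp t0 h0 FA; have mA := filtration_measurable t0 FA.
have [TP _ _] := HT.1.
have [_ /(_ t h t0 h0)[_ _ /(_ A FA) hA] _ _] := HX PPp.
move: hA; rewrite !Ex_indic//; first by move=> [].
- by apply: process_L1 => //; rewrite addr_ge0.
- by apply: process_L1 => //; exact: TP.
Qed.

Lemma Ex_process_sum p t h A k (f : 'I_k -> E -> R) (c : 'I_k -> R) :
  PP p -> 0 <= t -> 0 <= h -> F t A -> (forall i, PP (f i)) ->
  T h p = \sum_i c i *: f i ->
  Ex (fun w => \1_A w * p (X (t + h) w)) = \sum_i c i * Ex (fun w => \1_A w * f i (X t w)).
Proof.
move=> PPp t0 h0 FA PPf Tp; rewrite Ex_action// Tp.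
have mA := filtration_measurable t0 FA.
have lf i : L1 (fun w => \1_A w * f i (X t w)).
  by apply: L1_indic_mul => //; exact: process_L1.
rewrite (@eq_Ex _ _ _ _ _ (fun w => \sum_i c i * (\1_A w * f i (X t w)))) => [|w].
  by rewrite Ex_sum => [|i]; [apply: eq_bigr => i _; rewrite ExZ|exact: L1Z].
by rewrite fct_sumE mulr_sumr; apply: eq_bigr => i _; rewrite mulrCA.
Qed.

(** The expectation at time [s] is a combination of the fixed numbers [E[f_i(X_0)]] with
    coefficients [c i s], which are cadlag and hence bounded on [[0, t]]. *)
Lemma Ex_process_bounded b t : PP b -> (forall x, 0 <= b x) -> 0 <= t ->
  exists C, forall s, 0 <= s <= t -> Ex (fun w => b (X s w)) <= C.
Proof.
move=> PPb b0 t0.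
have [_ [k [f [c [e [PPf cf Tb _ _]]]]]] := generator_total HPP HT HTfin PPb.
have /choice[K KP] : forall i, exists K, forall s, 0 <= s <= t -> `|c i s| <= K.
  by move=> i; have [K _ cK] := cadlag_bounded t (cf i).1; exists K.
exists (\sum_i K i * `|Ex (fun w => \1_setT w * f i (X 0 w))|) => s /andP[s0 st].
have FT : F 0 setT.
  by have [F00 FC _] := filtration_sigma (lexx 0); rewrite -(setD0 setT); exact: FC.
have -> : Ex (fun w => b (X s w)) = Ex (fun w => \1_setT w * b (X (0 + s) w)).
  by apply: eq_Ex => w; rewrite indicT mul1r add0r.
rewrite (Ex_process_sum PPb (lexx 0) s0 FT _ (Tb s s0)) => [|i]; last exact: (PPf i).1.
apply: ler_sum => i _; rewrite (le_trans (ler_norm _))// normrM ler_wpM2r//.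
by apply: KP; rewrite s0.
Qed.

(** The absolute value of a polynomial need not be one; a majorant inside [PP] makes [E[|g(X_s)|]]
    locally bounded in [s], which Fubini needs. *)
Definition dominated (g : E -> R) := PP g /\ exists2 b, PP b & forall x, `|g x| <= b x.

Lemma dominated_square g : PP g -> PP (g * g) -> dominated g.
Proof.
move=> PPg PPgg; have [[PPc PPD _] _] := HPP.
split => //; exists (cst 1 + g * g) => [|x]; first exact: PPD.
have -> : (cst 1 + g * g) x = 1 + g x * g x by [].
by rewrite ler_norml; apply/andP; split; have := sqr_ge0 (g x - 1); have := sqr_ge0 (g x + 1); nra.
Qed.

Lemma dominated_bounded g t : dominated g -> 0 <= t ->
  exists C, forall s, 0 <= s <= t -> Ex (fun w => `|g (X s w)|) <= C.
Proof.
move=> [PPg [b PPb gb]] t0.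
have b0 x : 0 <= b x by exact: le_trans (gb x).
have [C bC] := Ex_process_bounded PPb b0 t0; exists C => s s0t.
have s0 : 0 <= s by case/andP: s0t.
rewrite (le_trans _ (bC s s0t))//; apply: le_Ex => //.
- by apply: L1_norm; exact: process_L1.
- exact: process_L1.
Qed.

Lemma dominated_integral g s t A : dominated g -> 0 <= s -> s <= t -> measurable A ->
  L1 (fun w => \1_A w * \int[mu]_(v in `[s, t]) g (X v w)) /\
  Ex (fun w => \1_A w * \int[mu]_(v in `[s, t]) g (X v w)) =
  \int[mu]_(v in `[s, t]) Ex (fun w => \1_A w * g (X v w)).
Proof.
move=> dg s0 st mA; have t0 := le_trans s0 st; have PPg := dg.1.
have [C gC] := dominated_bounded dg t0.
have cg w : cadlag (fun v => g (X v w)) by exact: process_cadlag.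
have E1 w : \1_A w * \int[mu]_(v in `[s, t]) g (X v w) =
    \int[mu]_(v in `[s, t]) (\1_A w * g (X v w)).
  by rewrite cadlag_RintegralZ.
rewrite (funext E1); apply: (Ex_path_integral (C := C)) => // [w|v /andP[sv vt]].
  exact: cadlagZ.
have v0 := le_trans s0 sv; have lg := process_L1 PPg v0.
split; first exact: L1_indic_mul.
apply: (@le_trans _ _ (Ex (fun w => `|g (X v w)|))); last by rewrite gC// v0.
apply: le_Ex; [by apply: L1_norm; exact: L1_indic_mul|exact: L1_norm|].
move=> w; rewrite normrM ler_piMl// indicE.
by case: (_ \in _); rewrite ?normr1 ?normr0.
Qed.

Lemma dominated_L1 g s t : dominated g -> 0 <= s -> s <= t ->
  L1 (fun w => \int[mu]_(v in `[s, t]) g (X v w)).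
Proof.
move=> dg s0 st; have [+ _] := dominated_integral dg s0 st measurableT.
by under [X in L1 X -> _]eq_fun do rewrite indicT mul1r.
Qed.

(** Given [F s], both sides are combinations of the same numbers [E[1_A f_i(X_s)]]; their
    coefficients, [c i (t - s) - c i 0] and the integral of [e i] over [[0, t - s]], agree by
    [generator_total]. *)
Lemma dynkin p s t A : PP p -> dominated (gen p) -> 0 <= s -> s <= t -> F s A ->
  Ex (fun w => \1_A w * (p (X t w) - p (X s w))) =
  Ex (fun w => \1_A w * \int[mu]_(v in `[s, t]) gen p (X v w)).
Proof.
move=> PPp dg s0 st FA; have t0 := le_trans s0 st.
have mA := filtration_measurable s0 FA.
have [_ [k [f [c [e [PPf ce Tp Tg cE]]]]]] := generator_total HPP HT HTfin PPp.
have PPf' i := (PPf i).1.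
have ts0 : 0 <= t - s by rewrite subr_ge0.
rewrite (dominated_integral dg s0 st mA).2.
rewrite (@eq_Ex _ _ _ _ _ (fun w => \1_A w * p (X t w) - \1_A w * p (X s w))) => [|w]; last first.
  by rewrite mulrBr.
rewrite ExB; last 2 first.
- by apply: L1_indic_mul => //; exact: process_L1.
- by apply: L1_indic_mul => //; exact: process_L1.
have -> : Ex (fun w => \1_A w * p (X t w)) =
    \sum_i c i (t - s) * Ex (fun w => \1_A w * f i (X s w)).
  by rewrite -(Ex_process_sum PPp s0 ts0 FA PPf' (Tp _ ts0)) addrC subrK.
have -> : Ex (fun w => \1_A w * p (X s w)) =
    \sum_i c i 0 * Ex (fun w => \1_A w * f i (X s w)).
  by rewrite -(Ex_process_sum PPp s0 (lexx 0) FA PPf' (Tp _ (lexx 0))) addr0.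
rewrite -sumrB.
transitivity (\sum_i Ex (fun w => \1_A w * f i (X s w)) * \int[mu]_(u in `[0, t - s]) e i u).
  by apply: eq_bigr => i _; rewrite cE// -mulrBl addrAC subrr add0r mulrC.
rewrite -cadlag_Rintegral_sum// => [|i]; last exact: (ce i).2.
pose m i := Ex (fun w => \1_A w * f i (X s w)).
have := @Rintegral_shift R (fun u => \sum_i m i * e i u) s t (- s).
rewrite subrr => ->; last first.
  apply: cadlag_integrable_itv => //; apply: cadlag_sum => i; apply: cadlagZ.
  exact: (ce i).2.
apply: eq_Rintegral => v; rewrite inE/= in_itv/= => /andP[sv vt].
have vs0 : 0 <= v - s by rewrite subr_ge0.
have [Pg _] := dg.
have := Ex_process_sum Pg s0 vs0 FA PPf' (Tg _ vs0); rewrite addrC subrK => ->.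
by apply: eq_bigr => i _; rewrite mulrC.
Qed.

Section martingale_part.
Variable p : E -> R.
Local Notation g := (gen p).
Hypotheses (PPp : PP p) (PPpp : PP (p * p)) (PPgg : PP (g * g)) (PPpg : PP (p * g))
  (dgpp : dominated (gen (p * p))).
Local Notation M := (M_process PP T X p).

Let PPg : PP g.
Proof. by have [[]] := generator_total HPP HT HTfin PPp. Qed.

Let dominated_sqr f : PP (f * f) -> dominated (f * f).
Proof. by move=> PPff; split => //; exists (f * f) => // x; rewrite ger0_norm// sqr_ge0. Qed.

Let dg : dominated g.
Proof. exact: dominated_square. Qed.

Lemma dominated_mul : dominated (p * g).
Proof.
have [[PPc PPD _] _] := HPP.
split => //; exists (p * p + g * g) => [|x]; first exact: PPD.
have -> : (p * p + g * g) x = p x * p x + g x * g x by [].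
have -> : (p * g) x = p x * g x by [].
by rewrite ler_norml; apply/andP; split; nra.
Qed.

Lemma dominated_carre : dominated (carre_du_champ PP T p p).
Proof.
have [[PPc PPD PPZ] _] := HPP; have [_ [b PPb gb]] := dgpp.
have [_ [b' PPb' gb']] := dominated_mul.
have aE : carre_du_champ PP T p p = gen (p * p) + (-2) *: (p * g).
  apply/funext => x; rewrite /carre_du_champ.
  have -> : (gen (p * p) + (-2) *: (p * g)) x = gen (p * p) x + (-2) * (p x * g x) by [].
  ring.
split; first by rewrite aE; apply: PPD; [exact: dgpp.1|exact: PPZ].
exists (b + 2 *: b') => [|x]; first by apply: PPD => //; exact: PPZ.
have -> : (b + 2 *: b') x = b x + 2 * b' x by [].
rewrite aE; have -> : (gen (p * p) + (-2) *: (p * g)) x =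
  gen (p * p) x + (-2) * (p * g) x by [].
have n2 : `|(-2) : R| = 2 by rewrite normrN ger0_norm.
by rewrite (le_trans (ler_normD _ _))// lerD// normrM n2 ler_wpM2l.
Qed.

Lemma M_incr s t w : 0 <= s -> s <= t -> M t w - M s w =
  p (X t w) - p (X s w) - \int[mu]_(v in `[s, t]) g (X v w).
Proof.
move=> s0 st; rewrite /M_process.
rewrite (cadlag_Rintegral_itvD (lexx 0) s0 st (process_cadlag w PPg)).
by rewrite opprB addrCA !opprD -!addrA; ring.
Qed.

Lemma M_0 w : M 0 w = 0.
Proof. by rewrite /M_process Rintegral_itv11 subr0 subrr. Qed.

Lemma M_cadlag w : cadlag (fun t => M t w).
Proof.
apply: cadlagB; last exact: primitive_cadlag (process_cadlag w PPg).
by apply: cadlagB; [exact: process_cadlag|exact: cadlag_cst].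
Qed.

Lemma M_adapted t : 0 <= t -> measurable_wrt (F t) (M t).
Proof.
move=> t0; have sF := filtration_sigma t0.
apply: measurable_wrtB => //; last first.
  apply: (measurable_wrt_path_integral (Y := fun v w => g (X v w))) => // [w|v /andP[v0 vt]].
    exact: process_cadlag.
  by apply: (measurable_wrt_filtration v0 vt); exact: process_wrt.
apply: measurable_wrtB => //; first exact: process_wrt.
by apply: (measurable_wrt_filtration (lexx 0) t0); exact: process_wrt.
Qed.

Lemma process_L2 f t : PP f -> PP (f * f) -> 0 <= t -> L2 (fun w => f (X t w)).
Proof.
move=> PPf PPff t0; split; first exact: L1_measurable (process_L1 PPf t0).
exact: (process_L1 PPff t0).
Qed.

(** Cauchy-Schwarz in time bounds the squared drift by [t - s] times the integral of [g^2], and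
    [g * g] is a polynomial. *)
Lemma drift_L2 s t : 0 <= s -> s <= t -> L2 (fun w => \int[mu]_(v in `[s, t]) g (X v w)).
Proof.
move=> s0 st.
have mV := L1_measurable (dominated_L1 dg s0 st).
split => //; apply: (L1_le _ (L1Z (t - s) (dominated_L1 (dominated_sqr PPgg) s0 st))).
  exact: measurable_funX.
move=> w; rewrite ger0_norm ?sqr_ge0//; apply: le_trans (ler_norm _).
exact: (sqr_Rintegral_le s0 st (process_cadlag w PPg)).
Qed.

Lemma M_L2 t : 0 <= t -> L2 (M t).
Proof.
move=> t0; apply: L2B; last exact: drift_L2.
by apply: L2B; exact: process_L2.
Qed.

Lemma M_martingale s t A : 0 <= s -> s <= t -> F s A ->
  Ex (fun w => \1_A w * (M t w - M s w)) = 0.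
Proof.
move=> s0 st FA; have t0 := le_trans s0 st; have mA := filtration_measurable s0 FA.
rewrite (@eq_Ex _ _ _ _ _ (fun w => \1_A w * (p (X t w) - p (X s w)) -
    \1_A w * \int[mu]_(v in `[s, t]) g (X v w))) => [|w]; last by rewrite M_incr// mulrBr.
rewrite ExB; first by rewrite dynkin// subrr.
- by apply: L1_indic_mul => //; apply: L1B; exact: process_L1.
- by apply: L1_indic_mul => //; exact: dominated_L1.
Qed.

Lemma M_orthogonal s t z : 0 <= s -> s <= t -> measurable_wrt (F s) z -> L2 z ->
  Ex (fun w => z w * (M t w - M s w)) = 0.
Proof.
move=> s0 st mz lz; have t0 := le_trans s0 st; have [_ Fm _] := HF.
have lM : L2 (fun w => M t w - M s w) by apply: L2B; exact: M_L2.
apply: (@orthogonal_ext _ _ _ _ (F s) (filtration_sigma s0) (Fm s s0)) => //.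
- exact: L2_L1.
- by move=> A; exact: M_martingale.
- exact: L2_mul.
Qed.

(** After Fubini, [M_t - M_s] may be replaced by [M_v - M_s] inside the time integral, because the
    future increment [M_t - M_v] is orthogonal to the [F v]-measurable [1_A g(X_v)]. This stands in
    for integration by parts between [M] and its drift. *)
Lemma Ex_incr_drift s t A : 0 <= s -> s <= t -> F s A ->
  Ex (fun w => \1_A w * ((M t w - M s w) * \int[mu]_(v in `[s, t]) g (X v w))) =
  Ex (fun w => \1_A w * \int[mu]_(v in `[s, t]) ((M v w - M s w) * g (X v w))).
Proof.
move=> s0 st FA; have t0 := le_trans s0 st; have mA := filtration_measurable s0 FA.
have cD w : cadlag (fun v => (M v w - M s w) * g (X v w)).
  apply: cadlagM; last exact: process_cadlag.
  by apply: cadlagB; [exact: M_cadlag|exact: cadlag_cst].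
have lD v : s <= v <= t -> L2 (fun w => M v w - M s w).
  by move=> /andP[sv vt]; apply: L2B; apply: M_L2 => //; exact: le_trans sv.
have lg v : s <= v <= t -> L2 (fun w => g (X v w)).
  by move=> /andP[sv vt]; apply: process_L2 => //; exact: le_trans sv.
have [Cg CgP] := dominated_bounded (dominated_sqr PPgg) t0.
have [CD CDE] : exists CD, CD = Ex (fun w => (M t w - M s w) ^+ 2) by eexists.
(* Orthogonality of increments makes the second moment of [M_v - M_s] nondecreasing in [v], so its
   value at [t] is a uniform bound. *)
have ED v : s <= v <= t -> Ex (fun w => (M v w - M s w) ^+ 2) <= CD.
  move=> svt; have /andP[sv vt] := svt; have v0 := le_trans s0 sv.
  have lv := lD v svt; have lt : L2 (fun w => M t w - M v w) by apply: L2B; exact: M_L2.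
  have lvt := L2_mul lv lt.
  rewrite CDE (@eq_Ex _ _ _ _ (fun w => (M t w - M s w) ^+ 2) (fun w => (M v w - M s w) ^+ 2 +
    (2 * ((M v w - M s w) * (M t w - M v w)) + (M t w - M v w) ^+ 2))); last first.
    by move=> w; move: (M t w) (M v w) (M s w) => x y z; ring.
  rewrite (ExD lv.2 (L1D (L1Z 2 lvt) lt.2)) (ExD (L1Z 2 lvt) lt.2) (ExZ 2 lvt).
  rewrite (M_orthogonal v0 vt _ lv) ?mulr0 ?add0r ?lerDl.
    by apply: Ex_ge0 => w; exact: sqr_ge0.
  apply: (measurable_wrtB (filtration_sigma v0)); first exact: M_adapted.
  exact: (measurable_wrt_filtration s0 sv (M_adapted s0)).
have Egg v : s <= v <= t -> Ex (fun w => g (X v w) ^+ 2) <= Cg.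
  move=> /andP[sv vt]; have v0 := le_trans s0 sv.
  have v0t : 0 <= v <= t by rewrite v0.
  apply: le_trans (CgP v v0t); apply: le_Ex.
  - exact: (process_L1 PPgg v0).
  - by apply: L1_norm; exact: process_L1.
  - by move=> w; exact: ler_norm.
have bnd (D : Omega -> R) v : s <= v <= t -> L2 D -> Ex (fun w => D w ^+ 2) <= CD ->
    Ex (fun w => `|\1_A w * (D w * g (X v w))|) <= CD + Cg.
  move=> svt lDD ED'.
  apply: (@le_trans _ _ (Ex (fun w => D w ^+ 2 + g (X v w) ^+ 2))); last first.
    by rewrite ExD; [rewrite lerD// Egg|exact: lDD.2|exact: (lg v svt).2].
  apply: le_Ex.
  - by apply: L1_norm; apply: L1_indic_mul => //; apply: L2_mul => //; exact: lg.
  - by apply: L1D; [exact: lDD.2|exact: (lg v svt).2].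
  - move=> w; rewrite normrM; apply: (@le_trans _ _ `|D w * g (X v w)|).
      by rewrite ler_piMl// indicE; case: (_ \in _); rewrite ?normr1 ?normr0.
    by rewrite ler_norml; apply/andP; split; nra.
transitivity (\int[mu]_(v in `[s, t]) Ex (fun w => \1_A w * ((M t w - M s w) * g (X v w)))).
  rewrite -(Ex_path_integral (C := CD + Cg) (Y := fun v w => \1_A w * ((M t w - M s w) * g (X v w)))
    s0 st _ _).2.
  - apply: eq_Ex => w; rewrite cadlag_RintegralZ//; last by apply: cadlagZ; exact: process_cadlag.
    by rewrite cadlag_RintegralZ//; exact: process_cadlag.
  - by move=> w; apply: cadlagZ; apply: cadlagZ; exact: process_cadlag.
  - move=> v svt; split.
      apply: L1_indic_mul => //; apply: L2_mul; last exact: lg.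
      by apply: lD; rewrite st lexx.
    by apply: bnd => //; [apply: lD|apply: ED]; rewrite st lexx.
transitivity (\int[mu]_(v in `[s, t]) Ex (fun w => \1_A w * ((M v w - M s w) * g (X v w)))).
  apply: eq_Rintegral => v; rewrite inE/= in_itv/= => svt.
  have /andP[sv vt] := svt; have v0 := le_trans s0 sv.
  rewrite (@eq_Ex _ _ _ _ _ (fun w => (\1_A w * g (X v w)) * (M t w - M v w) +
     \1_A w * ((M v w - M s w) * g (X v w)))) => [|w]; last by ring.
  have lz : L2 (fun w => \1_A w * g (X v w)) by apply: L2_indic_mul => //; exact: lg.
  rewrite ExD; last 2 first.
  - by apply: L2_mul => //; apply: L2B; apply: M_L2.
  - by apply: L1_indic_mul => //; apply: L2_mul; [exact: lD|exact: lg].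
  rewrite M_orthogonal// ?add0r//.
  apply: measurable_wrtM; first exact: filtration_sigma.
  - apply: (measurable_wrt_filtration s0 sv); apply: measurable_wrt_indic => //.
    exact: filtration_sigma.
  - exact: process_wrt.
rewrite -(Ex_path_integral (C := CD + Cg) (Y := fun v w => \1_A w * ((M v w - M s w) * g (X v w)))
    s0 st _ _).2.
- by apply: eq_Ex => w; rewrite cadlag_RintegralZ.
- by move=> w; apply: cadlagZ.
- move=> v svt; split; first by apply: L1_indic_mul => //; apply: L2_mul; [exact: lD|exact: lg].
  by apply: bnd => //; [exact: lD|exact: ED].
Qed.

(** With [D] the increment of [M] and [V] the drift, [p(X_t) = p(X_s) + D + V], so [D^2] is the
    increment of [p^2] minus [2 p(X_s) D + 2 D V + 2 p(X_s) V + V^2]. Dynkin's formula for [p * p]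
    handles the increment, [p(X_s) D] has mean 0 on [A], and [D V] is replaced by [K] through
    [Ex_incr_drift]. Expanding [K] cancels the remaining terms and leaves the integral of
    [gen (p * p) - 2 p g]. *)
Lemma M_bracket s t A : 0 <= s -> s <= t -> F s A ->
  Ex (fun w => \1_A w * (M t w - M s w) ^+ 2) =
  Ex (fun w => \1_A w * \int[mu]_(v in `[s, t]) carre_du_champ PP T p p (X v w)).
Proof.
move=> s0 st FA; have t0 := le_trans s0 st; have mA := filtration_measurable s0 FA.
pose V w := \int[mu]_(v in `[s, t]) g (X v w).
pose D w := M t w - M s w.
pose K w := \int[mu]_(v in `[s, t]) ((M v w - M s w) * g (X v w)).
have lD : L2 D by apply: L2B; exact: M_L2.
have lV : L2 V by exact: drift_L2.
have lps : L2 (fun w => p (X s w)) by exact: process_L2.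
have cg w := process_cadlag w PPg.
have cp w := process_cadlag w PPp.
(* Here [M_v - M_s = p(X_v) - p(X_s)] minus the integral of [g] over [[s, v]]; the iterated integral
   of [g] equals [V^2 / 2] by [Rintegral_primitive]. *)
have KE w : K w = \int[mu]_(v in `[s, t]) (p * g) (X v w) - p (X s w) * V w - V w ^+ 2 / 2.
  rewrite -(Rintegral_primitive s0 st (cg w)) /K.
  set B := \int[mu]_(v in _) (g (X v w) * _); rewrite [2 * B / 2]mulrAC divff ?pnatr_eq0// mul1r.
  rewrite /B /V -cadlag_RintegralZ//.
  have cI : cadlag (fun v => g (X v w) * (\int[mu]_(x in `[0, v]) g (X x w) -
      \int[mu]_(x in `[0, s]) g (X x w))).
    by apply: cadlagM => //; apply: cadlagB; [exact: primitive_cadlag|exact: cadlag_cst].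
  have -> : \int[mu]_(v in `[s, t]) (g (X v w) * \int[mu]_(u in `[s, v]) g (X u w)) =
      \int[mu]_(v in `[s, t]) (g (X v w) * (\int[mu]_(x in `[0, v]) g (X x w) -
      \int[mu]_(x in `[0, s]) g (X x w))).
    apply: eq_Rintegral => v; rewrite inE/= in_itv/= => /andP[sv vt].
    by rewrite (cadlag_Rintegral_itvD (lexx 0) s0 sv (cg w)) addrAC subrr add0r.
  rewrite -cadlag_RintegralB//; [|exact: process_cadlag|exact: cadlagZ].
  rewrite -cadlag_RintegralB//; last by apply: cadlagB; [exact: process_cadlag|exact: cadlagZ].
  apply: eq_Rintegral => v; rewrite inE/= in_itv/= => /andP[sv vt].
  rewrite M_incr// (cadlag_Rintegral_itvD (lexx 0) s0 sv (cg w)).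
  have -> : (p * g) (X v w) = p (X v w) * g (X v w) by [].
  move: (\int[mu]_(x in `[0, s]) _) (\int[mu]_(x in `[s, v]) _) => I0 I1; ring.
have lK : L1 K.
  rewrite (funext KE); apply: L1B; last first.
    by under [X in L1 X]eq_fun do rewrite mulrC; apply: L1Z; exact: lV.2.
  by apply: L1B; [exact: dominated_L1 dominated_mul s0 st|exact: L2_mul].
pose Q w := \int[mu]_(v in `[s, t]) gen (p * p) (X v w).
have lQ : L1 Q by exact: dominated_L1.
have lpp u : 0 <= u -> L1 (fun w => (p * p) (X u w)) by exact: process_L1.
have e1 : Ex (fun w => \1_A w * ((p * p) (X t w) - (p * p) (X s w))) =
  Ex (fun w => \1_A w * Q w) by exact: dynkin.
have e2 : Ex (fun w => (\1_A w * p (X s w)) * D w) = 0.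
  apply: M_orthogonal => //; last exact: L2_indic_mul.
  apply: measurable_wrtM; [exact: filtration_sigma| |exact: process_wrt].
  by apply: measurable_wrt_indic => //; exact: filtration_sigma.
have e3 : Ex (fun w => \1_A w * (D w * V w)) = Ex (fun w => \1_A w * K w).
  exact: Ex_incr_drift.
have lA f : L1 f -> L1 (fun w => \1_A w * f w) by exact: L1_indic_mul.
have lpD : L1 (fun w => \1_A w * p (X s w) * D w).
  by apply: L2_mul => //; exact: L2_indic_mul.
have lDV : L1 (fun w => \1_A w * (D w * V w)) by apply: lA; exact: L2_mul.
have lpV : L1 (fun w => p (X s w) * V w) by exact: L2_mul.
transitivity (Ex (fun w => \1_A w * ((p * p) (X t w) - (p * p) (X s w)) -
   (2 * (\1_A w * p (X s w) * D w) + (2 * (\1_A w * (D w * V w)) +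
   \1_A w * (2 * (p (X s w) * V w) + V w ^+ 2))))).
  apply: eq_Ex => w; rewrite -/(D w).
  have -> : (p * p) (X t w) = p (X t w) * p (X t w) by [].
  have -> : (p * p) (X s w) = p (X s w) * p (X s w) by [].
  have -> : p (X t w) = p (X s w) + D w + V w by rewrite /D /V M_incr//; ring.
  ring.
have lR : L1 (fun w => \1_A w * (2 * (p (X s w) * V w) + V w ^+ 2)).
  by apply: lA; apply: L1D; [exact: L1Z|exact: lV.2].
have lDR := L1D (L1Z 2 lDV) lR.
rewrite (ExB (lA _ (L1B (lpp t t0) (lpp s s0))) (L1D (L1Z 2 lpD) lDR)) (ExD (L1Z 2 lpD) lDR).
rewrite (ExD (L1Z 2 lDV) lR) (ExZ 2 lpD) (ExZ 2 lDV) e1 e2 e3 mulr0 add0r.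
have l2K := L1Z 2 (lA _ lK).
rewrite -(ExZ 2 (lA _ lK)) -(ExD l2K lR) -(ExB (lA _ lQ) (L1D l2K lR)).
apply: eq_Ex => w; rewrite KE.
have -> : \int[mu]_(v in `[s, t]) carre_du_champ PP T p p (X v w) =
    Q w - 2 * \int[mu]_(v in `[s, t]) (p * g) (X v w).
  have cpg : cadlag (fun v => (p * g) (X v w)) by exact: process_cadlag.
  rewrite -cadlag_RintegralZ// /Q -cadlag_RintegralB//; last 2 first.
  - exact: (process_cadlag w dgpp.1).
  - exact: cadlagZ.
  apply: eq_Rintegral => v _; rewrite /carre_du_champ.
  have -> : (p * g) (X v w) = p (X v w) * g (X v w) by [].
  ring.
by move: (\int[mu]_(v in _) _) (Q w) (V w) (p _) => *; field.
Qed.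

End martingale_part.

End polynomial_process.

(** * Isometry of elementary stochastic integrals *)

Section step_functions.
Context (R : realType).
Local Notation mu := (@lebesgue_measure R).
Implicit Types (f : R -> R) (x y t : R).

Lemma indic_oc_integral f x y t : 0 <= x -> y <= t -> cadlag f ->
  mu.-integrable `[0, t] (EFin \o (fun s => \1_`]x, y] s * f s)) /\
  \int[mu]_(s in `[0, t]) (\1_`]x, y] s * f s) = \int[mu]_(s in `[x, y]) f s.
Proof.
move=> x0 yt cf.
have if1 : mu.-integrable `[x, y] (EFin \o f) by exact: cadlag_integrable_itv.
have if2 : mu.-integrable `]x, y] (EFin \o f).
  by apply: integrableS if1 => //; apply: subset_itvr; rewrite bnd_simp.
have E1 : (fun s => \1_`]x, y] s * f s) \_ `[0, t] = f \_ `]x, y].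
  apply/funext => s; rewrite /patch indicE !mem_setE !in_itv/=.
  have [xs|sx] := ltP x s => /=; last by rewrite mul0r; case: ifP.
  have [sy|ys] := leP s y; last by rewrite mul0r; case: ifP.
  by rewrite mul1r (le_trans sy yt) (le_trans x0 (ltW xs)).
split; last first.
  by rewrite -Rintegral_itv_obnd_cbnd// Rintegral_mkcond E1 -Rintegral_mkcond.
have h : mu.-integrable setT (EFin \o (f \_ `]x, y])).
  by rewrite -restrict_EFin -integrable_mkcond.
by rewrite integrable_mkcond// restrict_EFin E1.
Qed.

Lemma indic_ocM x y x' y' s : (\1_`]x, y] s * \1_`]x', y'] s : R) =
  \1_`]Num.max x x', Num.min y y'] s.
Proof.
rewrite !indicE !mem_setE !in_itv/= gt_max le_min.
by case: (x < s); case: (s <= y); case: (x' < s); case: (s <= y');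
  rewrite ?mulr0 ?mul0r ?mulr1.
Qed.

(** Intervals are open on the left, as for a predictable integrand: the weight [z i], known at
    [u i], acts strictly after [u i]. They are allowed to overlap. *)
Definition step (I : finType) (z u v : I -> R) (s : R) : R :=
  \sum_i z i * \1_`]u i, v i] s.

(** The square is expanded over pairs because the intervals may overlap, as they do for the
    difference of two partitions; disjoint pairs have an empty range of integration. *)
Lemma step_sqr_integral (I : finType) (z u v : I -> R) f t :
  (forall i, 0 <= u i) -> (forall i, v i <= t) -> cadlag f ->
  mu.-integrable `[0, t] (EFin \o (fun s => step z u v s ^+ 2 * f s)) /\
  \int[mu]_(s in `[0, t]) (step z u v s ^+ 2 * f s) =
  \sum_i \sum_j z i * z j *
    \int[mu]_(s in `[Num.max (u i) (u j), Num.min (v i) (v j)]) f s.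
Proof.
move=> u0 vt cf.
have E1 s : step z u v s ^+ 2 * f s = \sum_(k : I * I) z k.1 * z k.2 *
    (\1_`]Num.max (u k.1) (u k.2), Num.min (v k.1) (v k.2)] s * f s).
  rewrite /step expr2 mulr_suml mulr_suml; under eq_bigr do rewrite mulr_sumr mulr_suml.
  rewrite pair_big; apply: eq_bigr => -[i j] _ /=.
  by rewrite -indic_ocM; ring.
have h (k : I * I) : mu.-integrable `[0, t] (EFin \o (fun s =>
    \1_`]Num.max (u k.1) (u k.2), Num.min (v k.1) (v k.2)] s * f s)) /\
   \int[mu]_(s in `[0, t]) (\1_`]Num.max (u k.1) (u k.2), Num.min (v k.1) (v k.2)] s * f s) =
   \int[mu]_(s in `[Num.max (u k.1) (u k.2), Num.min (v k.1) (v k.2)]) f s.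
  by apply: indic_oc_integral => //; rewrite ?le_max ?u0// ge_min vt.
rewrite (funext E1).
have [h1 h2] := @Rintegral_lincomb R _ (measurableTypeR R) mu `[0, t]%classic _
  (index_enum _) (fun k : I * I => z k.1 * z k.2) _ (measurable_itv _) (fun k => (h k).1).
split => //; rewrite h2 pair_big; apply: eq_bigr => -[i j] _ /=.
by rewrite (h (i, j)).2.
Qed.

End step_functions.

Section square_integrable_martingale.
Context (R : realType) d (Omega : measurableType d) (Pr : probability Omega R)
  (F : R -> set (set Omega)) (HF : is_filtration F) (M a : R -> Omega -> R).
Local Notation mu := (@lebesgue_measure R).
Local Notation Ex := (Ex Pr).
Local Notation L1 := (L1 Pr).
Local Notation L2 := (L2 Pr).
Hypotheses (aM : forall t, 0 <= t -> measurable_wrt (F t) (M t))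
  (lM : forall t, 0 <= t -> L2 (M t))
  (mM : forall s t A, 0 <= s -> s <= t -> F s A ->
    Ex (fun w => \1_A w * (M t w - M s w)) = 0)
  (ca : forall w, cadlag (a ^~ w))
  (la : forall s t, 0 <= s -> s <= t -> L1 (fun w => \int[mu]_(v in `[s, t]) a v w))
  (bM : forall s t A, 0 <= s -> s <= t -> F s A ->
    Ex (fun w => \1_A w * (M t w - M s w) ^+ 2) =
    Ex (fun w => \1_A w * \int[mu]_(v in `[s, t]) a v w)).

Let sF t (t0 : 0 <= t) : sigma_algebra setT (F t) := filtration_sigma HF t0.
Let Fm t (t0 : 0 <= t) : F t `<=` measurable :=
  fun A FA => filtration_measurable HF t0 FA.

Lemma increment_L2 s t : 0 <= s -> 0 <= t -> L2 (fun w => M t w - M s w).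
Proof. by move=> s0 t0; apply: L2B; exact: lM. Qed.

Lemma increment_orthogonal s t (z : Omega -> R) : 0 <= s -> s <= t -> measurable_wrt (F s) z ->
  L1 (fun w => z w * (M t w - M s w)) -> Ex (fun w => z w * (M t w - M s w)) = 0.
Proof.
move=> s0 st mz lz; have t0 := le_trans s0 st.
apply: (orthogonal_ext (sF s0) (@Fm s s0)) => //; first exact/L2_L1/increment_L2.
by move=> A; exact: mM.
Qed.

Lemma increment_bracket s t (z : Omega -> R) (C : R) : 0 <= s -> s <= t -> measurable_wrt (F s) z ->
  (forall w, `|z w| <= C) ->
  Ex (fun w => z w * (M t w - M s w) ^+ 2) =
  Ex (fun w => z w * \int[mu]_(v in `[s, t]) a v w).
Proof.
move=> s0 st mz zC; have t0 := le_trans s0 st.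
have mz' := measurable_wrt_measurable (@Fm s s0) mz.
have lD := (increment_L2 s0 t0).2; have lA := la s0 st.
apply/eqP; rewrite -subr_eq0; apply/eqP.
rewrite -ExB; [|exact: L1_bounded_mul mz' zC lD|exact: L1_bounded_mul mz' zC lA].
rewrite -(@orthogonal_ext _ _ _ Pr _ (sF s0) (@Fm s s0)
  (fun w => (M t w - M s w) ^+ 2 - \int[mu]_(v in `[s, t]) a v w) z) //.
- by apply: eq_Ex => w; rewrite mulrBr.
- exact: L1B.
- move=> A FA; have mA := Fm s0 FA.
  rewrite (@eq_Ex _ _ _ _ _ (fun w => \1_A w * (M t w - M s w) ^+ 2 -
    \1_A w * \int[mu]_(v in `[s, t]) a v w)) => [|w]; last by rewrite mulrBr.
  by rewrite ExB; [rewrite bM// subrr|exact: L1_indic_mul|exact: L1_indic_mul].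
- by apply: (L1_bounded_mul mz' zC); exact: L1B.
Qed.

(** The data of one term [Z * (M_v - M_u)] of an elementary stochastic integral. *)
Record bounded_interval (Z : Omega -> R) (u v C : R) : Prop := BoundedInterval {
  bi_ge0 : 0 <= u;
  bi_le : u <= v;
  bi_meas : measurable_wrt (F u) Z;
  bi_bound : forall w, `|Z w| <= C }.

(** The first increment is split at the later starting time [u']. Its part before [u'] is orthogonal
    to the second increment. Beyond [u'], the two increments share the piece up to [m = min v v'],
    which contributes its square, while the excess of the longer one is again a future increment. *)
Let bilinear_le Z u v C Z' u' v' C' :
  bounded_interval Z u v C -> bounded_interval Z' u' v' C' -> u <= u' ->
  Ex (fun w => (Z w * (M v w - M u w)) * (Z' w * (M v' w - M u' w))) =
  Ex (fun w => Z w * Z' w *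
    \int[mu]_(s in `[Num.max u u', Num.min v v']) a s w).
Proof.
move=> [u0 uv mZ ZC] [u0' uv' mZ' ZC'] uu'.
have v0 := le_trans u0 uv; have v0' := le_trans u0' uv'.
have mZu : measurable_wrt (F u') Z := measurable_wrt_filtration HF u0 uu' mZ.
have gZ := measurable_wrt_measurable (@Fm u u0) mZ.
have gZ' := measurable_wrt_measurable (@Fm u' u0') mZ'.
have sF' := sF u0'.
have lZZ (b c : R) : 0 <= b -> 0 <= c ->
    L1 (fun w => (Z w * (M c w - M b w)) * (Z' w * (M v' w - M u' w))).
  by move=> b0 c0; apply: L2_mul; [apply: L2_bounded_mul gZ ZC _|apply: L2_bounded_mul gZ' ZC' _];
    exact: increment_L2.
have past c : 0 <= c -> c <= u' ->
    Ex (fun w => (Z w * (M c w - M u w)) * (Z' w * (M v' w - M u' w))) = 0.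
  move=> c0 cu'; rewrite (@eq_Ex _ _ _ _ _
    (fun w => (Z w * (M c w - M u w) * Z' w) * (M v' w - M u' w))) => [|w]; last by ring.
  apply: increment_orthogonal => //.
    apply: measurable_wrtM => //; apply: measurable_wrtM => //.
    apply: measurable_wrtB => //.
      by apply: (measurable_wrt_filtration HF c0 cu'); exact: aM.
    by apply: (measurable_wrt_filtration HF u0 uu'); exact: aM.
  have := lZZ u c u0 c0.
  by under [X in L1 X -> _]eq_fun do rewrite mulrA.
rewrite max_r//; have [vu'|u'v] := leP v u'.
  rewrite past//.
  rewrite (@eq_Ex _ _ _ _ _ (fun=> 0)) ?Ex_cst// => w.
  have mle : Num.min v v' <= u' by rewrite ge_min vu'.
  move: mle; rewrite le_eqVlt => /predU1P[->|mlt]; first by rewrite Rintegral_itv11 mulr0.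
  by rewrite set_itv_ge ?bnd_simp -?ltNge// Rintegral_set0 mulr0.
have u'v_ := ltW u'v.
set m := Num.min v v'; set n := Num.max v v'.
have u'm : u' <= m by rewrite le_min u'v_.
have mn : m <= n by rewrite ge_min le_max lexx.
have m0 := le_trans u0' u'm; have n0 := le_trans m0 mn.
have vv'E w : (M v w - M u' w) * (M v' w - M u' w) =
    (M m w - M u' w) ^+ 2 + (M m w - M u' w) * (M n w - M m w).
  by rewrite /m /n; case: (leP v v') => _; ring.
have ZZ'C w : `|Z w * Z' w| <= C * C' by rewrite normrM ler_pM.
have gZZ : measurable_fun setT (fun w => Z w * Z' w) by exact: measurable_funM.
have mZZ : measurable_wrt (F u') (fun w => Z w * Z' w) by exact: measurable_wrtM.
have lmn : L1 (fun w => (Z w * Z' w * (M m w - M u' w)) * (M n w - M m w)).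
  apply: L2_mul; last exact: increment_L2.
  by apply: L2_bounded_mul gZZ ZZ'C _; exact: increment_L2.
have lmu : L1 (fun w => Z w * Z' w * (M m w - M u' w) ^+ 2).
  by apply: L1_bounded_mul gZZ ZZ'C _; exact: (increment_L2 u0' m0).2.
rewrite (@eq_Ex _ _ _ _ _ (fun w => (Z w * (M u' w - M u w)) * (Z' w * (M v' w - M u' w)) +
   (Z w * Z' w * (M m w - M u' w) ^+ 2 +
     (Z w * Z' w * (M m w - M u' w)) * (M n w - M m w)))) => [|w]; last first.
  transitivity ((Z w * (M u' w - M u w)) * (Z' w * (M v' w - M u' w)) +
    Z w * Z' w * ((M v w - M u' w) * (M v' w - M u' w))); first by ring.
  by rewrite vv'E; ring.
rewrite ExD; [|exact: lZZ|exact: L1D].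
rewrite past// add0r ExD// (increment_bracket _ _ _ ZZ'C)//.
rewrite increment_orthogonal// ?addr0//.
apply: (measurable_wrtM (sF m0)).
  exact: (measurable_wrt_filtration HF u0' u'm mZZ).
apply: (measurable_wrtB (sF m0)); first exact: aM.
by apply: (measurable_wrt_filtration HF u0' u'm); exact: aM.
Qed.

Lemma increments_bilinear Z u v C Z' u' v' C' :
  bounded_interval Z u v C -> bounded_interval Z' u' v' C' ->
  Ex (fun w => (Z w * (M v w - M u w)) * (Z' w * (M v' w - M u' w))) =
  Ex (fun w => Z w * Z' w *
    \int[mu]_(s in `[Num.max u u', Num.min v v']) a s w).
Proof.
move=> bi bi'; have /orP[uu'|uu'] := le_total u u'; first exact: (bilinear_le bi bi' uu').
rewrite (@eq_Ex _ _ _ _ _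
  (fun w => (Z' w * (M v' w - M u' w)) * (Z w * (M v w - M u w)))) => [|w]; last by ring.
rewrite (bilinear_le bi' bi uu'); apply: eq_Ex => w.
by rewrite maxC minC [Z' w * _]mulrC.
Qed.

Lemma path_integral_L1 (b : R -> Omega -> R) x y :
  (forall s t, 0 <= s -> s <= t -> L1 (fun w => \int[mu]_(v in `[s, t]) b v w)) ->
  0 <= x -> L1 (fun w => \int[mu]_(v in `[x, y]) b v w).
Proof.
move=> lb x0; have [xy|yx] := leP x y; first exact: lb.
under [X in L1 X]eq_fun do rewrite set_itv_ge ?bnd_simp -?ltNge// Rintegral_set0.
exact: L1_cst.
Qed.

Section isometry.
Variables (I : finType) (Z : I -> Omega -> R) (u v : I -> R) (C t : R).
Hypotheses (bi : forall i, bounded_interval (Z i) (u i) (v i) C) (vt : forall i, v i <= t).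

Let gZ i : measurable_fun setT (Z i).
Proof. exact: (measurable_wrt_measurable (@Fm _ (bi_ge0 (bi i))) (bi_meas (bi i))). Qed.

Let ZZC i j w : `|Z i w * Z j w| <= C * C.
Proof. by rewrite normrM; apply: ler_pM => //; exact: bi_bound (bi _) w. Qed.

Lemma step_integral_L1 (b : R -> Omega -> R) : (forall w, cadlag (b ^~ w)) ->
  (forall s t, 0 <= s -> s <= t -> L1 (fun w => \int[mu]_(v in `[s, t]) b v w)) ->
  L1 (fun w => \int[mu]_(s in `[0, t]) (step (Z ^~ w) u v s ^+ 2 * b s w)).
Proof.
move=> cb lb.
have u0 i : 0 <= u i := bi_ge0 (bi i).
under [X in L1 X]eq_fun do rewrite (step_sqr_integral _ u0 vt (cb _)).2.
apply: L1_sum => i; apply: L1_sum => j.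
have gZZ : measurable_fun setT (fun w => Z i w * Z j w) by exact: measurable_funM.
apply: (L1_bounded_mul gZZ (ZZC i j)).
by apply: path_integral_L1 => //; rewrite le_max u0.
Qed.

(** Both sides expand over pairs of intervals and agree term by term through
    [increments_bilinear]. *)
Lemma isometry :
  Ex (fun w => (\sum_i Z i w * (M (v i) w - M (u i) w)) ^+ 2) =
  Ex (fun w => \int[mu]_(s in `[0, t]) (step (Z ^~ w) u v s ^+ 2 * a s w)).
Proof.
have u0 i : 0 <= u i := bi_ge0 (bi i).
have v0 i : 0 <= v i := le_trans (u0 i) (bi_le (bi i)).
have lD i : L2 (fun w => Z i w * (M (v i) w - M (u i) w)).
  by apply: L2_bounded_mul (gZ i) (bi_bound (bi i)) _; exact: increment_L2.
pose J i j w := Z i w * Z j w *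
  \int[mu]_(s in `[Num.max (u i) (u j), Num.min (v i) (v j)]) a s w.
have lJ i j : L1 (J i j).
  have gZZ : measurable_fun setT (fun w => Z i w * Z j w) by exact: measurable_funM.
  apply: (L1_bounded_mul gZZ (ZZC i j)).
  by apply: path_integral_L1 => //; rewrite le_max u0.
transitivity (\sum_i \sum_j Ex (J i j)).
  rewrite (@eq_Ex _ _ _ _ _ (fun w => \sum_i \sum_j
    (Z i w * (M (v i) w - M (u i) w)) * (Z j w * (M (v j) w - M (u j) w)))) => [|w].
    rewrite Ex_sum => [|i]; last by apply: L1_sum => j; exact: L2_mul.
    apply: eq_bigr => i _; rewrite Ex_sum => [|j]; last exact: L2_mul.
    by apply: eq_bigr => j _; exact: (increments_bilinear (bi i) (bi j)).
  by rewrite expr2 mulr_suml; apply: eq_bigr => i _; rewrite mulr_sumr.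
rewrite (@eq_Ex _ _ _ _ _ (fun w => \sum_i \sum_j J i j w) _) => [|w]; last first.
  by rewrite (step_sqr_integral _ u0 vt (ca w)).2.
rewrite Ex_sum => [|i]; last exact: L1_sum.
by apply: eq_bigr => i _; rewrite Ex_sum.
Qed.

Lemma increments_sqr_L1 : L1 (fun w => (\sum_i Z i w * (M (v i) w - M (u i) w)) ^+ 2).
Proof.
have u0 i : 0 <= u i := bi_ge0 (bi i).
have v0 i : 0 <= v i := le_trans (u0 i) (bi_le (bi i)).
have lD i : L2 (fun w => Z i w * (M (v i) w - M (u i) w)).
  by apply: L2_bounded_mul (gZ i) (bi_bound (bi i)) _; exact: increment_L2.
under [X in L1 X]eq_fun do rewrite expr2 mulr_suml.
apply: L1_sum => i; under [X in L1 X]eq_fun do rewrite mulr_sumr.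
by apply: L1_sum => j; exact: L2_mul.
Qed.

End isometry.

End square_integrable_martingale.

(** * Left-point sums *)

Section dominated_integrals.
Context (R : realType) d (T : measurableType d) (m : {measure set T -> \bar R}) (D : set T).

Lemma Rintegral_dominated (f_ : nat -> T -> R) f g : measurable D ->
  (forall n, measurable_fun D (f_ n)) -> m.-integrable D (EFin \o g) ->
  (forall n x, D x -> `|f_ n x| <= g x) -> (forall x, D x -> f_ n x @[n --> \oo] --> f x) ->
  \int[m]_(x in D) f_ n x @[n --> \oo] --> \int[m]_(x in D) f x.
Proof.
move=> mD mf_ lg fg cf.
have mf : measurable_fun D f by exact: measurable_fun_cvg mf_ cf.
have [| | | | |lf _ h] := @dominated_convergence _ _ _ m D mD
    (fun n => EFin \o f_ n) (EFin \o f) (EFin \o g).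
- by move=> n; exact/measurable_EFinP.
- exact/measurable_EFinP.
- by apply: aeW => x Dx; apply: cvg_EFin; [exact: nearW|exact: cf].
- exact: lg.
- by apply: aeW => x n Dx /=; rewrite lee_fin fg.
have := fine_cvg (f := fun n => (\int[m]_(x in D) (f_ n x)%:E)%E).
move=> /(_ _ _ (\int[m]_(x in D) f x)); apply.
by rewrite /Rintegral fineK//; exact: integrable_fin_num lf.
Qed.

End dominated_integrals.

Section partitions.
Context (R : realType).
Implicit Types (u : nat -> R) (t : R).

(* Repeated points are allowed, so that the stopped grids [min (u i) t] are
   partitions of [0, t] for every [t]. *)
Definition weak_partition t u N := [/\ u 0%N = 0, forall i, u i <= u i.+1 & u N = t].

Lemma weak_partition_le t u N i j : weak_partition t u N -> (i <= j)%N -> u i <= u j.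
Proof. by move=> [_ /nondecreasing_seqP uS _]; exact: uS. Qed.

Lemma weak_partition_ge0 t u N i : weak_partition t u N -> 0 <= u i.
Proof. by move=> wp; have [<- _ _] := wp; exact: weak_partition_le wp _. Qed.

Lemma weak_partition_let t u N i : weak_partition t u N -> (i <= N)%N -> u i <= t.
Proof. by move=> wp iN; have [_ _ <-] := wp; exact: weak_partition_le wp _. Qed.

Definition partition_step u N (z : nat -> R) : R -> R :=
  step (fun i : 'I_N => z i) (fun i => u i) (fun i => u i.+1).

Lemma partition_stepE t u N z s : weak_partition t u N -> 0 < s <= t ->
  exists j : 'I_N, u j < s <= u j.+1 /\ partition_step u N z s = z j.
Proof.
move=> wp /andP[s0 st]; have [u0 uS uN] := wp.
have ex : exists n, s <= u n by exists N; rewrite uN.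
have [n sn nmin] := ex_minnP ex.
have nN : (n <= N)%N by apply: nmin; rewrite uN.
case: n sn nmin nN => [|j] sn nmin jN; first by move: s0; rewrite ltNge -u0 sn.
have uj : u j < s by rewrite ltNge; apply/negP => /nmin; rewrite ltnn.
exists (Ordinal jN); split; first by rewrite /= uj.
rewrite /partition_step /step (bigD1 (Ordinal jN))//= big1 => [|i ij].
  by rewrite indicE mem_setE in_itv/= uj sn mulr1 addr0.
rewrite indicE mem_setE in_itv/=; case: (ltnP i j) => [ij'|ji].
  by rewrite [s <= _]leNgt (le_lt_trans (weak_partition_le wp ij') uj) andbF mulr0.
have ji' : (j < i)%N by rewrite ltn_neqAle ji andbT eq_sym; apply: contraNneq ij => e; apply/eqP/val_inj.
by rewrite ltNge (le_trans sn (weak_partition_le wp ji')) mulr0.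
Qed.

Lemma partition_step0 t u N z : weak_partition t u N -> partition_step u N z 0 = 0.
Proof.
move=> wp; rewrite /partition_step /step big1// => i _.
by rewrite indicE mem_setE in_itv/= ltNge (weak_partition_ge0 _ wp) mulr0.
Qed.

Lemma partition_integral t u N f : weak_partition t u N -> cadlag f ->
  \sum_(i < N) \int[lebesgue_measure]_(x in `[u i, u i.+1]) f x =
  \int[lebesgue_measure]_(x in `[0, t]) f x.
Proof.
move=> wp cf; have [u0 uS <-] := wp.
have h n : \sum_(i < n) \int[lebesgue_measure]_(x in `[u i, u i.+1]) f x =
    \int[lebesgue_measure]_(x in `[0, u n]) f x; last exact: h.
elim: n => [|n ih]; first by rewrite big_ord0 u0 Rintegral_itv11.
rewrite big_ord_recr/= ih -(cadlag_Rintegral_itvD (lexx 0) _ (uS n) cf)//.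
exact: weak_partition_ge0 wp.
Qed.

End partitions.

Section mesh.
Context (R : realType).
Implicit Types (u : nat -> R) (t : R).

Definition mesh_below u N (e : R) := forall i, (i < N)%N -> u i.+1 - u i < e.

(** Dominated convergence works along sequences, while convergence in probability of covariation
    sums asks for a mesh bound. Failure at every mesh [1 / n.+1] would produce sequences
    contradicting the hypothesis. *)
Lemma uniform_of_sequences t (D : (nat -> R) -> nat -> (nat -> R) -> nat -> R) :
  (forall (u : nat -> nat -> R) (N : nat -> nat) (u' : nat -> nat -> R) (N' : nat -> nat),
    (forall n, weak_partition t (u n) (N n)) -> (forall n, weak_partition t (u' n) (N' n)) ->
    (forall e : R, 0 < e -> \forall n \near \oo, mesh_below (u n) (N n) e) ->
    (forall e : R, 0 < e -> \forall n \near \oo, mesh_below (u' n) (N' n) e) ->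
    D (u n) (N n) (u' n) (N' n) @[n --> \oo] --> 0) ->
  forall e : R, 0 < e -> exists2 dlt : R, 0 < dlt &
    forall u N u' N', weak_partition t u N -> weak_partition t u' N' ->
      mesh_below u N dlt -> mesh_below u' N' dlt -> D u N u' N' <= e.
Proof.
move=> hD e e0; apply: contrapT => nh.
have ex n : exists u N u' N', [/\ weak_partition t u N, weak_partition t u' N',
    mesh_below u N n.+1%:R^-1, mesh_below u' N' n.+1%:R^-1 & e < D u N u' N'].
  apply: contrapT => nx; apply: nh; exists n.+1%:R^-1; first by rewrite invr_gt0.
  move=> u N u' N' wp wp' mh mh'; rewrite leNgt; apply/negP => lt.
  by apply: nx; exists u, N, u', N'.
have /choice[u /choice[N /choice[u' /choice[N' P]]]] := ex.
have inv0 (dlt : R) : 0 < dlt -> \forall n \near \oo, n.+1%:R^-1 < dlt.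
  move=> d0; have /cvgrPdist_lt/(_ _ d0) := @cvg_harmonic R.
  by apply: filterS => n; rewrite sub0r normrN ger0_norm ?invr_ge0.
have cv := hD u N u' N'.
have {}cv : D (u n) (N n) (u' n) (N' n) @[n --> \oo] --> 0.
  apply: cv => [n|n|dlt d0|dlt d0].
  - by have [] := P n.
  - by have [] := P n.
  - apply: filterS (inv0 _ d0) => n nd i iN; have [_ _ mh _ _] := P n.
    exact: lt_trans (mh i iN) nd.
  - apply: filterS (inv0 _ d0) => n nd i iN; have [_ _ _ mh _] := P n.
    exact: lt_trans (mh i iN) nd.
move/cvgrPdist_lt: cv => /(_ _ e0)[n0 _ h].
have [_ _ _ _ lt] := P n0.
have := h n0 (leqnn _); rewrite sub0r normrN => /(le_lt_trans (ler_norm _)).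
by move=> /(lt_trans lt); rewrite ltxx.
Qed.

End mesh.

(** As [b] never switches off again, [S] is the increment of [m] since the switching time. The
    identity is the usual one for twice the left-point sum from that time on, with the initial value
    eliminated as [m n - S]: thus [m n ^+ 2 - (m n - S) ^+ 2 = 2 * m n * S - S ^+ 2]. *)
Lemma late_sum (R : realType) (b : nat -> bool) (m : nat -> R) n :
  (forall i j, (i <= j)%N -> b i -> b j) ->
  let S := \sum_(i < n) (b i)%:R * (m i.+1 - m i) in
  2 * \sum_(i < n) (b i)%:R * (m i * (m i.+1 - m i)) =
  2 * m n * S - S ^+ 2 - \sum_(i < n) (b i)%:R * (m i.+1 - m i) ^+ 2.
Proof.
move=> bS /=; elim: n => [|n ih]; first by rewrite !big_ord0; ring.
rewrite !big_ord_recr/= mulrDr ih; have [bn|bn] := boolP (b n) => /=; first by ring.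
have -> : \sum_(i < n) (b i)%:R * (m i.+1 - m i) = 0.
  apply: big1 => i _; rewrite (_ : b i = false) ?mul0r//.
  by apply/negbTE; apply: contra bn; apply: bS; exact: ltnW.
by ring.
Qed.

Lemma cvg_seq_le (R : realType) (x : nat -> R) (l K : R) : x n @[n --> \oo] --> l ->
  (forall n, x n <= K) -> l <= K.
Proof.
move=> xl xK; rewrite -(cvg_lim _ xl)//.
by apply: limr_le; [apply/cvg_ex; exists l|exact: nearW].
Qed.

Section left_point_sums.
Context (R : realType) d (Omega : measurableType d) (Pr : probability Omega R)
  (F : R -> set (set Omega)) (HF : is_filtration F) (M a c : R -> Omega -> R).
Local Notation mu := (@lebesgue_measure R).
Local Notation Ex := (Ex Pr).
Local Notation L1 := (L1 Pr).
Local Notation L2 := (L2 Pr).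
Hypotheses (cM : forall w, cadlag (M ^~ w))
  (aM : forall t, 0 <= t -> measurable_wrt (F t) (M t))
  (lM : forall t, 0 <= t -> L2 (M t))
  (mM : forall s t A, 0 <= s -> s <= t -> F s A ->
    Ex (fun w => \1_A w * (M t w - M s w)) = 0)
  (ca : forall w, cadlag (a ^~ w)) (cc : forall w, cadlag (c ^~ w))
  (la : forall s t, 0 <= s -> s <= t -> L1 (fun w => \int[mu]_(v in `[s, t]) a v w))
  (lc : forall s t, 0 <= s -> s <= t -> L1 (fun w => \int[mu]_(v in `[s, t]) c v w))
  (ac : forall v w, `|a v w| <= c v w)
  (bM : forall s t A, 0 <= s -> s <= t -> F s A ->
    Ex (fun w => \1_A w * (M t w - M s w) ^+ 2) =
    Ex (fun w => \1_A w * \int[mu]_(v in `[s, t]) a v w)).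

Let sF t (t0 : 0 <= t) : sigma_algebra setT (F t) := filtration_sigma HF t0.
Let Fm t (t0 : 0 <= t) : F t `<=` measurable :=
  fun A FA => filtration_measurable HF t0 FA.

Definition bounded_until (K r : R) : set Omega :=
  [set w | forall s, 0 <= s <= r -> `|M s w| <= K].

Lemma bounded_untilS K r r' : r <= r' -> bounded_until K r' `<=` bounded_until K r.
Proof. by move=> rr' w Kw s /andP[s0 sr]; apply: Kw; rewrite s0 (le_trans sr). Qed.

(** By right-continuity the bound on [[0, r]] is tested at countably many grid points clamped to
    [[0, r]], so the event lies in [F r] itself and no completion is involved. *)
Lemma bounded_until_F K r : 0 <= r -> F r (bounded_until K r).
Proof.
move=> r0.
pose B n k : set Omega := [set w | `|M (clamp 0 r (k%:R / n.+1%:R)) w| <= K].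
have BF n k : F r (B n k).
  have /andP[x0 xr] := @clamp_itv R 0 r (k%:R / n.+1%:R) r0.
  have mMx := measurable_wrt_filtration HF x0 xr (aM x0).
  have -> : B n k = M (clamp 0 r (k%:R / n.+1%:R)) @^-1` `[- K, K].
    by apply/seteqP; split => w /=; rewrite /B/= in_itv/= ler_norml.
  by apply: mMx; exact: measurable_itv.
have -> : bounded_until K r = \bigcap_n \bigcap_k B n k.
  apply/seteqP; split=> [w Kw n _ k _ /=|w Kw s /andP[s0 sr]].
    by apply: Kw; exact: clamp_itv.
  have h : `|M (clamp 0 r (next_grid n s)) w| @[n --> \oo] --> `|M s w|.
    apply: cvg_norm; have := right_continuous_clamp (lexx 0) r0 (cM w) (t := s).
    rewrite [in X in X -> _](@clamp_id _ 0 r s) ?s0// => /cvg_at_rightP; apply; split.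
      by move=> n; exact: next_grid_gt.
    exact: cvg_next_grid.
  apply: (cvg_seq_le h) => n.
  have kE : next_grid n s = (absz (Num.floor (s * n.+1%:R) + 1))%:R / n.+1%:R.
    by rewrite /next_grid natr_absz ger0_norm// addr_ge0// floor_ge0 mulr_ge0.
  by rewrite kE; exact: Kw.
have GE : <<s F r >> = F r by exact: sigma_algebra_id (sF r0).
have := @bigcapT_measurable _ (g_sigma_algebraType (F r)) (fun n => \bigcap_k B n k).
rewrite /measurable/= GE; apply => n.
have := @bigcapT_measurable _ (g_sigma_algebraType (F r)) (B n).
by rewrite /measurable/= GE; apply.
Qed.

Lemma bounded_until_eventually t w : exists K0, forall K, K0 <= K -> bounded_until K t w.
Proof.
have [K0 _ MK] := cadlag_bounded t (cM w); exists K0 => K K0K s st.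
exact: le_trans (MK s st) K0K.
Qed.

(** Set to 0, not frozen, once the bound has failed. Only the integrand of the left-point sums is
    truncated; the integrator remains [M], to which the isometry applies directly. *)
Definition truncated (K r : R) (w : Omega) := M r w * \1_(bounded_until K r) w.

Lemma truncated_wrt K r : 0 <= r -> measurable_wrt (F r) (truncated K r).
Proof.
move=> r0; apply: (measurable_wrtM (sF r0)); first exact: aM.
by apply: measurable_wrt_indic; [exact: sF|exact: bounded_until_F].
Qed.

Lemma truncated_le K r w : 0 <= K -> 0 <= r -> `|truncated K r w| <= K.
Proof.
move=> K0 r0; rewrite /truncated indicE.
have [|_] := boolP (w \in _); last by rewrite mulr0 normr0.
by rewrite inE mulr1 => Kw; apply: Kw; rewrite r0 lexx.
Qed.

(** Either the bound holds at all times before [s], and the process is [M] there, or it has failed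
    by some [r0 < s], and the process is 0 from [r0] on. *)
Lemma truncated_left_limit K (s : R) w : 0 < s ->
  exists l : R, truncated K r w @[r --> s^'-] --> l.
Proof.
move=> s0; have [Ks|] := pselect (forall r, 0 <= r < s -> bounded_until K r w).
  have /cvg_ex[/= l Ml] := (cM w).2 s s0; exists l.
  apply: cvg_trans Ml; apply: near_eq_cvg; near=> r.
  rewrite /truncated indicE mem_set ?mulr1//; apply: Ks.
  by apply/andP; split; near: r; [exact: nbhs_left_ge|exact: nbhs_left_lt].
move=> /existsNP[r0 /not_implyP[/andP[r00 r0s] nK]].
exists 0; apply: cvg_near_cst; near=> r.
rewrite /truncated indicE memNset ?mulr0// => /(bounded_untilS _)-/(_ r0) h.
apply: nK; apply: h; near: r; exact: nbhs_left_ge.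
Unshelve. all: by end_near. Qed.

Definition left_sum (u : nat -> R) N (Z : R -> Omega -> R) (w : Omega) : R :=
  \sum_(i < N) Z (u i) w * (M (u i.+1) w - M (u i) w).

Let tail K t w : R := \1_(~` bounded_until K t) w * \int[mu]_(s in `[0, t]) c s w.

Let mB K t : 0 <= t -> measurable (bounded_until K t).
Proof. by move=> t0; apply: (@Fm t t0); exact: bounded_until_F. Qed.

Let c_ge0 v w : 0 <= c v w. Proof. exact: le_trans (ac v w). Qed.

Let indic01 (A : set Omega) w : 0 <= (\1_A w : R) <= 1.
Proof. by rewrite indicE; case: (_ \in _); rewrite ?lexx ?ler01. Qed.

Let tail_L1 K t : 0 <= t -> L1 (tail K t).
Proof. by move=> t0; apply: L1_indic_mul; [exact/measurableC/mB|exact: lc]. Qed.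

Lemma tail_cvg t : 0 <= t -> Ex (tail n%:R t) @[n --> \oo] --> 0.
Proof.
move=> t0; rewrite -(@Ex_cst _ _ _ Pr 0).
have [|||_ +] := @Ex_dominated _ _ _ Pr (fun n => tail n%:R t) (fun=> 0) _ _
  (L1_norm (lc (lexx 0) t0)) => //.
- by move=> n; exact: L1_measurable (tail_L1 _ t0).
- move=> n w; rewrite /tail normrM ler_piMl//.
  by have /andP[i0 i1] := indic01 (~` bounded_until n%:R t) w; rewrite ger0_norm.
- move=> w; have [K0 KP] := bounded_until_eventually t w.
  apply: cvg_near_cst; near=> n; rewrite /tail indicE memNset ?mul0r//.
  by apply; apply: KP; near: n; exact: nbhs_infty_ger.
Unshelve. all: by end_near. Qed.

Lemma left_sum_L1 t u N Z : weak_partition t u N -> (forall i, L2 (Z (u i))) ->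
  L1 (left_sum u N Z).
Proof.
move=> wp lZ; apply: L1_sum => i; apply: L2_mul => //.
by apply: L2B; apply: lM; exact: weak_partition_ge0 wp.
Qed.

Let late (K : R) (u : nat -> R) (i : nat) (w : Omega) : R := \1_(~` bounded_until K (u i)) w.

Let late_interval t u N K i : weak_partition t u N ->
  bounded_interval F (late K u i) (u i) (u i.+1) 1.
Proof.
move=> wp; have ui0 := weak_partition_ge0 i wp; have [_ uS _] := wp.
split=> // [|w].
  apply: measurable_wrt_indic; first exact: sF.
  have [F0 FC _] := sF ui0; rewrite -setTD; apply: FC; exact: bounded_until_F.
by have /andP[i0 i1] := indic01 (~` bounded_until K (u i)) w; rewrite ger0_norm.
Qed.

Let late_le K u N t i w : weak_partition t u N -> (i <= N)%N ->
  late K u i w <= \1_(~` bounded_until K t) w.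
Proof.
move=> wp iN; rewrite /late !indicE !in_setC.
have [|nu] := boolP (w \in bounded_until K (u i)) => /=; first by rewrite ler0n.
rewrite (_ : (w \in bounded_until K t) = false)//; apply/negbTE; apply: contra nu.
by rewrite !inE; apply: bounded_untilS; exact: weak_partition_let wp iN.
Qed.

(** This and [late_var] control the two quadratic terms of [late_sum]. Each late indicator is at
    most that of exceeding [K] by time [t], and [|a| <= c], so both expectations are at most that of
    [tail], whatever the partition. *)
Let late_sqr K t u N : weak_partition t u N ->
  Ex (fun w => (\sum_(i < N) late K u i w * (M (u i.+1) w - M (u i) w)) ^+ 2) <=
  Ex (tail K t).
Proof.
move=> wp; have t0 : 0 <= t by have [_ _ <-] := wp; exact: weak_partition_ge0 wp.
have bi (i : 'I_N) := late_interval K i wp.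
have vt (i : 'I_N) : u i.+1 <= t by exact: weak_partition_let wp _.
rewrite (isometry HF aM lM mM ca la bM bi vt).
apply: le_Ex; [exact: (step_integral_L1 HF bi vt ca la)|exact: tail_L1|].
move=> w; rewrite /tail -cadlag_RintegralZ//.
have u0 (i : 'I_N) : 0 <= u i by exact: weak_partition_ge0 wp.
apply: le_Rintegral => //.
- exact: (step_sqr_integral _ u0 vt (ca w)).1.
- by apply: cadlag_integrable_itv => //; exact: cadlagZ.
move=> s /=; rewrite in_itv/= => /andP[]; rewrite le_eqVlt => /predU1P[<-|s0] st.
  have := partition_step0 (late K u ^~ w) wp; rewrite /partition_step => ->.
  by rewrite expr0n mul0r mulr_ge0//; case/andP: (indic01 (~` bounded_until K t) w).
have [|j [_]] := partition_stepE (late K u ^~ w) wp (s := s); first by rewrite s0.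
rewrite /partition_step => ->.
have l1 := @late_le K u N t j w wp (ltnW (ltn_ord j)).
have /andP[l0 l1'] : 0 <= late K u j w <= 1 by exact: indic01.
apply: (@le_trans _ _ (late K u j w ^+ 2 * c s w)).
  by rewrite ler_wpM2l ?sqr_ge0// (le_trans (ler_norm _)).
rewrite ler_wpM2r//; apply: le_trans l1; rewrite expr2 -[leRHS]mulr1.
by rewrite ler_wpM2l.
Qed.

Let late_var K t u N : weak_partition t u N ->
  Ex (fun w => \sum_(i < N) late K u i w * (M (u i.+1) w - M (u i) w) ^+ 2) <=
  Ex (tail K t).
Proof.
move=> wp; have t0 : 0 <= t by have [_ _ <-] := wp; exact: weak_partition_ge0 wp.
have u0 i : 0 <= u i by exact: weak_partition_ge0 wp.
have [_ uS _] := wp.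
have bi i := late_interval K i wp.
have ml i : measurable_fun setT (late K u i).
  exact: (measurable_wrt_measurable (@Fm _ (u0 i)) (bi_meas (bi i))).
have lc' i : L1 (fun w => \1_(~` bounded_until K t) w *
    \int[mu]_(v in `[u i, u i.+1]) c v w).
  by apply: L1_indic_mul; [exact/measurableC/mB|exact: lc].
rewrite Ex_sum => [|i]; last first.
  apply: (L1_bounded_mul (ml i) (bi_bound (bi i))).
  by have [] := increment_L2 lM (u0 i) (u0 i.+1).
apply: (@le_trans _ _ (\sum_(i < N) Ex (fun w => \1_(~` bounded_until K t) w *
    \int[mu]_(v in `[u i, u i.+1]) c v w))).
  apply: ler_sum => i _.
  rewrite (increment_bracket HF lM la bM (u0 i) (uS i) (bi_meas (bi i)) (bi_bound (bi i))).
  apply: le_Ex; [|exact: lc'|].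
    by apply: (L1_bounded_mul (ml i) (bi_bound (bi i))); exact: la.
  move=> w; have l1 := @late_le K u N t i w wp (ltnW (ltn_ord i)).
  have /andP[l0 _] : 0 <= late K u i w <= 1 by exact: indic01.
  apply: (@le_trans _ _ (late K u i w * \int[mu]_(v in `[u i, u i.+1]) c v w)).
    rewrite ler_wpM2l//; apply: cadlag_le_Rintegral => // x _.
    exact: le_trans (ler_norm _) (ac x w).
  by rewrite ler_wpM2r//; apply: Rintegral_ge0.
rewrite -Ex_sum => [|i]; last exact: lc'.
apply: le_Ex; [by apply: L1_sum => i; exact: lc'|exact: tail_L1|].
by move=> w; rewrite /tail -(partition_integral wp (cc w)) mulr_sumr.
Qed.

(** The difference of the sums runs over the late indices, so by [late_sum] its double is
    [2 M_t S - S^2 - B]. The expectations of [S^2] and [B] are bounded by that of [tail]; the cross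
    term is split by Young's inequality with a free weight [th], since the second moment of [M_t] is
    not small. *)
Lemma truncation_error K t u N th : weak_partition t u N -> 0 < th ->
  Ex (fun w => `|left_sum u N M w - left_sum u N (truncated K) w|) <=
  th * Ex (fun w => M t w ^+ 2) + (th^-1 + 1) * Ex (tail K t).
Proof.
move=> wp th0; have t0 : 0 <= t by have [_ _ <-] := wp; exact: weak_partition_ge0 wp.
have u0 i : 0 <= u i by exact: weak_partition_ge0 wp.
have uN : u N = t by case: wp.
have bi i := late_interval K i wp.
have ml i : measurable_fun setT (late K u i).
  exact: (measurable_wrt_measurable (@Fm _ (u0 i)) (bi_meas (bi i))).
pose S w := \sum_(i < N) late K u i w * (M (u i.+1) w - M (u i) w).
pose B w := \sum_(i < N) late K u i w * (M (u i.+1) w - M (u i) w) ^+ 2.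
have lS : L1 (fun w => S w ^+ 2).
  exact: (increments_sqr_L1 HF lM (fun i : 'I_N => bi i)).
have lB : L1 B.
  apply: L1_sum => i; apply: (L1_bounded_mul (ml i) (bi_bound (bi i))).
  by have [] := increment_L2 lM (u0 i) (u0 i.+1).
have lMt : L1 (fun w => M t w ^+ 2) by have [] := lM t0.
have ltr i : L2 (truncated K (u i)).
  have mB' := mB K (u0 i); have [mM' _] := lM (u0 i).
  apply: L2_le (lM (u0 i)) _ => [|w].
    by apply: measurable_funM => //; exact: measurable_indic.
  rewrite /truncated normrM ler_piMr//.
  by have /andP[i0 i1] := indic01 (bounded_until K (u i)) w; rewrite ger0_norm.
have DE w : 2 * (left_sum u N M w - left_sum u N (truncated K) w) =
    2 * M t w * S w - S w ^+ 2 - B w.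
  pose b i := w \in ~` bounded_until K (u i).
  have bS i j : (i <= j)%N -> b i -> b j.
    move=> ij; rewrite /b !in_setC; apply: contra; rewrite !inE; apply: bounded_untilS.
    exact: weak_partition_le wp ij.
  have -> : S w = \sum_(i < N) (b i)%:R * (M (u i.+1) w - M (u i) w).
    by apply: eq_bigr => i _; rewrite /late indicE.
  have -> : B w = \sum_(i < N) (b i)%:R * (M (u i.+1) w - M (u i) w) ^+ 2.
    by apply: eq_bigr => i _; rewrite /late indicE.
  rewrite -uN -(late_sum (fun i => M (u i) w) N bS) -sumrB; congr (_ * _).
  apply: eq_bigr => i _; rewrite /truncated indicE /b in_setC.
  by case: (_ \in _) => /=; ring.
have bnd w : `|left_sum u N M w - left_sum u N (truncated K) w| <=
    th * M t w ^+ 2 + (th^-1 + 1) / 2 * S w ^+ 2 + B w / 2.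
  have B0 : 0 <= B w.
    apply: sumr_ge0 => i _; apply: mulr_ge0; last exact: sqr_ge0.
    by case/andP: (indic01 (~` bounded_until K (u i)) w).
  have := DE w; set D := _ - _; move: (M t w) (S w) B0 => m n B0 e.
  have h1 : `|2 * m * n| <= th * m ^+ 2 + th^-1 * n ^+ 2.
    have p1 := sqr_ge0 (th * m + n); have p2 := sqr_ge0 (th * m - n).
    have -> : th * m ^+ 2 + th^-1 * n ^+ 2 = th^-1 * ((th * m) ^+ 2 + n ^+ 2).
      by field; exact: lt0r_neq0.
    rewrite ler_pdivlMl// -[X in X * _](gtr0_norm th0) -normrM.
    by rewrite ler_norml; apply/andP; split; nra.
  have h2 : `|2 * D| <= `|2 * m * n| + n ^+ 2 + B w.
    rewrite e (le_trans (ler_normB _ _))// (ger0_norm B0) lerD2r.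
    by rewrite (le_trans (ler_normB _ _))// (ger0_norm (sqr_ge0 n)).
  move: h2; rewrite normrM (ger0_norm (ler0n _ 2)) => h2.
  have thm : 0 <= th * m ^+ 2 by rewrite mulr_ge0 ?sqr_ge0// ltW.
  have -> : (th^-1 + 1) / 2 * n ^+ 2 =
      (th^-1 * n ^+ 2 + n ^+ 2) / 2 by field; exact: lt0r_neq0.
  move: (th^-1 * n ^+ 2) h1 => q h1; lra.
have lD : L1 (fun w => left_sum u N M w - left_sum u N (truncated K) w).
  apply: L1B; apply: (left_sum_L1 wp) => // i; exact: lM.
apply: (@le_trans _ _ (Ex (fun w =>
   th * M t w ^+ 2 + (th^-1 + 1) / 2 * S w ^+ 2 + 2^-1 * B w))).
  apply: le_Ex => [||w]; first exact: L1_norm.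
    by apply: L1D; [apply: L1D; exact: L1Z|exact: L1Z].
  by apply: le_trans (bnd w) _; rewrite lerD2l [leLHS]mulrC.
rewrite ExD; [|by apply: L1D; exact: L1Z|exact: L1Z].
rewrite ExD; [|exact: L1Z|exact: L1Z].
rewrite !ExZ// -addrA lerD2l.
have h1 := late_sqr K wp; have h2 := late_var K wp.
have th1 : 0 < th^-1 by rewrite invr_gt0.
have z0 : 0 <= Ex (tail K t).
  apply: Ex_ge0 => w; apply: mulr_ge0; last exact: Rintegral_ge0.
  by case/andP: (indic01 (~` bounded_until K t) w).
move: h1 h2; rewrite -[X in X <= _ -> _]/(Ex (fun w => S w ^+ 2)) -[X in _ -> X <= _ -> _]/(Ex B).
move: (Ex (fun w => S w ^+ 2)) (Ex B) (Ex (tail K t)) z0 (th^-1) th1 => x y z z0 q q0 h1 h2.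
have h3 := ler_wpM2l (ltW q0) h1; have h4 := mulr_ge0 (ltW q0) z0.
lra.
Qed.

Section truncated_sums.
Variables (K t : R) (u u' : nat -> nat -> R) (N N' : nat -> nat).
Hypotheses (K0 : 0 <= K) (wp : forall n, weak_partition t (u n) (N n))
  (wp' : forall n, weak_partition t (u' n) (N' n))
  (mu0 : forall e : R, 0 < e -> \forall n \near \oo, mesh_below (u n) (N n) e)
  (mu0' : forall e : R, 0 < e -> \forall n \near \oo, mesh_below (u' n) (N' n) e).

(** The difference of two left-point sums is one elementary integral over the disjoint union of the
    index sets, the sign being put into the weights of the second. *)
Let Z n (x : 'I_(N n) + 'I_(N' n)) : Omega -> R :=
  match x with
  | inl i => truncated K (u n i)
  | inr i => fun w => - truncated K (u' n i) w
  end.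
Let U n (x : 'I_(N n) + 'I_(N' n)) : R := match x with inl i => u n i | inr i => u' n i end.
Let V n (x : 'I_(N n) + 'I_(N' n)) : R :=
  match x with inl i => u n i.+1 | inr i => u' n i.+1 end.

Let bi n (x : 'I_(N n) + 'I_(N' n)) : bounded_interval F (Z x) (U x) (V x) K.
Proof.
case: x => i /=.
  have u0 := weak_partition_ge0 i (wp n); have [_ uS _] := wp n.
  by split=> // [|w]; [exact: truncated_wrt|exact: truncated_le].
have u0 := weak_partition_ge0 i (wp' n); have [_ uS _] := wp' n.
split=> // [|w]; last by rewrite normrN; exact: truncated_le.
have := measurable_wrtM (sF u0) (measurable_wrt_cst (sF u0) (-1)) (truncated_wrt K u0).
by under [X in measurable_wrt _ X -> _]eq_fun do rewrite mulN1r.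
Qed.

Let Vt n (x : 'I_(N n) + 'I_(N' n)) : V x <= t.
Proof. by case: x => i /=; [exact: weak_partition_let (wp n) _|exact: weak_partition_let (wp' n) _]. Qed.

Let U0 n (x : 'I_(N n) + 'I_(N' n)) : 0 <= U x.
Proof. exact: bi_ge0 (bi x). Qed.

Let H n w s := step (fun x => @Z n x w) (@U n) (@V n) s.

Let HE n w s : H n w s = partition_step (u n) (N n) (fun i => truncated K (u n i) w) s -
  partition_step (u' n) (N' n) (fun i => truncated K (u' n i) w) s.
Proof.
rewrite /H /step big_sumType/=; congr (_ + _).
by rewrite -sumrN; apply: eq_bigr => i _; rewrite mulNr.
Qed.

Let H_le n w s : 0 <= s <= t -> `|H n w s| <= 2 * K.
Proof.
move=> /andP[]; rewrite le_eqVlt => /predU1P[<- _|s0 st].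
  by rewrite HE !(partition_step0 _ (wp n)) !(partition_step0 _ (wp' n)) subrr normr0 mulr_ge0.
have s0t : 0 < s <= t by rewrite s0.
have [j [_ ej]] := partition_stepE (fun i => truncated K (u n i) w) (wp n) s0t.
have [j' [_ ej']] := partition_stepE (fun i => truncated K (u' n i) w) (wp' n) s0t.
rewrite HE ej ej' (le_trans (ler_normB _ _))// mulr_natl mulr2n lerD// truncated_le//.
- exact: weak_partition_ge0 (wp n).
- exact: weak_partition_ge0 (wp' n).
Qed.

(** At [s > 0] both step functions take the value of the truncated process at a point to the left of
    [s] within the mesh, so both tend to its left limit at [s]. *)
Let H_cvg w s : 0 <= s <= t -> H n w s @[n --> \oo] --> 0.
Proof.
move=> /andP[]; rewrite le_eqVlt => /predU1P[<- _|s0 st].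
  apply: cvg_near_cst; near=> n.
  by rewrite HE !(partition_step0 _ (wp n)) !(partition_step0 _ (wp' n)) subrr.
have s0t : 0 < s <= t by rewrite s0.
have [l hl] := truncated_left_limit K w s0.
apply/cvgrPdist_le => e e0; have e20 : 0 < e / 2 by rewrite divr_gt0.
have /cvgrPdist_le/(_ _ e20)/nbhs_left0P[dd /= d0 dP] := hl.
have close (v : nat -> R) j n : v j < s <= v j.+1 -> (j < n)%N -> mesh_below v n dd ->
    `|l - truncated K (v j) w| <= e / 2.
  move=> /andP[vs sv] jn mv; have sv0 : 0 < s - v j by rewrite subr_gt0.
  have := dP (s - v j); rewrite /= sub0r normrN gtr0_norm// subKr; apply => //.
  by rewrite (le_lt_trans _ (mv j jn))// lerD2r.
near=> n.
have [j [sj ej]] := partition_stepE (fun i => truncated K (u n i) w) (wp n) s0t.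
have [j' [sj' ej']] := partition_stepE (fun i => truncated K (u' n i) w) (wp' n) s0t.
rewrite sub0r normrN HE ej ej'.
have c1 : `|l - truncated K (u n j) w| <= e / 2.
  by apply: (close _ _ (N n)) => //; near: n; exact: mu0.
have c2 : `|l - truncated K (u' n j') w| <= e / 2.
  by apply: (close _ _ (N' n)) => //; near: n; exact: mu0'.
rewrite -[X in X - _](subrK l) -addrA (le_trans (ler_normD _ _))//.
by rewrite [e]splitr lerD// distrC.
Unshelve. all: by end_near. Qed.

Let ct0 : 0 <= t.
Proof. by have [_ _ <-] := wp 0; exact: weak_partition_ge0 (wp 0). Qed.

Let bound n w s : 0 <= s <= t -> `|H n w s ^+ 2 * c s w| <= (2 * K) ^+ 2 * c s w.
Proof.
move=> st; rewrite normrM (ger0_norm (c_ge0 s w)) ler_wpM2r// normrX.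
by rewrite lerXn2r ?nnegrE ?mulr_ge0// H_le.
Qed.

Let H_integrable n w : mu.-integrable `[0, t] (EFin \o (fun s => H n w s ^+ 2 * c s w)).
Proof. by have [] := step_sqr_integral (fun x => @Z n x w) (@U0 n) (@Vt n) (cc w). Qed.

Let H_path_cvg w : \int[mu]_(s in `[0, t]) (H n w s ^+ 2 * c s w) @[n --> \oo] --> 0.
Proof.
have z : \int[mu]_(s in `[0, t]) (cst (0 : R) s) = 0 by rewrite Rintegral_cst// mul0r.
rewrite -[X in _ --> X]z.
apply: (@Rintegral_dominated _ _ (measurableTypeR R) mu `[0, t]%classic
  (fun n s => H n w s ^+ 2 * c s w) (cst 0) (fun s => (2 * K) ^+ 2 * c s w)).
- exact: measurable_itv.
- by move=> n; apply/measurable_EFinP; exact: measurable_int (H_integrable n w).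
- by apply: cadlag_integrable_itv => //; exact: cadlagZ.
- by move=> n s /=; rewrite in_itv/=; exact: bound.
- move=> s /=; rewrite in_itv/= => st; rewrite -[X in _ --> X](mul0r (c s w)).
  apply: cvgMl; rewrite -[X in _ --> X](mulr0 0).
  by under eq_fun do rewrite expr2; apply: cvgM; exact: H_cvg.
Qed.

Lemma truncated_sqr_L1 n : L1 (fun w => (left_sum (u n) (N n) (truncated K) w -
  left_sum (u' n) (N' n) (truncated K) w) ^+ 2).
Proof.
have := increments_sqr_L1 HF lM (@bi n).
congr L1; apply/funext => w; congr (_ ^+ 2); rewrite big_sumType/=; congr (_ + _).
by rewrite -sumrN; apply: eq_bigr => i _; rewrite mulNr.
Qed.

(** The isometry bounds the second moment by the expectation of the time integral of [H^2 c].
    Dominated convergence with [(2 K)^2 c] applies to the time integral along each path and to the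
    expectation. *)
Lemma truncated_cvg :
  Ex (fun w => (left_sum (u n) (N n) (truncated K) w -
    left_sum (u' n) (N' n) (truncated K) w) ^+ 2) @[n --> \oo] --> 0.
Proof.
pose B n w := \int[mu]_(s in `[0, t]) (H n w s ^+ 2 * c s w).
have lB n : L1 (B n) by exact: (step_integral_L1 HF (@bi n) (@Vt n) cc lc).
have B0 : Ex (B n) @[n --> \oo] --> 0.
  rewrite -(@Ex_cst _ _ _ Pr 0).
  have [|||//] := @Ex_dominated _ _ _ Pr B (fun=> 0) _ _ (L1Z ((2 * K) ^+ 2) (lc (lexx 0) ct0)).
  - by move=> n; exact: L1_measurable.
  - move=> n w; rewrite -cadlag_RintegralZ//.
    apply: le_trans; first by apply: le_normr_Rintegral => //; exact: H_integrable.
    apply: le_Rintegral => //.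
    + exact: integrable_norm (H_integrable n w).
    + by apply: cadlag_integrable_itv => //; exact: cadlagZ.
    + by move=> s /=; rewrite in_itv/=; exact: bound.
  - by move=> w; exact: H_path_cvg.
refine (@squeeze_cvgr nat \oo _ R (cst 0) (fun n => Ex (B n)) _ _ 0 (cvg_cst _) B0).
near=> n; rewrite Ex_ge0/=; last by move=> w; exact: sqr_ge0.
rewrite (@eq_Ex _ _ _ _ _ (fun w => (\sum_x @Z n x w * (M (V x) w - M (U x) w)) ^+ 2)); last first.
  move=> w; congr (_ ^+ 2); rewrite big_sumType/=; congr (_ + _).
  by rewrite -sumrN; apply: eq_bigr => i _; rewrite mulNr.
rewrite (isometry HF aM lM mM ca la bM (@bi n) (@Vt n)).
apply: le_Ex => [||w].
- exact: (step_integral_L1 HF (@bi n) (@Vt n) ca la).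
- exact: lB.
- apply: le_Rintegral => //.
  + exact: (step_sqr_integral _ (@U0 n) (@Vt n) (ca w)).1.
  + by move=> s _; rewrite ler_wpM2l ?sqr_ge0// (le_trans (ler_norm _)).
Unshelve. all: by end_near. Qed.

End truncated_sums.

Lemma left_sum_cvg t (u u' : nat -> nat -> R) (N N' : nat -> nat) :
  (forall n, weak_partition t (u n) (N n)) -> (forall n, weak_partition t (u' n) (N' n)) ->
  (forall e : R, 0 < e -> \forall n \near \oo, mesh_below (u n) (N n) e) ->
  (forall e : R, 0 < e -> \forall n \near \oo, mesh_below (u' n) (N' n) e) ->
  Ex (fun w => `|left_sum (u n) (N n) M w - left_sum (u' n) (N' n) M w|) @[n --> \oo] --> 0.
Proof.
move=> wp wp' mu0 mu0'.
have t0 : 0 <= t by have [_ _ <-] := wp 0%N; exact: weak_partition_ge0 (wp 0%N).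
apply/cvgrPdist_le => e e0.
pose m := Ex (fun w => M t w ^+ 2).
have m0 : 0 <= m by apply: Ex_ge0 => w; exact: sqr_ge0.
(* [th] makes the part of the truncation error with the second moment of [M_t] at most [e / 8];
   adding 1 to [m] keeps the divisor positive. [K] is chosen after [th] so that the tail part is at
   most [e / 8] too. Two truncation errors then cost [e / 2] in all. *)
pose th := e / (8 * (m + 1)).
have th0 : 0 < th by rewrite divr_gt0// mulr_gt0// ltr_wpDl.
have thm : th * m <= e / 8.
  rewrite /th invfM mulrA -[leRHS]mulr1 -!mulrA ler_wpM2l//; first exact: ltW.
  by rewrite ler_wpM2l// mulrC ler_pdivrMr ?ltr_wpDl// mul1r lerDl.
have q0 : 0 < th^-1 + 1 by rewrite ltr_wpDl// invr_ge0 ltW.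
have [n0 tail0] : exists n0, Ex (tail n0%:R t) <= e / 8 / (th^-1 + 1).
  have e1 : 0 < e / 8 / (th^-1 + 1) by rewrite !divr_gt0.
  have /cvgrPdist_le/(_ _ e1)[n0 _ h] := tail_cvg t0; exists n0.
  by have := h n0 (leqnn _); rewrite /= sub0r normrN => /(le_trans (ler_norm _)).
pose K : R := n0%:R.
have err v n : weak_partition t v n ->
    Ex (fun w => `|left_sum v n M w - left_sum v n (truncated K) w|) <= e / 4.
  move=> wpv; apply: (le_trans (truncation_error K wpv th0)); rewrite -/m.
  have : (th^-1 + 1) * Ex (tail K t) <= e / 8.
    by rewrite mulrC -ler_pdivlMr.
  lra.
have e2 : 0 < e ^+ 2 / 4 by rewrite divr_gt0// exprn_gt0.
have /cvgrPdist_le/(_ _ e2) := truncated_cvg (ler0n R n0) wp wp' mu0 mu0'.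
apply: filterS => n; rewrite !sub0r !normrN => h.
rewrite ger0_norm; last exact: Ex_ge0.
have lL v k : weak_partition t v k -> L1 (left_sum v k M).
  by move=> wpv; apply: (left_sum_L1 wpv) => i; apply: lM; exact: weak_partition_ge0 wpv.
have lT v k : weak_partition t v k -> L1 (left_sum v k (truncated K)).
  move=> wpv; apply: (left_sum_L1 wpv) => i.
  have vi0 := weak_partition_ge0 i wpv.
  have mB' := mB K vi0; have [mM' _] := lM vi0.
  apply: L2_le (lM vi0) _ => [|w].
    by apply: measurable_funM => //; exact: measurable_indic.
  rewrite /truncated normrM ler_piMr//.
  by have /andP[i0 i1] := indic01 (bounded_until K (v i)) w; rewrite ger0_norm.
have lsq : L1 (fun w => (left_sum (u n) (N n) (truncated K) w -
    left_sum (u' n) (N' n) (truncated K) w) ^+ 2).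
  exact: truncated_sqr_L1.
pose A w := `|left_sum (u n) (N n) M w - left_sum (u n) (N n) (truncated K) w|.
pose A' w := `|left_sum (u' n) (N' n) M w - left_sum (u' n) (N' n) (truncated K) w|.
pose D w := (left_sum (u n) (N n) (truncated K) w -
  left_sum (u' n) (N' n) (truncated K) w) ^+ 2.
have lA : L1 A by apply: L1_norm; apply: L1B; [exact: lL|exact: lT].
have lA' : L1 A' by apply: L1_norm; apply: L1B; [exact: lL|exact: lT].
apply: (@le_trans _ _ (Ex (fun w => A w + A' w + (e / 4 + e^-1 * D w)))).
  apply: le_Ex => [||w].
  - by apply: L1_norm; apply: L1B; exact: lL.
  - by apply: L1D; [exact: L1D|apply: L1D; [exact: L1_cst|exact: L1Z]].
  - rewrite /A /A' /D; move: (left_sum (u n) _ M w) (left_sum (u' n) _ M w).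
    move: (left_sum (u n) _ _ w) (left_sum (u' n) _ _ w) => x x' y y'.
    (* From the square of [e / 2 - |x - x'|]: it passes from second moments to [L^1] without square
       roots. The constant and the quadratic term each take [e / 4] of the budget. *)
    have h1 : `|x - x'| <= e / 4 + e^-1 * (x - x') ^+ 2.
      have p1 := sqr_ge0 (e / 2 - `|x - x'|).
      rewrite -(ler_pM2l e0) mulrDr [e * (e^-1 * _)]mulrA divff ?lt0r_neq0// mul1r.
      rewrite -(real_normK (num_real (x - x'))); move: (`|x - x'|) p1 => z p1; nra.
    have -> : y - y' = (y - x) + (x - x') - (y' - x') by ring.
    rewrite (le_trans (ler_normB _ _))// [leRHS]addrAC lerD2r.
    by rewrite (le_trans (ler_normD _ _))// lerD2l.
rewrite ExD; [|exact: L1D|by apply: L1D; [exact: L1_cst|exact: L1Z]].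
rewrite ExD// ExD; [|exact: L1_cst|exact: L1Z].
rewrite Ex_cst ExZ//.
have hA : Ex A <= e / 4 by exact: err.
have hA' : Ex A' <= e / 4 by exact: err.
have hD : e^-1 * Ex D <= e / 4.
  rewrite ler_pdivrMl// mulrA -expr2; apply: le_trans h; exact: ler_norm.
lra.
Qed.

Lemma left_sum_uniform t (e : R) : 0 < e -> exists2 dlt : R, 0 < dlt &
  forall u N u' N', weak_partition t u N -> weak_partition t u' N' ->
    mesh_below u N dlt -> mesh_below u' N' dlt ->
    Ex (fun w => `|left_sum u N M w - left_sum u' N' M w|) <= e.
Proof.
apply: (@uniform_of_sequences _ t (fun u N u' N' =>
  Ex (fun w => `|left_sum u N M w - left_sum u' N' M w|))) => u N u' N'.
exact: left_sum_cvg.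
Qed.

End left_point_sums.

(** * Quadratic variation *)

Section maximal_inequality.
Context (R : realType) d (Omega : measurableType d) (Pr : probability Omega R)
  (F : R -> set (set Omega)) (HF : is_filtration F) (Y : R -> Omega -> R).
Local Notation Ex := (Ex Pr).
Local Notation L1 := (L1 Pr).

(** Fairness is tested on increments over the sets of [F s], the form in which it passes to sums and
    [L^1] limits. Here every path is cadlag, not almost every one. *)
Record integrable_martingale (Y : R -> Omega -> R) : Prop := {
  im_cadlag : forall w, cadlag (Y ^~ w);
  im_adapted : forall t, 0 <= t -> measurable_wrt (F t) (Y t);
  im_L1 : forall t, 0 <= t -> L1 (Y t);
  im_fair : forall s t A, 0 <= s -> s <= t -> F s A ->
    Ex (fun w => \1_A w * (Y t w - Y s w)) = 0 }.

Hypothesis mY : integrable_martingale Y.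

Let sF t (t0 : 0 <= t) : sigma_algebra setT (F t) := filtration_sigma HF t0.
Let Fm t (t0 : 0 <= t) A : F t A -> measurable A :=
  fun FA => filtration_measurable HF t0 FA.

Let F_setC t A : 0 <= t -> F t A -> F t (~` A).
Proof. by move=> t0 FA; have [_ FC _] := sF t0; rewrite -setTD; exact: FC. Qed.

Let F_bigcup t (A : nat -> set Omega) : 0 <= t -> (forall n, F t (A n)) -> F t (\bigcup_n A n).
Proof. by move=> t0 FA; have [_ _ FU] := sF t0; exact: FU. Qed.

Let F_setU t (A B : set Omega) : 0 <= t -> F t A -> F t B -> F t (A `|` B).
Proof. by move=> t0 FA FB; rewrite -bigcup2E; apply: F_bigcup => // -[|[|n]]//=; have [] := sF t0. Qed.

Let F_setD t (A B : set Omega) : 0 <= t -> F t A -> F t B -> F t (A `\` B).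
Proof.
by move=> t0 FA FB; rewrite setDE -[X in F t X]setCK setCI setCK; apply: F_setC => //;
  apply: F_setU => //; exact: F_setC.
Qed.

Variables (T lam : R).
Hypothesis T0 : 0 <= T.

Let above t : set Omega := [set w | lam < Y t w].

Let above_F t : 0 <= t -> F t (above t).
Proof.
move=> t0; rewrite (_ : above t = Y t @^-1` `]lam, +oo[).
  by apply: (im_adapted mY t0); exact: measurable_itv.
by apply/seteqP; split => w /=; rewrite in_itv/= andbT.
Qed.

Let late_hit s B : 0 <= s -> s <= T -> F s B -> B `<=` above s ->
  lam * Ex \1_B <= Ex (fun w => \1_B w * `|Y T w|).
Proof.
move=> s0 sT FB Ba; have mB := Fm s0 FB.
have lB := L1_indic Pr mB.
have lBT : L1 (fun w => \1_B w * Y T w) by apply: L1_indic_mul => //; exact: im_L1.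
have lBs : L1 (fun w => \1_B w * Y s w) by apply: L1_indic_mul => //; exact: im_L1.
apply: (@le_trans _ _ (Ex (fun w => \1_B w * Y T w))).
  have -> : Ex (fun w => \1_B w * Y T w) = Ex (fun w => \1_B w * Y s w).
    have := im_fair mY s0 sT FB.
    rewrite (@eq_Ex _ _ _ _ _ (fun w => \1_B w * Y T w - \1_B w * Y s w)); last first.
      by move=> w; rewrite mulrBr.
    by rewrite ExB// => /eqP; rewrite subr_eq0 => /eqP.
  rewrite -ExZ//; apply: le_Ex => // [|w]; first exact: L1Z.
  rewrite indicE; have [|_] := boolP (w \in B); last by rewrite mulr0 mul0r.
  by rewrite inE mulr1 mul1r => /Ba /ltW.
apply: le_Ex => // [|w].
  by apply: L1_indic_mul => //; apply: L1_norm; exact: im_L1.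
by rewrite ler_wpM2l ?ler_norm// indicE.
Qed.

(** Induction on the number of times: the paths exceeding [lam] at [x n] but not before form a set
    of [F (x n)], disjoint from the earlier ones, to which [late_hit] applies. *)
Let discrete_hit (x : nat -> R) n : (forall i j, (i <= j)%N -> x i <= x j) ->
  (forall i, 0 <= x i <= T) ->
  let A := \bigcup_(i < n) above (x i) in
  measurable A /\ lam * Ex \1_A <= Ex (fun w => \1_A w * `|Y T w|).
Proof.
move=> xS xT; elim: n => [|n [mA ih]]/=.
  rewrite II0 bigcup0//; split => //.
  rewrite indic0 Ex_cst mulr0; apply: Ex_ge0 => w; exact: mulr_ge0.
have /andP[xn0 xnT] := xT n.
have FA : F (x n) (\bigcup_(i < n) above (x i)).
  rewrite bigcup_mkcond; apply: F_bigcup => // i.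
  case: ifPn => [|_]; last by have [] := sF xn0.
  rewrite inE/= => iN; have /andP[xi0 _] := xT i.
  by apply: (filtration_le HF xi0); [exact/xS/ltnW|exact: above_F].
set A := \bigcup_(i < n) _ in mA ih FA *.
have -> : \bigcup_(i < n.+1) above (x i) = A `|` (above (x n) `\` A).
  by rewrite setUDr setDv setD0 /A !bigcup_mkord big_ord_recr.
set B := above (x n) `\` A.
have FB : F (x n) B by apply: F_setD => //; exact: above_F.
have mB := Fm xn0 FB.
have E w : (\1_(A `|` B) w : R) = \1_A w + \1_B w.
  rewrite !indicE in_setU /B in_setD; case: (w \in A) => /=; first by rewrite andbF addr0.
  by rewrite andbT add0r.
split; first exact: measurableU.
have lY C : measurable C -> L1 (fun w => \1_C w * `|Y T w|).
  by move=> mC; apply: L1_indic_mul => //; apply: L1_norm; exact: im_L1.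
rewrite (eq_Ex _ E) ExD ?mulrDr; [|exact: L1_indic|exact: L1_indic].
rewrite (@eq_Ex _ _ _ _ (fun w => _ * `|_|) (fun w => \1_A w * `|Y T w| + \1_B w * `|Y T w|));
  last by move=> w; rewrite E mulrDl.
rewrite ExD; [|exact: lY|exact: lY].
by rewrite lerD//; apply: (late_hit xn0 xnT FB) => w [].
Qed.

(** The strict inequality and right-continuity put every path of [A] eventually into the grid events
    [B n]. Each [B n] is contained in [A], so the indicators converge pointwise, and the discrete
    inequality passes to the limit. *)
Lemma maximal_inequality :
  let A := [set w | exists2 s, 0 <= s <= T & lam < Y s w] in
  measurable A /\ lam * Ex \1_A <= Ex (fun w => `|Y T w|).
Proof.
move=> A.
pose x n k : R := clamp 0 T (k%:R / n.+1%:R).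
(* Enough indices to include [next_grid n s] for every [s <= T]; grid points beyond [T] are clamped
   to [T]. *)
pose K n := (absz (Num.floor (T * n.+1%:R) + 1)).+1.
pose B n := \bigcup_(i < K n) above (x n i).
have xT n k : 0 <= x n k <= T by exact: clamp_itv.
have xS n i j : (i <= j)%N -> x n i <= x n j.
  move=> ij; have h : i%:R / n.+1%:R <= j%:R / n.+1%:R :> R.
    by rewrite ler_wpM2r ?invr_ge0// ler_nat.
  rewrite /x /clamp; move: (i%:R / n.+1%:R) (j%:R / n.+1%:R) h => p q pq.
  rewrite ge_max le_max lexx/= le_max; apply/orP; right.
  by rewrite le_min ge_min pq/= ge_min lexx orbT.
have hB n := discrete_hit (K n) (xS n) (xT n).
have BA n : B n `<=` A by move=> w [i /= _ ?]; exists (x n i).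
have AB w : A w -> \forall n \near \oo, B n w.
  move=> [s sT lY]; have /andP[s0 sT'] := sT.
  have h : Y (clamp 0 T (next_grid n s)) w @[n --> \oo] --> Y s w.
    have := right_continuous_clamp (lexx 0) T0 (im_cadlag mY w) (t := s).
    rewrite [in X in X -> _](@clamp_id _ 0 T s)// => /cvg_at_rightP; apply; split.
      by move=> n; exact: next_grid_gt.
    exact: cvg_next_grid.
  near=> n.
  have lt : lam < Y (clamp 0 T (next_grid n s)) w by near: n; exact: cvgr_gt h _ lY.
  have kE : next_grid n s = (absz (Num.floor (s * n.+1%:R) + 1))%:R / n.+1%:R.
    by rewrite /next_grid natr_absz ger0_norm// addr_ge0// floor_ge0 mulr_ge0.
  exists (absz (Num.floor (s * n.+1%:R) + 1)); last by rewrite /above /x /= -kE.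
  rewrite /= /K ltnS -lez_nat !gez0_abs ?addr_ge0 ?floor_ge0 ?mulr_ge0//.
  by rewrite lerD2r; apply: le_floor; rewrite ler_wpM2r.
have BC w : (\1_(B n) w : R) @[n --> \oo] --> (\1_A w : R).
  have [Aw|nA] := pselect (A w); apply: cvg_near_cst.
    by apply: filterS (AB w Aw) => n Bw; rewrite !indicE !mem_set.
  apply: nearW => n; rewrite !indicE !memNset//.
  by move=> /BA.
have mA : measurable A.
  have -> : A = \bigcup_n B n.
    apply/seteqP; split => [w /AB[n _ h]|w [n _ /BA]//].
    by exists n => //; apply: h => /=.
  by apply: bigcupT_measurable => n; case: (hB n).
split => //.
have [||_ cE] := @Ex_dominated _ _ _ Pr (fun n => \1_(B n)) \1_A _ _ (L1_cst Pr 1) _ BC.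
- by move=> n; apply: measurable_indic; case: (hB n).
- by move=> n w; rewrite indicE; case: (_ \in _); rewrite ?normr1 ?normr0.
have cE' : lam * Ex \1_(B n) @[n --> \oo] --> lam * Ex \1_A by apply: cvgM; [exact: cvg_cst|exact: cE].
apply: (cvg_seq_le cE') => n; have [mB /le_trans] := hB n; apply.
apply: le_Ex => [||w]; [|by apply: L1_norm; exact: im_L1|].
  by apply: L1_indic_mul => //; apply: L1_norm; exact: im_L1.
by rewrite ler_piMl// indicE; case: (_ \in _).
Unshelve. all: by end_near. Qed.

End maximal_inequality.

Section uniform_limits.
Context (R : realType).

Lemma geometric_cauchy (x : nat -> R) n0 :
  (forall k, (n0 <= k)%N -> `|x k.+1 - x k| <= (2 ^ k.+1)%:R^-1) ->
  exists l : R, x k @[k --> \oo] --> l /\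
    forall k, (n0 <= k)%N -> `|l - x k| <= (2 ^ k)%:R^-1.
Proof.
move=> hx.
have p2 k : 0 < (2 ^ k)%:R :> R by rewrite ltr0n expn_gt0.
have pS k : (2 ^ k)%:R^-1 = (2 ^ k.+1)%:R^-1 + (2 ^ k.+1)%:R^-1 :> R.
  rewrite expnS natrM invfM; have := p2 k; move: ((2 ^ k)%:R) => z z0.
  by field; exact: lt0r_neq0.
have tele k j : (n0 <= k)%N -> `|x (k + j)%N - x k| <= (2 ^ k)%:R^-1 - (2 ^ (k + j))%:R^-1.
  move=> nk; elim: j => [|j ih]; first by rewrite addn0 !subrr normr0.
  rewrite addnS; have h := hx (k + j)%N (leq_trans nk (leq_addr _ _)).
  have := pS (k + j)%N; move: ih h; move: (x (k + j)%N) (x (k + j).+1) (x k) => a b c.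
  have := ler_normD (b - a) (a - c); rewrite (_ : b - a + (a - c) = b - c); last by ring.
  lra.
have tele' k m : (n0 <= k)%N -> (k <= m)%N -> `|x m - x k| <= (2 ^ k)%:R^-1.
  move=> nk km; rewrite -(subnKC km); apply: le_trans (tele k (m - k)%N nk) _.
  by rewrite gerBl invr_ge0 ltW.
have /cvg_ex[l xl] : cvg (x k @[k --> \oo]).
  apply: cauchy_cvg; apply: cauchy_exP => e e0.
  have : (2 ^ k)%:R^-1 @[k --> \oo] --> (0 : R).
    have -> : (fun k => (2 ^ k)%:R^-1) = (fun k => 2^-1 ^+ k) :> (nat -> R).
      by apply/funext => k; rewrite natrX exprVn.
    by apply: cvg_expr; rewrite ger0_norm ?invr_ge0// invf_lt1// ltr1n.
  move=> /cvgrPdist_lt/(_ _ e0)[k0 _ hk].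
  pose k := maxn n0 k0; exists (x k); exists k => // m /= km.
  rewrite /ball/= distrC (le_lt_trans (tele' k m (leq_maxl _ _) km))//.
  have := hk k (leq_maxr _ _); rewrite sub0r normrN ger0_norm//.
exists l; split => // k nk.
have h : `|x m - x k| @[m --> \oo] --> `|l - x k|.
  by apply: cvg_norm; apply: cvgB => //; exact: cvg_cst.
rewrite -(cvg_lim _ h)//; apply: limr_le; first by apply/cvg_ex; eexists; exact: h.
by near=> m; apply: tele' => //; near: m; exact: nbhs_infty_ge.
Unshelve. all: by end_near. Qed.

Lemma cadlag_uniform_limit (f_ : nat -> R -> R) (f : R -> R) : (forall n, cadlag (f_ n)) ->
  (forall t e : R, 0 < e -> exists n, forall s, 0 <= s <= t -> `|f s - f_ n s| <= e) ->
  cadlag f.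
Proof.
move=> cf uf; split => t t0.
  apply/cvgrPdist_le => e e0; have e3 : 0 < e / 3 by rewrite divr_gt0.
  have [n hn] := uf (t + 1) _ e3.
  have ht : `|f t - f_ n t| <= e / 3 by apply: hn; rewrite t0 lerDl ler01.
  have /cvgrPdist_le/(_ _ e3) c := (cf n).1 t t0.
  near=> s.
  have hs : `|f s - f_ n s| <= e / 3.
    apply: hn; apply/andP; split; last by near: s; apply: nbhs_right_le; rewrite ltrDl.
    by apply: (le_trans t0); near: s; exact: nbhs_right_ge.
  have cs : `|f_ n t - f_ n s| <= e / 3 by near: s; exact: c.
  have -> : f t - f s = (f t - f_ n t) + (f_ n t - f_ n s) - (f s - f_ n s) by ring.
  have := ler_normB (f t - f_ n t + (f_ n t - f_ n s)) (f s - f_ n s).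
  have := ler_normD (f t - f_ n t) (f_ n t - f_ n s).
  lra.
apply: cauchy_cvg; apply: cauchy_exP => e e0.
have e2 : 0 < e / 2 by rewrite divr_gt0.
have e3 : 0 < e / 3 by rewrite divr_gt0.
have [n hn] := uf t _ e3.
have /cvg_ex[/= l cl] := (cf n).2 t t0.
exists l; have /cvgrPdist_le/(_ _ e2) c := cl.
near=> s; rewrite /ball/=.
have hs : `|f s - f_ n s| <= e / 3.
  apply: hn; apply/andP; split; near: s; [exact: nbhs_left_ge|exact: nbhs_left_le].
have cs : `|l - f_ n s| <= e / 2 by near: s; exact: c.
have -> : l - f s = (l - f_ n s) - (f s - f_ n s) by ring.
by apply: le_lt_trans (ler_normB _ _) _; lra.
Unshelve. all: by end_near. Qed.

Lemma limn_einf_le (u : nat -> \bar R) (e : \bar R) : (forall k, (u k <= e)%E) ->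
  (limn_einf u <= e)%E.
Proof.
move=> ue; rewrite limn_einf_lim; apply: lime_le; first exact: is_cvg_einfs.
apply: nearW => n; apply: le_trans (ue n); apply: ereal_inf_lbound; exists n => //=.
Qed.

End uniform_limits.

(** * Limits of martingales that are Cauchy in L^1 *)

Section martingale_limit.
Context (R : realType) d (Omega : measurableType d) (Pr : probability Omega R)
  (F : R -> set (set Omega)) (HF : is_filtration F).
Local Notation Ex := (Ex Pr).
Local Notation L1 := (L1 Pr).

Let sF t (t0 : 0 <= t) : sigma_algebra setT (F t) := filtration_sigma HF t0.
Let Fm t (t0 : 0 <= t) A : F t A -> measurable A :=
  fun FA => filtration_measurable HF t0 FA.

Lemma integrable_martingaleB (Y Z : R -> Omega -> R) :
  integrable_martingale Pr F Y -> integrable_martingale Pr F Z ->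
  integrable_martingale Pr F (fun t w => Y t w - Z t w).
Proof.
move=> mY mZ; split=> [w|t t0|t t0|s t A s0 st FA].
- by apply: cadlagB; [exact: (im_cadlag mY)|exact: (im_cadlag mZ)].
- apply: (measurable_wrtB (sF t0)); [exact: (im_adapted mY)|exact: (im_adapted mZ)].
- by apply: L1B; [exact: (im_L1 mY)|exact: (im_L1 mZ)].
have t0 := le_trans s0 st; have mA := Fm s0 FA.
rewrite (@eq_Ex _ _ _ _ _ (fun w => \1_A w * (Y t w - Y s w) - \1_A w * (Z t w - Z s w))).
  rewrite ExB ?(im_fair mY)// ?(im_fair mZ)// ?subr0//; apply: L1_indic_mul => //;
    apply: L1B; by [exact: (im_L1 mY)|exact: (im_L1 mZ)].
by move=> w; ring.
Qed.

Lemma integrable_martingaleN (Y : R -> Omega -> R) :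
  integrable_martingale Pr F Y -> integrable_martingale Pr F (fun t w => - Y t w).
Proof.
move=> mY; have mZ : integrable_martingale Pr F (fun _ _ => 0).
  split=> [w|t t0|t t0|s t A s0 st FA].
  - exact: cadlag_cst.
  - exact: (measurable_wrt_cst (sF t0)).
  - exact: L1_cst.
  - by rewrite (@eq_Ex _ _ _ _ _ (fun=> 0)) ?Ex_cst// => w; rewrite subrr mulr0.
have := integrable_martingaleB mZ mY.
by congr integrable_martingale; apply/funext => t; apply/funext => w; rewrite sub0r.
Qed.

Lemma norm_maximal_inequality (Y : R -> Omega -> R) (T lam : R) :
  integrable_martingale Pr F Y -> 0 <= T -> 0 <= lam ->
  let A := [set w | exists2 s, 0 <= s <= T & lam < `|Y s w|] in
  measurable A /\ lam * Ex \1_A <= 2 * Ex (fun w => `|Y T w|).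
Proof.
move=> mY T0 l0 A.
have [/= mB hB] := maximal_inequality HF mY lam T0.
have [/= mC hC] := maximal_inequality HF (integrable_martingaleN mY) lam T0.
set B := [set w | _] in mB hB; set C := [set w | _] in mC hC.
have AE : A = B `|` C.
  apply/seteqP; split => [w [s sT]|w [[s sT lt]|[s sT lt]]].
  - by rewrite lter_normr => /orP[lt|lt]; [left|right]; exists s.
  - by exists s => //; rewrite lter_normr lt.
  - by exists s => //; rewrite lter_normr lt orbT.
have mA : measurable A by rewrite AE; exact: measurableU.
split => //.
have h : Ex \1_A <= Ex \1_B + Ex \1_C.
  rewrite -ExD; [|exact: L1_indic|exact: L1_indic].
  apply: le_Ex => [||w]; [exact: L1_indic|by apply: L1D; exact: L1_indic|].
  by rewrite AE !indicE in_setU; case: (w \in B); case: (w \in C); rewrite /= ?addr0 ?add0r ?lerDl.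
have -> : 2 * Ex (fun w => `|Y T w|) = Ex (fun w => `|Y T w|) + Ex (fun w => `|- Y T w|).
  by rewrite mulr_natl mulr2n; congr (_ + _); apply: eq_Ex => w; rewrite normrN.
apply: le_trans (ler_wpM2l l0 h) _; rewrite mulrDr; exact: lerD.
Qed.

Variable Y : nat -> R -> Omega -> R.
Hypotheses (mY : forall n, integrable_martingale Pr F (Y n))
  (cauchyY : forall t e, 0 <= t -> 0 < e -> exists n0 : nat, forall n m, (n0 <= n)%N ->
    (n0 <= m)%N -> Ex (fun w => `|Y n t w - Y m t w|) <= e).

Let half k : R := (2 ^ k)%:R^-1.
Let half_gt0 k : 0 < half k. Proof. by rewrite invr_gt0 ltr0n expn_gt0. Qed.

(** One factor [half k.+1] is the level in the maximal inequality, the other is the resulting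
    summable bound on the probability, and the division by 2 absorbs the constant of
    [norm_maximal_inequality]. The time [k] grows with the index so that every compact interval is
    eventually covered. *)
Let fast : exists2 n_ : nat -> nat, (forall k, (k <= n_ k)%N) &
  forall k, Ex (fun w => `|Y (n_ k.+1) k%:R w - Y (n_ k) k%:R w|) <=
    half k.+1 * half k.+1 / 2.
Proof.
have /choice[n0 hn0] : forall k : nat, exists n0 : nat, forall n m, (n0 <= n)%N ->
    (n0 <= m)%N -> Ex (fun w => `|Y n k%:R w - Y m k%:R w|) <= half k.+1 * half k.+1 / 2.
  by move=> k; apply: cauchyY; rewrite ?divr_gt0 ?mulr_gt0.
(* Not below [k] nor any [n0 j] with [j <= k], so both [n_ k] and [n_ k.+1] reach the range of
   [n0 k]. *)
exists (fun k => (k + \sum_(j < k.+1) n0 j)%N) => [k|k]; first exact: leq_addr.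
have h : (n0 k <= \sum_(j < k.+1) n0 j)%N by rewrite big_ord_recr leq_addl.
apply: hn0; last exact: leq_trans h (leq_addl _ _).
by rewrite [X in (_ + X)%N]big_ord_recr/=; apply: leq_trans h _; rewrite addnCA leq_addr.
Qed.

(** Along the fast subsequence, the maximal inequality and Borel-Cantelli upgrade the [L^1] Cauchy
    property at fixed times to almost sure uniform convergence on compacts, which preserves cadlag
    paths. Fatou's lemma gives [L^1] convergence of the whole sequence, and fairness follows from
    it. *)
Lemma martingale_limit : exists Q : R -> Omega -> R,
  [/\ (forall t, 0 <= t -> measurable_wrt (F t) (Q t)),
      {ae Pr, forall w, cadlag (Q ^~ w)},
      (forall t, 0 <= t -> L1 (Q t)) &
      (forall t e, 0 <= t -> 0 < e -> exists n0 : nat, forall n, (n0 <= n)%N ->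
         Ex (fun w => `|Y n t w - Q t w|) <= e)] /\
  (forall s t A, 0 <= s -> s <= t -> F s A -> Ex (fun w => \1_A w * (Q t w - Q s w)) = 0).
Proof.
have [n_ n_k fastY] := fast.
(* An upper limit exists for every [w] and is measurable for [F t], even when the null set of bad
   paths is not in [F t]. On that null set [fine] may return its default 0. *)
pose Q t w := fine (limn_esup (fun k => (Y (n_ k) t w)%:E)).
have aQ t : 0 <= t -> measurable_wrt (F t) (Q t).
  move=> t0; apply/(measurable_wrtP (sF t0)).
  apply: measurableT_comp; first exact: fine_measurable.
  apply: (@measurable_fun_limn_esup _ (g_sigma_algebraType (F t)) R setT
    (fun k w => (Y (n_ k) t w)%:E)) => k.
  by apply/measurable_EFinP/(measurable_wrtP (sF t0)); exact: im_adapted.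
pose A k : set Omega :=
  [set w | exists2 s, 0 <= s <= k%:R & half k.+1 < `|Y (n_ k.+1) s w - Y (n_ k) s w|].
have hA k : measurable (A k) /\ Ex \1_(A k) <= half k.+1.
  have mD := integrable_martingaleB (mY (n_ k.+1)) (mY (n_ k)).
  have [mA hA] := norm_maximal_inequality mD (ler0n R k) (ltW (half_gt0 k.+1)).
  split => //; rewrite -(ler_pM2l (half_gt0 k.+1)); apply: le_trans hA _.
  have := fastY k; lra.
have mA k : measurable (A k) by case: (hA k).
have PA k : (Pr (A k) <= (half k.+1)%:E)%E.
  by rewrite -(Ex_indicE Pr (mA k)) lee_fin; case: (hA k).
have N0 : Pr (lim_sup_set A) = 0%E.
  apply: lim_sup_set_cvg0 => //.
  apply: (@le_lt_trans _ _ (\sum_(k <oo) (1 / (2 ^ k.+1)%:R)%:E)%E).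
    apply: lee_nneseries => // k _; rewrite div1r; exact: PA.
  by apply: le_lt_trans (epsilon_trick0 xpredT ler01) _; rewrite ltry.
have mN : measurable (lim_sup_set A).
  by apply: bigcap_measurable => // n _; apply: bigcup_measurable => k _; exact: mA.
(* A path outside the upper limit of the [A k] lies in none of them from some [K] on; the increments
   are then bounded geometrically on [[0, k]], with remainder [half k]. *)
have good w : ~ lim_sup_set A w -> exists K, forall t k, 0 <= t -> t <= k%:R -> (K <= k)%N ->
    Y (n_ j) t w @[j --> \oo] --> Q t w /\ `|Q t w - Y (n_ k) t w| <= half k.
  move=> nA; have [K hK] : exists K, forall k, (K <= k)%N -> ~ A k w.
    apply: contrapT => nK; apply: nA => K _; apply: contrapT => nA; apply: nK; exists K.
    by move=> k Kk Ak; apply: nA; exists k.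
  exists K => t k t0 tk Kk.
  have [l [cl hl]] : exists l : R, Y (n_ j) t w @[j --> \oo] --> l /\
      forall j, (k <= j)%N -> `|l - Y (n_ j) t w| <= half j.
    apply: geometric_cauchy => j kj; rewrite leNgt; apply/negP => lt.
    apply: (hK j (leq_trans Kk kj)); exists t => //; rewrite t0 (le_trans tk)//.
    by rewrite ler_nat.
  have -> : Q t w = l; last by split => //; exact: hl.
  have cE : (Y (n_ j) t w)%:E @[j --> \oo] --> l%:E by apply: cvg_EFin => //; exact: nearW.
  by rewrite /Q (cvg_limn_einf_sup cE).2.
have ae_good (P : Omega -> Prop) : (forall w, ~ lim_sup_set A w -> P w) -> {ae Pr, forall w, P w}.
  move=> hP; exists (lim_sup_set A); split => // w /= nP; apply: contrapT => nw.
  by apply: nP; exact: hP.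
have lQ t e : 0 <= t -> 0 < e -> exists n0 : nat, forall n, (n0 <= n)%N ->
    L1 (fun w => Y n t w - Q t w) /\ Ex (fun w => `|Y n t w - Q t w|) <= e.
  move=> t0 e0; have [n0 hn0] := cauchyY t0 e0; exists n0 => n nn.
  have mYt k := L1_measurable (im_L1 (mY k) t0).
  have mQ : measurable_fun setT (Q t).
    by apply: (measurable_wrt_measurable (@Fm _ t0)); exact: aQ.
  (* Fatou is applied along the subsequence. The shift by [n0], together with [k <= n_ k], keeps all
     its terms in the range where the Cauchy bound holds. *)
  pose f k w := `|Y n t w - Y (n_ (k + n0)%N) t w|%:E.
  have mf k : measurable_fun setT (f k).
    by apply/measurable_EFinP; apply: measurableT_comp => //; exact: measurable_funB.
  have h : (\int[Pr]_w `|Y n t w - Q t w|%:E <= e%:E)%E.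
    apply: (@le_trans _ _ (\int[Pr]_w limn_einf (f ^~ w))%E).
      apply: ae_ge0_le_integral => //.
      - by apply/measurable_EFinP; apply: measurableT_comp => //; exact: measurable_funB.
      - move=> w _; rewrite limn_einf_lim; apply: lime_ge; first exact: is_cvg_einfs.
        by apply: nearW => k; apply/ereal_infP => _ [j _ <-]; rewrite lee_fin.
      - apply: measurableT_comp; first exact: oppe_measurable.
        by apply: measurable_fun_limn_esup => k; apply: measurableT_comp; [exact: oppe_measurable|].
      - apply: ae_good => w /good[K hK] _.
        pose k := maxn K (Num.bound `|t|).
        have [|c _] := hK t k t0 _ (leq_maxl _ _).
          by rewrite (le_trans (ler_norm _))// (le_trans (ltW (archi_boundP _)))// ler_nat leq_maxr.
        suff cE : f j w @[j --> \oo] --> `|Y n t w - Q t w|%:E.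
          by rewrite (cvg_limn_einf_sup cE).1.
        apply: cvg_EFin; first exact: nearW.
        apply: cvg_norm; apply: cvgB; first exact: cvg_cst.
        by rewrite (cvg_shiftn n0 (fun j => Y (n_ j) t w)).
    have f0 k w : setT w -> (0 <= f k w)%E by rewrite lee_fin.
    apply: (le_trans (fatou Pr measurableT mf f0)).
    apply: limn_einf_le => k; rewrite /f -ExE ?lee_fin; last first.
      by apply: L1_norm; apply: L1B; exact: im_L1.
    by apply: hn0 => //; apply: leq_trans (n_k _); exact: leq_addl.
  have li : L1 (fun w => Y n t w - Q t w).
    apply/integrableP; split; first by apply/measurable_EFinP; exact: measurable_funB.
    by apply: le_lt_trans h _; exact: ltry.
  by split => //; rewrite -lee_fin ExE//; exact: L1_norm.
have L1Q t : 0 <= t -> L1 (Q t).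
  move=> t0; have [n0 /(_ _ (leqnn _))[l _]] := lQ t 1 t0 ltr01.
  have := L1B (im_L1 (mY n0) t0) l.
  by congr L1; apply/funext => w; ring.
exists Q; split; first split => //.
- apply: ae_good => w /good[K hK].
  apply: (cadlag_uniform_limit (f_ := fun k t => Y (n_ k) t w)) => [k|t e e0].
    exact: im_cadlag.
  have : half k @[k --> \oo] --> (0 : R).
    have -> : half = (fun k => 2^-1 ^+ k) by apply/funext => k; rewrite /half natrX exprVn.
    by apply: cvg_expr; rewrite ger0_norm ?invr_ge0// invf_lt1// (ltr_nat _ 1 2).
  move=> /cvgrPdist_lt/(_ _ e0)[k0 _ hk0].
  pose k := maxn (maxn K k0) (Num.bound `|t|).
  exists k => s /andP[s0 st].
  have [||_ le] := hK s k s0.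
  - by rewrite (le_trans st)// (le_trans (ler_norm _))// (le_trans (ltW (archi_boundP _)))// ler_nat leq_maxr.
  - by rewrite /k !leq_max leqnn.
  have kk0 : (k0 <= k)%N by rewrite /k !leq_max leqnn orbT.
  have := hk0 k kk0; rewrite sub0r normrN gtr0_norm// => /ltW; exact: le_trans.
- move=> t e t0 e0; have [n0 h] := lQ t e t0 e0.
  by exists n0 => n nn; case: (h n nn).
move=> s t B s0 st FB; have t0 := le_trans s0 st; have mB := Fm s0 FB.
apply/eqP; rewrite -normr_le0; apply/ler_addgt0Pr => e e0; rewrite add0r.
have e2 : 0 < e / 2 by rewrite divr_gt0.
have [n1 h1] := lQ s _ s0 e2; have [n2 h2] := lQ t _ t0 e2.
pose n := maxn n1 n2.
have [l1 {}h1] := h1 n (leq_maxl _ _); have [l2 {}h2] := h2 n (leq_maxr _ _).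
rewrite (@eq_Ex _ _ _ _ _ (fun w => \1_B w * (Y n t w - Y n s w) +
  (\1_B w * (Y n s w - Q s w) - \1_B w * (Y n t w - Q t w)))); last by move=> w; ring.
have j1 := L1_indic_mul mB l1; have j2 := L1_indic_mul mB l2.
rewrite ExD; [|by apply: L1_indic_mul => //; apply: L1B; exact: im_L1|exact: L1B].
rewrite (im_fair (mY n) s0 st FB) add0r ExB//.
have le01 f : L1 f -> `|Ex (fun w => \1_B w * f w)| <= Ex (fun w => `|f w|).
  move=> lf; apply: le_trans (normr_Ex (L1_indic_mul mB lf)) _.
  apply: le_Ex => [||w]; [by apply: L1_norm; exact: L1_indic_mul|exact: L1_norm|].
  by rewrite normrM ler_piMl// indicE; case: (_ \in _); rewrite ?normr1 ?normr0.
rewrite [leRHS]splitr (le_trans (ler_normB _ _))//.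
by apply: lerD; [exact: le_trans (le01 _ l1) h1|exact: le_trans (le01 _ l2) h2].
Qed.

End martingale_limit.

Lemma cadlag_stop (R : realType) (f : R -> R) (x : R) : 0 <= x -> cadlag f ->
  cadlag (fun t => f (Num.min x t)).
Proof.
move=> x0 [rf lf]; split => t t0.
  have [xt|tx] := leP x t.
    apply: cvg_near_cst; near=> s; rewrite min_l//; apply: (le_trans xt).
    by near: s; exact: nbhs_right_ge.
  apply: cvg_trans (rf t t0); apply: near_eq_cvg; near=> s.
  by rewrite min_r//; near: s; exact: nbhs_right_le.
have [xt|tx] := ltP x t.
  apply/cvg_ex; exists (f x); apply: cvg_near_cst; near=> s.
  by rewrite min_l//; near: s; exact: nbhs_left_ge.
have /cvg_ex[/= l fl] := lf t t0; apply/cvg_ex; exists l.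
apply: cvg_trans fl; apply: near_eq_cvg; near=> s.
by rewrite min_r//; apply: le_trans tx; near: s; exact: nbhs_left_le.
Unshelve. all: by end_near. Qed.

Section grids.
Context (R : realType).

(** Points of step [1 / n.+1] stopped at [t]: one grid serves all [t], so the left-point sums form a
    process in [t]. With [n.+1 * n.+1] cells it covers times up to [n.+1]. *)
Definition grid n (t : R) i : R := Num.min (i%:R / n.+1%:R) t.
Definition grid_size n := (n.+1 * n.+1)%N.

Let le_div n i j : (i <= j)%N -> i%:R / n.+1%:R <= j%:R / n.+1%:R :> R.
Proof. by move=> ij; rewrite ler_wpM2r ?invr_ge0// ler_nat. Qed.

Lemma grid_partition n (t : R) : 0 <= t -> t <= n.+1%:R ->
  weak_partition t (grid n t) (grid_size n).
Proof.
move=> t0 tn; split=> [|i|]; rewrite /grid.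
- by rewrite mul0r min_l.
- by rewrite le_min !ge_min le_div// lexx orbT.
- by rewrite min_r// /grid_size natrM mulfK// pnatr_eq0.
Qed.

Lemma grid_mesh n (t e : R) N : n.+1%:R^-1 < e -> mesh_below (grid n t) N e.
Proof.
move=> ne i _; apply: le_lt_trans ne; rewrite /grid lerBlDr.
have -> : i.+1%:R / n.+1%:R = i%:R / n.+1%:R + n.+1%:R^-1 :> R.
  by rewrite -natr1 mulrDl mul1r.
move: (i%:R / n.+1%:R) => x; have d0 : 0 <= n.+1%:R^-1 :> R by rewrite invr_ge0.
move: (n.+1%:R^-1) d0 => z z0.
have [tx|/ltW xt] := leP t x; first by rewrite ge_min lerDr z0 orbT.
by rewrite ge_min addrC lexx.
Qed.

End grids.

(** * Construction of the quadratic variation *)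

Section quadratic_variation.
Context (R : realType) d (Omega : measurableType d) (Pr : probability Omega R)
  (F : R -> set (set Omega)) (HF : is_filtration F) (M a c : R -> Omega -> R).
Local Notation mu := (@lebesgue_measure R).
Local Notation Ex := (Ex Pr).
Local Notation L1 := (L1 Pr).
Local Notation L2 := (L2 Pr).
Hypotheses (cM : forall w, cadlag (M ^~ w)) (M0 : forall w, M 0 w = 0)
  (aM : forall t, 0 <= t -> measurable_wrt (F t) (M t))
  (lM : forall t, 0 <= t -> L2 (M t))
  (mM : forall s t A, 0 <= s -> s <= t -> F s A ->
    Ex (fun w => \1_A w * (M t w - M s w)) = 0)
  (ca : forall w, cadlag (a ^~ w)) (cc : forall w, cadlag (c ^~ w))
  (la : forall s t, 0 <= s -> s <= t -> L1 (fun w => \int[mu]_(v in `[s, t]) a v w))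
  (lc : forall s t, 0 <= s -> s <= t -> L1 (fun w => \int[mu]_(v in `[s, t]) c v w))
  (ac : forall v w, `|a v w| <= c v w)
  (bM : forall s t A, 0 <= s -> s <= t -> F s A ->
    Ex (fun w => \1_A w * (M t w - M s w) ^+ 2) =
    Ex (fun w => \1_A w * \int[mu]_(v in `[s, t]) a v w)).

Let sF t (t0 : 0 <= t) : sigma_algebra setT (F t) := filtration_sigma HF t0.
Let Fm t (t0 : 0 <= t) : F t `<=` measurable :=
  fun A FA => filtration_measurable HF t0 FA.

Let fair_product r s t A : 0 <= r -> r <= s -> s <= t -> F s A ->
  Ex (fun w => \1_A w * (M r w * (M t w - M s w))) = 0.
Proof.
move=> r0 rs st FA; have s0 := le_trans r0 rs; have mA := Fm s0 FA.
rewrite (@eq_Ex _ _ _ _ _ (fun w => (\1_A w * M r w) * (M t w - M s w))); last first.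
  by move=> w; rewrite mulrA.
apply: (increment_orthogonal HF lM mM s0 st).
  apply: (measurable_wrtM (sF s0)); first by apply: measurable_wrt_indic => //; exact: sF.
  exact: (measurable_wrt_filtration HF r0 rs (aM r0)).
apply: L2_mul; first by apply: L2_indic_mul => //; exact: lM.
exact: (increment_L2 lM s0 (le_trans s0 st)).
Qed.

(** The elementary integral of [M_x] over []x, y]], run up to time [t]; after [y] it is constant and
    before [x] it is 0. *)
Let term x y t w := M (Num.min x t) w * (M (Num.min y t) w - M (Num.min x t) w).

Let term_im x y : 0 <= x -> x <= y -> integrable_martingale Pr F (term x y).
Proof.
move=> x0 xy; have y0 := le_trans x0 xy.
have min0 (z t : R) : 0 <= z -> 0 <= t -> 0 <= Num.min z t by move=> z0 t0; rewrite le_min z0.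
have lt t : 0 <= t -> L1 (term x y t).
  move=> t0; apply: L2_mul; first by apply: lM; exact: min0.
  by apply: L2B; apply: lM; exact: min0.
split=> [w|t t0||s t A s0 st FA] //.
- apply: cadlagM; first exact: (cadlag_stop x0 (cM w)).
  by apply: cadlagB; [exact: (cadlag_stop y0 (cM w))|exact: (cadlag_stop x0 (cM w))].
- have mz z : 0 <= z -> measurable_wrt (F t) (M (Num.min z t)).
    move=> z0; have zt := min0 _ _ z0 t0.
    by apply: (measurable_wrt_filtration HF zt _ (aM zt)); rewrite ge_min lexx orbT.
  by apply: (measurable_wrtM (sF t0)); [exact: mz|apply: (measurable_wrtB (sF t0)); exact: mz].
have t0 := le_trans s0 st; have mA := Fm s0 FA.
have [xs|/ltW sx] := leP x s.
  have xt := le_trans xs st.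
  have [ys|/ltW sy] := leP y s.
    rewrite (@eq_Ex _ _ _ _ _ (fun=> 0)) ?Ex_cst// => w.
    by rewrite /term !min_l// ?subrr ?mulr0// (le_trans ys).
  have sm : s <= Num.min y t by rewrite le_min sy.
  rewrite (@eq_Ex _ _ _ _ _ (fun w => \1_A w * (M x w * (M (Num.min y t) w - M s w)))).
    exact: fair_product.
  by move=> w; rewrite /term (min_l xs) (min_l xt) (min_r sy); ring.
have sy := le_trans sx xy.
have E w : term x y s w = 0 by rewrite /term (min_r sx) (min_r sy) subrr mulr0.
have [xt|/ltW tx] := leP x t.
  have xm : x <= Num.min y t by rewrite le_min xy.
  rewrite (@eq_Ex _ _ _ _ _ (fun w => \1_A w * (M x w * (M (Num.min y t) w - M x w)))).
    by apply: fair_product => //; exact: (filtration_le HF s0 sx FA).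
  by move=> w; rewrite E subr0 /term (min_l xt).
rewrite (@eq_Ex _ _ _ _ _ (fun=> 0)) ?Ex_cst// => w.
by rewrite E /term (min_r tx) (min_r (le_trans tx xy)) subrr mulr0 subrr mulr0.
Qed.

Let I n t w := left_sum M (grid n t) (grid_size n) M w.

Let I_im n : integrable_martingale Pr F (I n).
Proof.
pose Z (i : nat) := term (i%:R / n.+1%:R) (i.+1%:R / n.+1%:R).
have tm i : integrable_martingale Pr F (Z i).
  by apply: term_im; rewrite ?mulr_ge0 ?invr_ge0// ler_wpM2r ?invr_ge0// ler_nat.
have IE t w : I n t w = \sum_(i < grid_size n) Z i t w by [].
split=> [w|t t0|t t0|s t A s0 st FA].
- by apply: (@cadlag_sum _ _ _ (fun i : 'I_(grid_size n) => Z i ^~ w)) => i; exact: (im_cadlag (tm i)).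
- by apply: (measurable_wrt_sum (sF t0)) => i; exact: (im_adapted (tm i)).
- by apply: L1_sum => i; exact: (im_L1 (tm i)).
have t0 := le_trans s0 st; have mA := Fm s0 FA.
rewrite (@eq_Ex _ _ _ _ _ (fun w => \sum_(i < grid_size n) \1_A w * (Z i t w - Z i s w))); last first.
  by move=> w; rewrite -mulr_sumr sumrB -!IE.
rewrite Ex_sum ?big1// => [i _|i]; first exact: (im_fair (tm i) s0 st FA).
by apply: L1_indic_mul => //; apply: L1B; exact: (im_L1 (tm i)).
Qed.

Let eventually_fine t (dlt : R) : 0 < dlt -> 0 <= t -> exists n0 : nat, forall n, (n0 <= n)%N ->
  weak_partition t (grid n t) (grid_size n) /\ mesh_below (grid n t) (grid_size n) dlt.
Proof.
move=> d0 t0; exists (maxn (Num.bound t) (Num.bound dlt^-1)) => n.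
rewrite geq_max => /andP[n1 n2]; split.
  apply: grid_partition => //; apply: le_trans (ltW (archi_boundP t0)) _.
  by rewrite ler_nat leqW.
apply: grid_mesh; rewrite invf_plt ?posrE//; have di0 : 0 <= dlt^-1 by rewrite invr_ge0 ltW.
by apply: lt_le_trans (archi_boundP di0) _; rewrite ler_nat leqW.
Qed.

Let I_uniform t (e : R) : 0 < e -> exists2 dlt : R, 0 < dlt &
  forall u N u' N', weak_partition t u N -> weak_partition t u' N' ->
    mesh_below u N dlt -> mesh_below u' N' dlt ->
    Ex (fun w => `|left_sum M u N M w - left_sum M u' N' M w|) <= e.
Proof. exact: (left_sum_uniform HF cM aM lM mM ca cc la lc ac bM t). Qed.

(** [Q = M^2 - 2 J] with [J] the limit of the left-point sums along the grids. Since [M_t^2 - M_s^2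
    = (M_t - M_s)^2 + 2 M_s (M_t - M_s)] and both [J] and [M_s (M_t - M_s)] have fair increments,
    [Q] has the same compensation identity as the squared increments. The last clause, in [L^1] and
    uniform in the partition, survives polarization. *)
Lemma quadratic_variation : exists Q : R -> Omega -> R,
  [/\ (forall t, 0 <= t -> measurable_wrt (F t) (Q t)),
      {ae Pr, forall w, cadlag (Q ^~ w)},
      (forall t, 0 <= t -> L1 (Q t)),
      (forall s t A, 0 <= s -> s <= t -> F s A ->
        Ex (fun w => \1_A w * (Q t w - Q s w)) =
        Ex (fun w => \1_A w * \int[mu]_(v in `[s, t]) a v w)) &
      (forall t (e : R), 0 <= t -> 0 < e -> exists2 dlt : R, 0 < dlt &
        forall u N, weak_partition t u N -> mesh_below u N dlt ->
        Ex (fun w => `|\sum_(i < N) (M (u i.+1) w - M (u i) w) ^+ 2 - Q t w|) <= e)].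
Proof.
have cauchyI t e : 0 <= t -> 0 < e -> exists n0 : nat, forall n m, (n0 <= n)%N ->
    (n0 <= m)%N -> Ex (fun w => `|I n t w - I m t w|) <= e.
  move=> t0 e0; have [dlt d0 h] := I_uniform t e0.
  have [n0 hn] := eventually_fine d0 t0; exists n0 => n m nn nm.
  by have [w1 m1] := hn n nn; have [w2 m2] := hn m nm; exact: h.
have [J [[aJ cJ lJ hJ] fJ]] := martingale_limit HF I_im cauchyI.
have lM2 t : 0 <= t -> L1 (fun w => M t w ^+ 2) by move=> /lM[].
have lQ t : 0 <= t -> L1 (fun w => M t w ^+ 2 - 2 * J t w).
  by move=> t0; apply: L1B; [exact: lM2|by apply: L1Z; exact: lJ].
exists (fun t w => M t w ^+ 2 - 2 * J t w); split=> [t t0|||s t A s0 st FA|t e t0 e0] //.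
- apply: (measurable_wrtB (sF t0)).
    under eq_fun do rewrite expr2.
    by apply: (measurable_wrtM (sF t0)); exact: aM.
  apply: (measurable_wrtM (sF t0)); last exact: aJ.
  exact: (measurable_wrt_cst (sF t0)).
- apply: filterS cJ => w cw.
  apply: cadlagB; last exact: cadlagZ.
  by under eq_fun do rewrite expr2; apply: cadlagM.
- have t0 := le_trans s0 st; have mA := Fm s0 FA.
  have lD : L1 (fun w => \1_A w * (M t w - M s w) ^+ 2).
    by apply: L1_indic_mul => //; case: (increment_L2 lM s0 t0).
  have lP : L1 (fun w => \1_A w * (M s w * (M t w - M s w))).
    apply: L1_indic_mul => //; apply: L2_mul; first exact: lM.
    exact: (increment_L2 lM s0 t0).
  have lJ' : L1 (fun w => \1_A w * (J t w - J s w)).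
    by apply: L1_indic_mul => //; apply: L1B; exact: lJ.
  rewrite -bM// (@eq_Ex _ _ _ _ _ (fun w => \1_A w * (M t w - M s w) ^+ 2 +
    2 * (\1_A w * (M s w * (M t w - M s w)) - \1_A w * (J t w - J s w)))); last first.
    by move=> w; ring.
  rewrite ExD//; last by apply: L1Z; exact: L1B.
  rewrite ExZ; last exact: L1B.
  by rewrite ExB// fJ// (fair_product s0 (lexx s) st FA) subrr mulr0 addr0.
(* The error is twice the distance from the left-point sum to [J]; passing through a fine grid costs
   [e / 4] on either side. *)
have e4 : 0 < e / 4 by rewrite divr_gt0.
have [dlt d0 h] := I_uniform t e4; exists dlt => // u N wp mh.
have [n0 hn0] := hJ t _ t0 e4; have [n1 hn1] := eventually_fine d0 t0.
pose n := maxn n0 n1.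
have {}hn0 := hn0 n (leq_maxl _ _); have [wn mn] := hn1 n (leq_maxr _ _).
have {h} hu := h _ _ _ _ wp wn mh mn.
have lL v k : weak_partition t v k -> L1 (left_sum M v k M).
  by move=> wv; apply: (left_sum_L1 lM wv) => i; apply: lM; exact: (weak_partition_ge0 i wv).
have l1 := L1_norm (L1B (lL _ _ wp) (lL _ _ wn)).
have l2 := L1_norm (L1B (lL _ _ wn) (lJ t t0)).
have [u0 uS uN] := wp.
have SE w : \sum_(i < N) (M (u i.+1) w - M (u i) w) ^+ 2 - (M t w ^+ 2 - 2 * J t w) =
    -2 * (left_sum M u N M w - J t w).
  have tele k : \sum_(i < k) (M (u i.+1) w - M (u i) w) ^+ 2 =
      M (u k) w ^+ 2 - 2 * left_sum M u k M w.
    elim: k => [|k ih]; first by rewrite /left_sum !big_ord0 u0 M0; ring.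
    by rewrite big_ord_recr/= ih /left_sum big_ord_recr/=; ring.
  by rewrite tele uN; ring.
rewrite (@eq_Ex _ _ _ _ _ (fun w => 2 * `|left_sum M u N M w - J t w|)); last first.
  by move=> w; rewrite SE normrM normrN (ger0_norm (ler0n R 2)).
have l3 := L1_norm (L1B (lL _ _ wp) (lJ t t0)).
rewrite ExZ//.
have h3 : Ex (fun w => `|left_sum M u N M w - J t w|) <= e / 4 + e / 4.
  apply: le_trans (lerD hu hn0); rewrite -ExD//; apply: le_Ex => // [|w]; first exact: L1D.
  rewrite -/(I n t w); move: (I n t w) (left_sum M u N M w) (J t w) => x y z.
  by have := ler_normD (y - x) (x - z); rewrite addrA subrK.
lra.
Qed.

End quadratic_variation.

(** * Compensator *)

Section drift_process.
Context (R : realType) d (Omega : measurableType d) (Pr : probability Omega R)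
  (F : R -> set (set Omega)) (HF : is_filtration F).
Local Notation mu := (@lebesgue_measure R).

Let D : set (R * Omega) := `[0, +oo[%classic `*` setT.

(* Predictable sets are a sigma-algebra on [0, +oo) * Omega only; their
   preimages under the inclusion form one on the whole product. *)
Let S : set (set (R * Omega)) := [set C | predictable_sets F (D `&` C)].

Let sS : sigma_algebra setT S.
Proof.
have [p0 pC pU] : sigma_algebra D (predictable_sets F) by exact: smallest_sigma_algebra.
split=> [|C SC|C SC].
- by rewrite /S /= setI0.
- rewrite /S /= setTD -setDE; have := pC _ SC; congr predictable_sets.
  by apply/seteqP; split => x /=; tauto.
- by rewrite /S /= setI_bigcupr; exact: pU.
Qed.

(** For [t > 0], the left end of the cell []k / n.+1, k.+1 / n.+1]] containing [t], strictly before
    [t]; the maximum with 0 takes care of [t = 0]. *)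
Let left_grid n (t : R) : R := Num.max ((Num.ceil (t * n.+1%:R) - 1)%:~R / n.+1%:R) 0.

Let left_grid_oc n (t : R) (k : nat) : k%:R / n.+1%:R < t <= k.+1%:R / n.+1%:R ->
  left_grid n t = k%:R / n.+1%:R.
Proof.
have n0 : 0 < n.+1%:R :> R by rewrite ltr0n.
rewrite ltr_pdivrMr// ler_pdivlMr// => /andP[kt tk].
have cE : Num.ceil (t * n.+1%:R) = k.+1%:Z.
  by apply: ceil_def; rewrite -addn1 PoszD addrK -!pmulrn addn1 kt tk.
rewrite /left_grid cE -addn1 PoszD addrK -pmulrn.
by rewrite max_l// mulr_ge0.
Qed.

Let left_grid_ex n (t : R) : 0 < t -> exists k : nat, k%:R / n.+1%:R < t <= k.+1%:R / n.+1%:R.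
Proof.
move=> t0; have n0 : 0 < n.+1%:R :> R by rewrite ltr0n.
have c0 : 0 < Num.ceil (t * n.+1%:R) by rewrite ceil_gt0 mulr_gt0.
case E : (Num.ceil (t * n.+1%:R)) c0 => [[|k]|]// _; exists k.
have /andP[] := ceil_itv (t * n.+1%:R).
by rewrite E -addn1 PoszD addrK -!pmulrn addn1 ltr_pdivrMr// ler_pdivlMr// => -> ->.
Qed.

(** [A] is the limit of the step processes frozen at [left_grid], by the Lipschitz bound. Their
    preimages are unions of a generating rectangle at time 0 and countably many []x k, x k.+1]]
    times a set of [F (x k)]. Negative times are sent to 0, and intersection with [D] discards
    them. *)
Lemma predictable_continuous (A : R -> Omega -> R) :
  (forall t, 0 <= t -> measurable_wrt (F t) (A t)) ->
  (forall w t, exists2 K : R, 0 <= K &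
     forall u v, 0 <= u -> u <= v -> v <= t -> `|A v w - A u w| <= K * (v - u)) ->
  predictable F A.
Proof.
move=> aA lA.
pose Y n (z : g_sigma_algebraType S) := A (left_grid n (Num.max z.1 0)) z.2.
pose g (z : g_sigma_algebraType S) := A (Num.max z.1 0) z.2.
have SE : <<s S >> = S := sigma_algebra_id sS.
have DE (z : R * Omega) : D z = (0 <= z.1) :> Prop.
  by apply/propext; split=> [[/=]|]; rewrite /D /= in_itv/= andbT.
have lg0 n : left_grid n 0 = 0.
  by rewrite /left_grid mul0r ceil0 add0r mulN1r max_r// oppr_le0 invr_ge0.
have mY n : measurable_fun setT (Y n).
  move=> _ B mB; rewrite setTI /measurable/= SE /S /=.
  pose x (k : nat) : R := k%:R / n.+1%:R.
  have x0 k : 0 <= x k by rewrite mulr_ge0.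
  have -> : D `&` Y n @^-1` B = [set 0] `*` (A 0 @^-1` B) `|`
      \bigcup_k (`]x k, x k.+1]%classic `*` (A (x k) @^-1` B)).
    apply/seteqP; split=> [[t w]|[t w]].
      move=> []; rewrite DE /= le_eqVlt => /predU1P[<-|t0].
        by rewrite /Y/= maxxx lg0 => Bw; left.
      have [k kt] := left_grid_ex n t0; rewrite /Y/= max_l ?(ltW t0)// (left_grid_oc kt) => Bw.
      by right; exists k => //=; split => //=; rewrite in_itv.
    move=> [[/= -> Bw]|[k _ [/=]]].
      by split; [rewrite DE|rewrite /Y/= maxxx lg0].
    rewrite in_itv/= => kt Bw; have /andP[xt _] := kt.
    have t0 : 0 <= t by exact: le_trans (x0 k) (ltW xt).
    by split; [rewrite DE|rewrite /Y/= max_l// (left_grid_oc kt)].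
  have [p0 pC pU] : sigma_algebra D (predictable_sets F) by exact: smallest_sigma_algebra.
  rewrite -bigcup2E; apply: (pU) => -[|[|k]] //=.
    apply: sub_gen_smallest; left; exists (A 0 @^-1` B); split => //.
    exact: aA.
  apply: pU => k; apply: sub_gen_smallest; right; exists (x k), (x k.+1), (A (x k) @^-1` B).
  by split => //; [rewrite ler_wpM2r ?invr_ge0// ler_nat|exact: aA].
have cY z : Y n z @[n --> \oo] --> g z.
  have [z0|z0] := ltP 0 z.1; last first.
    by apply: cvg_near_cst; apply: nearW => n; rewrite /Y /g (max_r z0) lg0.
  rewrite /Y /g max_l ?(ltW z0)//; have [K K0 hK] := lA z.2 z.1.
  apply/cvgrPdist_le => e e0.
  have d0 : 0 < e / (K + 1) by rewrite divr_gt0// ltr_wpDl.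
  have /cvgrPdist_lt/(_ _ d0) := @cvg_harmonic R.
  apply: filterS => n; rewrite sub0r normrN ger0_norm ?invr_ge0// => ne.
  have [k kt] := left_grid_ex n z0; rewrite (left_grid_oc kt).
  have /andP[kz zk] := kt.
  apply: le_trans (hK _ _ _ (ltW kz) (lexx _)) _; first by rewrite mulr_ge0.
  have zd : z.1 - k%:R / n.+1%:R <= n.+1%:R^-1.
    by rewrite lerBlDl; apply: le_trans zk _; rewrite -natr1 mulrDl mul1r.
  apply: (@le_trans _ _ ((K + 1) * (e / (K + 1)))).
    apply: ler_pM => //; [by rewrite subr_ge0 ltW|by rewrite lerDl|].
    exact: le_trans zd (ltW ne).
  by rewrite mulrC divfK// gt_eqF// ltr_wpDl.
have mg : measurable_fun setT g by apply: measurable_fun_cvg mY _ => z _; exact: cY.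
move=> B mB; have := mg measurableT B mB; rewrite setTI /measurable/= SE /S /=.
congr predictable_sets; apply/seteqP; split=> [z|z] [].
  by rewrite DE /g /= => z0; rewrite max_l.
by move=> z0 Bz; split; [rewrite DE|rewrite /g /= max_l].
Qed.

Lemma local_martingale_of_martingale (Y : R -> Omega -> R) : is_martingale Pr F Y ->
  {ae Pr, forall w, cadlag (Y ^~ w)} -> is_local_martingale Pr F Y.
Proof.
move=> mY cY; have [aY _ _] := mY; split => //; exists (fun _ _ => +oo%E); split=> [n||n].
- split=> [w|t t0]; first exact: leey.
  rewrite (_ : [set w | _] = set0); first by have [F0 _ _] := filtration_sigma HF t0.
  by apply/seteqP; split => w //=; rewrite leye_eq.
- by apply: aeW => w; split => // ; exact: cvg_cst.
- rewrite (_ : stopped _ Y = Y)//.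
  by apply/funext => t; apply/funext => w; rewrite /stopped min_l ?leey.
Qed.

Lemma martingaleP (Y : R -> Omega -> R) :
  (forall t, 0 <= t -> measurable_wrt (F t) (Y t)) -> (forall t, 0 <= t -> L1 Pr (Y t)) ->
  (forall s t A, 0 <= s -> s <= t -> F s A -> Ex Pr (fun w => \1_A w * (Y t w - Y s w)) = 0) ->
  is_martingale Pr F Y.
Proof.
move=> aY lY fY; split=> // s t s0 st; have t0 := le_trans s0 st.
split=> [||A FA]; [exact: aY|exact: lY|].
have mA := filtration_measurable HF s0 FA.
have ls := L1_indic_mul mA (lY s s0); have lt := L1_indic_mul mA (lY t t0).
rewrite (Ex_indic mA (lY s s0)) (Ex_indic mA (lY t t0)); congr EFin.
apply/eqP; rewrite eq_sym -subr_eq0 -ExB// -(fY s t A s0 st FA); apply/eqP.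
by apply: eq_Ex => w; rewrite mulrBr.
Qed.

Lemma compensatorP (Q a c : R -> Omega -> R) :
  (forall w, cadlag (a ^~ w)) -> (forall w, cadlag (c ^~ w)) ->
  (forall t w, `|a t w| <= c t w) ->
  (forall t, 0 <= t -> measurable_wrt (F t) (a t)) ->
  (forall s t, 0 <= s -> s <= t -> L1 Pr (fun w => \int[mu]_(v in `[s, t]) a v w)) ->
  (forall t, 0 <= t -> measurable_wrt (F t) (Q t)) ->
  {ae Pr, forall w, cadlag (Q ^~ w)} ->
  (forall t, 0 <= t -> L1 Pr (Q t)) ->
  (forall s t A, 0 <= s -> s <= t -> F s A ->
    Ex Pr (fun w => \1_A w * (Q t w - Q s w)) =
    Ex Pr (fun w => \1_A w * \int[mu]_(v in `[s, t]) a v w)) ->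
  is_compensator Pr F Q (fun t w => \int[mu]_(v in `[0, t]) a v w).
Proof.
move=> ca cc ac aa la aQ cQ lQ hQ.
have aA t : 0 <= t -> measurable_wrt (F t) (fun w => \int[mu]_(v in `[0, t]) a v w).
  move=> t0; apply: measurable_wrt_path_integral => //; first exact: (filtration_sigma HF t0).
  by move=> v /andP[v0 vt]; exact: (measurable_wrt_filtration HF v0 vt (aa v v0)).
have aQA t : 0 <= t -> measurable_wrt (F t) (fun w => Q t w - \int[mu]_(v in `[0, t]) a v w).
  by move=> t0; apply: (measurable_wrtB (filtration_sigma HF t0)); [exact: aQ|exact: aA].
have lQA t : 0 <= t -> L1 Pr (fun w => Q t w - \int[mu]_(v in `[0, t]) a v w).
  by move=> t0; apply: L1B; [exact: lQ|exact: la].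
split.
- by apply: predictable_continuous => // w t; exact: primitive_lipschitz.
- by apply: aeW => w; exact: Rintegral_itv11.
- by apply: aeW => w; exact: primitive_cadlag.
- apply: aeW => w t t0.
  have mono f : cadlag f -> (forall s, 0 <= f s) ->
      bounded_variation 0 t (fun s => \int[mu]_(v in `[0, s]) f v).
    move=> cf f0; apply: nondecreasing_bounded_variation => x y.
    rewrite !in_itv/= => /andP[x0 _] _ xy.
    rewrite (cadlag_Rintegral_itvD (lexx 0) x0 xy cf) lerDl.
    exact: Rintegral_ge0.
  have c0 s : 0 <= c s w by exact: le_trans (ac s w).
  (* Additivity of bounded variation is applied on a nondegenerate interval; on a single point
     monotonicity is immediate. *)
  have [->|tn0] := eqVneq t 0.
    have := @nondecreasing_bounded_variation R 0 0 (fun s => \int[mu]_(v in `[0, s]) a v w).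
    apply => x y; rewrite !in_itv/= => /andP[x0 x0'] /andP[y0 y0'] _.
    by rewrite (le_anti (_ : x <= 0 <= x)) ?x0 ?x0'// (le_anti (_ : y <= 0 <= y)) ?y0 ?y0'.
  have tp : 0 < t by rewrite lt_neqAle eq_sym tn0.
  have bC := mono _ (cc w) c0.
  (* Since [|a| <= c], both [c] and [c - a] are nonnegative, and the integral of [a] is a difference
     of two nondecreasing primitives. *)
  have bD : bounded_variation 0 t (fun s => \int[mu]_(v in `[0, s]) (c v w - a v w)).
    apply: mono; first exact: cadlagB.
    by move=> s; rewrite subr_ge0 (le_trans (ler_norm _)).
  have := bounded_variationD tp bC (bounded_variationN bD).
  congr bounded_variation; apply/funext => s /=.
  by rewrite (cadlag_RintegralB s (lexx 0) (cc w) (ca w)) opprB addrC subrK.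
apply: local_martingale_of_martingale; last first.
  by apply: filterS cQ => w cw; apply: cadlagB => //; exact: primitive_cadlag.
apply: martingaleP => // s t A s0 st FA.
have t0 := le_trans s0 st; have mA := filtration_measurable HF s0 FA.
rewrite (@eq_Ex _ _ _ _ _ (fun w => \1_A w * (Q t w - Q s w) -
  \1_A w * \int[mu]_(v in `[s, t]) a v w)) => [|w]; last first.
  rewrite (cadlag_Rintegral_itvD (lexx 0) s0 st (ca w)).
  move: (\int[mu]_(v in `[0, s]) a v w) (\int[mu]_(v in `[s, t]) a v w) => x y; ring.
rewrite ExB; [|by apply: L1_indic_mul => //; apply: L1B; exact: lQ|].
  by rewrite hQ// subrr.
by apply: L1_indic_mul => //; exact: la.
Qed.

End drift_process.

Section covariation.
Context (R : realType) d (Omega : measurableType d) (Pr : probability Omega R).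
Local Notation Ex := (Ex Pr).
Local Notation L1 := (L1 Pr).

(** The default [t] of [nth] makes the sequence constant past the end of the list, hence
    nondecreasing on all indices. *)
Lemma itv_partition_weak (t : R) s : itv_partition 0 t s ->
  weak_partition t (nth t (0 :: s)) (size s).
Proof.
move=> [ps /eqP ls]; have tE : nth t (0 :: s) (size s) = t.
  by rewrite -[RHS]ls (last_nth t).
split=> // i; have [is_|si] := ltnP i (size s).
  by rewrite ltW//=; exact: (pathP t ps).
rewrite [leRHS]nth_default//= le_eqVlt; apply/orP; left; apply/eqP.
by move: si; rewrite leq_eqVlt => /predU1P[<-//|lt]; rewrite nth_default.
Qed.

Lemma markov_L1 (f : Omega -> R) (eps eta : R) : L1 f -> 0 < eps ->
  Ex (fun w => `|f w|) <= eps * eta -> (Pr [set w | (eps <= `|f w|)%R] <= eta%:E)%E.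
Proof.
move=> lf e0 h; set A := [set w | _].
have mA : measurable A.
  rewrite (_ : A = (fun w => `|f w|) @^-1` `[eps, +oo[); last first.
    by apply/seteqP; split => w; rewrite /A /= in_itv/= andbT.
  rewrite -[X in measurable X]setTI; apply: measurableT_comp => //.
  exact: L1_measurable lf.
have lI := L1_indic Pr mA.
rewrite -(Ex_indicE Pr mA) lee_fin -(ler_pM2l e0); apply: le_trans h.
rewrite -ExZ//; apply: le_Ex => [||w]; [exact: L1Z|exact: L1_norm|].
by rewrite indicE; have [|_] := boolP (w \in A); rewrite ?mulr0// inE mulr1.
Qed.

End covariation.

(** * Degree, linearity and polarization for the generator *)

Section generator_algebra.
Context (R : realType) (E : Type) (PP : set (E -> R)) (deg : (E -> R) -> nat)
  (HPP : polynomial_space PP deg) (T : R -> (E -> R) -> (E -> R))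
  (HT : polynomial_action PP deg T) (HTfin : locally_finite_action PP T).
Local Notation gen := (generator PP T).
Implicit Types (p q r : E -> R) (n : nat).

Lemma poly_leD n p q : poly_le PP deg n p -> poly_le PP deg n q -> poly_le PP deg n (p + q).
Proof.
move=> [PPp dp] [PPq dq]; have [[_ PPD _] [dD _ _]] := HPP.
by split; [exact: PPD|rewrite (leq_trans (dD _ _ PPp PPq))// geq_max dp dq].
Qed.

Lemma poly_leZ n (a : R) p : poly_le PP deg n p -> poly_le PP deg n (a *: p).
Proof.
move=> [PPp dp]; have [[PPc _ PPZ] [_ dZ d0]] := HPP.
have [->|an0] := eqVneq a 0; last by split; [exact: PPZ|rewrite dZ].
have -> : 0 *: p = cst 0 by apply/funext => x; exact: mul0r.
by split => //; rewrite ((d0 _ (PPc 0)).2 _)//; exists 0.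
Qed.

Lemma poly_leB n p q : poly_le PP deg n p -> poly_le PP deg n q -> poly_le PP deg n (p - q).
Proof. by move=> hp hq; rewrite -scaleN1r; apply: poly_leD => //; exact: poly_leZ. Qed.

Lemma poly_le_sum n (I : Type) (s : seq I) (c : I -> R) (f : I -> E -> R) :
  (forall i, poly_le PP deg n (f i)) -> poly_le PP deg n (\sum_(i <- s) c i *: f i).
Proof.
move=> hf; elim: s => [|i s ih]; last by rewrite big_cons; apply: poly_leD => //; exact: poly_leZ.
rewrite big_nil; have [[PPc _ _] [_ _ d0]] := HPP.
by split; [exact: (PPc 0)|rewrite ((d0 _ (PPc 0)).2 _)//; exists 0].
Qed.

Lemma generatorP p : PP p -> generator_graph PP T p (gen p).
Proof. by move=> /(generator_total HPP HT HTfin)[]. Qed.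

(** The axioms on [deg] say nothing about pointwise limits. Instead, [gen p = T_0 (gen p)] is a
    combination of the orbit polynomials [f i], of degree at most that of [p]. *)
Lemma generator_poly_le n p : poly_le PP deg n p -> poly_le PP deg n (gen p).
Proof.
move=> [PPp dp]; have [[_ PPg _] [k [f [c [e [hf _ _ Tg _]]]]]] := generator_total HPP HT HTfin PPp.
have [_ [T0 _ _]] := HT; rewrite -(T0 _ PPg) Tg//; apply: poly_le_sum => i.
by have [PPf df] := hf i; split => //; exact: leq_trans df dp.
Qed.

Lemma generatorD p q : PP p -> PP q -> gen (p + q) = gen p + gen q.
Proof.
move=> PPp PPq; have [[_ TL _] _] := HT; have [[_ PPD _] _] := HPP.
have [_ PPgp gp] := generatorP PPp; have [_ PPgq gq] := generatorP PPq.
apply: generatorE; split=> [||x]; [exact: PPD|exact: PPD|].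
apply: cvg_trans (cvgD (gp x) (gq x)); apply: near_eq_cvg; near=> h.
have h0 : 0 <= h by apply: ltW; near: h; exact: nbhs_right_gt.
have := TL h h0 1 p q PPp PPq; rewrite !scale1r => -> /=.
rewrite -mulrDl; congr (_ / _).
have DE (f g : E -> R) : (f + g) x = f x + g x by [].
rewrite !DE -[LHS]/((T h p x - p x) + (T h q x - q x)); ring.
Unshelve. all: by end_near. Qed.

Lemma generatorZ (a : R) p : PP p -> gen (a *: p) = a *: gen p.
Proof.
move=> PPp; have [[_ TL _] _] := HT; have [[PPc _ PPZ] _] := HPP.
have [_ PPgp gp] := generatorP PPp.
have TZ h : 0 <= h -> T h (a *: p) = a *: T h p.
  move=> h0; have PP0 : PP 0 by exact: (PPc 0).
  have T00 : T h 0 = 0.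
    by have := TL h h0 (-1) 0 0 PP0 PP0; rewrite scaler0 addr0 scaleN1r addNr.
  by have := TL h h0 a p 0 PPp PP0; rewrite !addr0 T00 addr0.
apply: generatorE; split=> [||x]; [exact: PPZ|exact: PPZ|].
have ZE (f : E -> R) : (a *: f) x = a * f x by [].
rewrite ZE; apply: cvg_trans (cvgM (cvg_cst a) (gp x)); apply: near_eq_cvg; near=> h.
have h0 : 0 <= h by apply: ltW; near: h; exact: nbhs_right_gt.
rewrite TZ// !ZE -[LHS]/(a * ((T h p x - p x) / h)); ring.
Unshelve. all: by end_near. Qed.

Lemma generatorB p q : PP p -> PP q -> gen (p - q) = gen p - gen q.
Proof.
move=> PPp PPq; have [[_ _ PPZ] _] := HPP.
have PPNq : PP (-1 *: q) by exact: PPZ.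
by rewrite -scaleN1r (generatorD PPp PPNq) (generatorZ _ PPq) scaleN1r.
Qed.

Lemma carre_polarization p q x : PP p -> PP q -> PP (p * p) -> PP (p * q) -> PP (q * q) ->
  4 * carre_du_champ PP T p q x =
  carre_du_champ PP T (p + q) (p + q) x - carre_du_champ PP T (p - q) (p - q) x.
Proof.
move=> PPp PPq PPpp PPpq PPqq; have [[_ PPD PPZ] _] := HPP.
have PP2 : PP (2 *: (p * q)) by exact: PPZ.
have PPs : PP (p * p + q * q) by exact: PPD.
have sE : (p + q) * (p + q) = (p * p + q * q) + 2 *: (p * q).
  apply/funext => y; rewrite -[LHS]/((p y + q y) * (p y + q y)).
  rewrite -[RHS]/(p y * p y + q y * q y + 2 * (p y * q y)); ring.
have dE : (p - q) * (p - q) = (p * p + q * q) - 2 *: (p * q).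
  apply/funext => y; rewrite -[LHS]/((p y - q y) * (p y - q y)).
  rewrite -[RHS]/(p y * p y + q y * q y - 2 * (p y * q y)); ring.
rewrite /carre_du_champ sE dE (generatorD PPs PP2) (generatorB PPs PP2).
rewrite (generatorD PPp PPq) (generatorB PPp PPq) generatorZ// generatorD//.
move: (gen (p * p)) (gen (q * q)) (gen (p * q)) (gen p) (gen q) => a b c f g.
have DE (u v : E -> R) : (u + v) x = u x + v x by [].
have NE (u : E -> R) : (- u) x = - u x by [].
have ZE (u : E -> R) : (2 *: u) x = 2 * u x by [].
by rewrite !(DE, NE, ZE); ring.
Qed.

End generator_algebra.

(** * Covariation of the martingale parts *)

Section covariation_of_polynomials.
Context (R : realType) d (Omega : measurableType d) (Pr : probability Omega R)
  (F : R -> set (set Omega)) (HF : is_filtration F) (E : Type)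
  (PP : set (E -> R)) (deg : (E -> R) -> nat) (HPP : polynomial_space PP deg)
  (T : R -> (E -> R) -> (E -> R)) (HT : polynomial_action PP deg T)
  (HTfin : locally_finite_action PP T)
  (H11 : products (poly_le PP deg 1) (poly_le PP deg 1) `<=` poly_le PP deg 2)
  (H12 : products (poly_le PP deg 2) (poly_le PP deg 2) `<=` PP \/
         spanned_by_positive (poly_le PP deg 2))
  (X : R -> Omega -> E) (HX : polynomial_process Pr F PP T X).
Local Notation mu := (@lebesgue_measure R).
Local Notation Ex := (Ex Pr).
Local Notation L1 := (L1 Pr).
Local Notation gen := (generator PP T).
Local Notation P1 := (poly_le PP deg 1).
Local Notation M := (M_process PP T X).
Local Notation carre := (carre_du_champ PP T).

Let Ex_scaleB (k : R) f g : L1 f -> L1 g ->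
  Ex (fun w => k * f w - k * g w) = k * Ex f - k * Ex g.
Proof. by move=> lf lg; rewrite ExB ?ExZ//; exact: L1Z. Qed.

Let P1M p q : P1 p -> P1 q -> poly_le PP deg 2 (p * q).
Proof. by move=> hp hq; apply: H11; exists p, q. Qed.

Let PP1 p : P1 p -> PP p. Proof. by case. Qed.

Let PP1M p q : P1 p -> P1 q -> PP (p * q). Proof. by move=> hp hq; case: (P1M hp hq). Qed.

Let P1g p : P1 p -> P1 (gen p). Proof. exact: (generator_poly_le HPP HT HTfin). Qed.

(** The alternative hypotheses enter here. Under the first, [|g| <= 1 + g^2] with [g^2] in [PP];
    under the second, [|g|] is at most the combination of positive elements with coefficients
    replaced by their absolute values. *)
Lemma dominated_degree2 g : poly_le PP deg 2 g -> dominated PP g.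
Proof.
move=> g2; have PPg : PP g by case: g2.
case: H12 => [h|h]; first by apply: (dominated_square HPP) => //; apply: h; exists g, g.
have [n [c [f [hf gE]]]] := h g g2.
split => //; exists (\sum_(i < n) `|c i| *: f i) => [|x].
  by apply: (poly_sum HPP) => i; case: (hf i) => -[].
rewrite gE !fct_sumE; apply: le_trans (ler_norm_sum _ _ _) _.
apply: ler_sum => i _; have -> (k : R) : (k *: f i) x = k * f i x by [].
by rewrite normrM (ger0_norm ((hf i).2 x)).
Qed.

Let dg p : P1 p -> dominated PP (gen p).
Proof. by move=> hp; apply: (dominated_square HPP); [exact/PP1/P1g|apply: PP1M; exact: P1g]. Qed.

Let dgpp p : P1 p -> dominated PP (gen (p * p)).
Proof.
by move=> hp; apply: dominated_degree2; apply: (generator_poly_le HPP HT HTfin); exact: P1M.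
Qed.

Lemma drift_integrable p t : 0 <= t -> P1 p ->
  (\int[Pr]_w \int[mu]_(r in `[0%R, t]) (`|gen p (X r w)|%R)%:E < +oo)%E.
Proof.
move=> t0 hp; have PPg := PP1 (P1g hp).
have cg w : cadlag (fun r => `|gen p (X r w)|).
  by apply: cadlag_norm; exact: (process_cadlag HX).
have [C hC] := dominated_bounded HF HPP HT HTfin HX (dg hp) t0.
have [|lg _] := @Ex_path_integral _ _ _ Pr (fun r w => `|gen p (X r w)|) 0 t C (lexx 0) t0 cg.
  move=> r rt; have /andP[r0 _] := rt; split.
    by apply: L1_norm; exact: (process_L1 HX).
  by under eq_fun do rewrite normr_id; exact: hC.
rewrite (eq_integral (fun w => (\int[mu]_(r in `[0, t]) `|gen p (X r w)|)%:E)) => [|w _].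
  rewrite -(ExE lg); exact: ltry.
rewrite /Rintegral fineK//; apply: integrable_fin_num => //.
exact: cadlag_integrable_itv.
Qed.

Let carre_dominated p : P1 p -> dominated PP (carre p p).
Proof.
move=> hp; apply: (dominated_carre HPP); [exact: PP1M|apply: PP1M; exact: P1g| |exact: dgpp].
by apply: PP1M => //; exact: P1g.
Qed.

Lemma quadratic_variation_process p : P1 p -> exists Q : R -> Omega -> R,
  [/\ (forall t, 0 <= t -> measurable_wrt (F t) (Q t)),
      {ae Pr, forall w, cadlag (Q ^~ w)},
      (forall t, 0 <= t -> L1 (Q t)),
      (forall s t A, 0 <= s -> s <= t -> F s A ->
        Ex (fun w => \1_A w * (Q t w - Q s w)) =
        Ex (fun w => \1_A w * \int[mu]_(v in `[s, t]) carre p p (X v w))) &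
      (forall t (e : R), 0 <= t -> 0 < e -> exists2 dlt : R, 0 < dlt &
        forall u N, weak_partition t u N -> mesh_below u N dlt ->
        Ex (fun w => `|\sum_(i < N) (M p (u i.+1) w - M p (u i) w) ^+ 2 - Q t w|) <= e)].
Proof.
move=> hp; have PPp := PP1 hp; have PPpp := PP1M hp hp.
have PPgg := PP1M (P1g hp) (P1g hp); have PPpg := PP1M hp (P1g hp).
have [PPa [b PPb ab]] := carre_dominated hp.
have db : dominated PP b.
  split => //; exists b => // x; rewrite ger0_norm//; exact: le_trans (ab x).
have da := carre_dominated hp.
apply: (@quadratic_variation _ _ _ Pr F HF (M p) (fun v w => carre p p (X v w))
  (fun v w => b (X v w))) => [w|w|t t0|t t0|s t A s0 st FA|w|w|s t s0 st|s t s0 st|v w|s t A s0 st FA].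
- exact: (M_cadlag HPP HT HTfin HX).
- exact: M_0.
- exact: (M_adapted HF HPP HT HTfin HX).
- exact: (M_L2 HF HPP HT HTfin HX).
- exact: (M_martingale HF HPP HT HTfin HX PPp PPgg s0 st FA).
- exact: (process_cadlag HX).
- exact: (process_cadlag HX).
- exact: (dominated_L1 HF HPP HT HTfin HX).
- exact: (dominated_L1 HF HPP HT HTfin HX).
- exact: ab.
- exact: (M_bracket HF HPP HT HTfin HX PPp PPpp PPgg PPpg (dgpp hp) s0 st FA).
Qed.

Let M_D p q t w : P1 p -> P1 q -> 0 <= t -> M (p + q) t w = M p t w + M q t w.
Proof.
move=> hp hq t0; rewrite /M_process (generatorD HPP HT HTfin (PP1 hp) (PP1 hq)).
rewrite (cadlag_RintegralD (f := fun s => gen p (X s w)) (g := fun s => gen q (X s w)))//.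
- rewrite -[X in X - _ - _]/(p (X t w) + q (X t w)) -[X in _ - X - _]/(p (X 0 w) + q (X 0 w)).
  move: (\int[mu]_(s in _) _) (\int[mu]_(s in _) _) => x y; ring.
- exact: (process_cadlag HX _ (PP1 (P1g hp))).
- exact: (process_cadlag HX _ (PP1 (P1g hq))).
Qed.

Let M_B p q t w : P1 p -> P1 q -> 0 <= t -> M (p - q) t w = M p t w - M q t w.
Proof.
move=> hp hq t0; have := M_D w (poly_leB HPP hp hq) hq t0; rewrite subrK => ->.
by rewrite addrK.
Qed.

Lemma compensated_covariation p q : P1 p -> P1 q ->
  is_compensated_covariation Pr F (M p) (M q)
    (fun t w => \int[mu]_(s in `[0, t]) carre p q (X s w)).
Proof.
move=> hp hq; have hD := poly_leD HPP hp hq; have hB := poly_leB HPP hp hq.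
have [Q1 [aQ1 cQ1 lQ1 hQ1 vQ1]] := quadratic_variation_process hD.
have [Q2 [aQ2 cQ2 lQ2 hQ2 vQ2]] := quadratic_variation_process hB.
have [PPa1 [b1 PPb1 ab1]] := carre_dominated hD.
have [PPa2 [b2 PPb2 ab2]] := carre_dominated hB.
pose a v w := carre p q (X v w).
have aE v w : a v w = 4^-1 * carre (p + q) (p + q) (X v w) - 4^-1 * carre (p - q) (p - q) (X v w).
  rewrite -mulrBr -(carre_polarization HPP HT HTfin _ (PP1 hp) (PP1 hq))//; last first.
  - exact: PP1M.
  - exact: PP1M.
  - exact: PP1M.
  by rewrite mulrA mulVf// mul1r.
have c1 w := process_cadlag HX w PPa1; have c2 w := process_cadlag HX w PPa2.
have d1 := carre_dominated hD; have d2 := carre_dominated hB.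
pose Q t w := 4^-1 * Q1 t w - 4^-1 * Q2 t w.
have aQ t : 0 <= t -> measurable_wrt (F t) (Q t).
  move=> t0; have sF := filtration_sigma HF t0.
  by apply: (measurable_wrtB sF); apply: (measurable_wrtM sF);
    [exact: (measurable_wrt_cst sF)|exact: aQ1|exact: (measurable_wrt_cst sF)|exact: aQ2].
have cQ : {ae Pr, forall w, cadlag (Q ^~ w)}.
  by apply: filterS2 cQ1 cQ2 => w h1 h2; apply: cadlagB; exact: cadlagZ.
have lQ t : 0 <= t -> L1 (Q t).
  by move=> t0; apply: L1B; apply: L1Z; [exact: lQ1|exact: lQ2].
have IE s t w : 0 <= s -> \int[mu]_(v in `[s, t]) a v w =
    4^-1 * \int[mu]_(v in `[s, t]) carre (p + q) (p + q) (X v w) -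
    4^-1 * \int[mu]_(v in `[s, t]) carre (p - q) (p - q) (X v w).
  move=> s0; rewrite -(cadlag_RintegralZ _ _ s0 (c1 w)) -(cadlag_RintegralZ _ _ s0 (c2 w)).
  rewrite -(cadlag_RintegralB _ s0 (cadlagZ _ (c1 w)) (cadlagZ _ (c2 w))).
  by congr (Rintegral _ _ _); apply/funext => v; exact: aE.
have lI1 s t := @dominated_L1 _ _ _ _ _ HF _ _ _ HPP _ HT HTfin _ HX _ s t d1.
have lI2 s t := @dominated_L1 _ _ _ _ _ HF _ _ _ HPP _ HT HTfin _ HX _ s t d2.
have ca w : cadlag (a ^~ w).
  rewrite (_ : a ^~ w = fun v => 4^-1 * carre (p + q) (p + q) (X v w) -
      4^-1 * carre (p - q) (p - q) (X v w)); last by apply/funext => v; exact: aE.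
  by apply: cadlagB; exact: cadlagZ.
(* A cadlag majorant of [|a|], as [compensatorP] asks for in order to prove finite variation; it
   comes from the majorants for [p + q] and [p - q]. *)
pose c v w := 4^-1 * b1 (X v w) + 4^-1 * b2 (X v w).
have cc w : cadlag (c ^~ w) by apply: cadlagD; apply: cadlagZ; exact: (process_cadlag HX).
have i4 : 0 <= 4^-1 :> R by rewrite invr_ge0.
have ac v w : `|a v w| <= c v w.
  rewrite aE (le_trans (ler_normB _ _))// !normrM !(ger0_norm i4).
  by apply: lerD; rewrite ler_wpM2l.
have aa t : 0 <= t -> measurable_wrt (F t) (a t).
  move=> t0; have sF := filtration_sigma HF t0.
  rewrite (_ : a t = fun w => 4^-1 * carre (p + q) (p + q) (X t w) -
    4^-1 * carre (p - q) (p - q) (X t w)); last by apply/funext => w; exact: aE.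
  by apply: (measurable_wrtB sF); apply: (measurable_wrtM sF);
    [exact: (measurable_wrt_cst sF)|exact: (process_wrt HX)|
     exact: (measurable_wrt_cst sF)|exact: (process_wrt HX)].
have la s t : 0 <= s -> s <= t -> L1 (fun w => \int[mu]_(v in `[s, t]) a v w).
  move=> s0 st; rewrite (_ : (fun w => _) = fun w =>
    4^-1 * \int[mu]_(v in `[s, t]) carre (p + q) (p + q) (X v w) -
    4^-1 * \int[mu]_(v in `[s, t]) carre (p - q) (p - q) (X v w)); last first.
    by apply/funext => w; exact: IE.
  by apply: L1B; apply: L1Z; [exact: lI1|exact: lI2].
have hQ s t A : 0 <= s -> s <= t -> F s A -> Ex (fun w => \1_A w * (Q t w - Q s w)) =
    Ex (fun w => \1_A w * \int[mu]_(v in `[s, t]) a v w).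
  move=> s0 st FA; have t0 := le_trans s0 st; have mA := filtration_measurable HF s0 FA.
  have lq1 := L1_indic_mul mA (L1B (lQ1 t t0) (lQ1 s s0)).
  have lq2 := L1_indic_mul mA (L1B (lQ2 t t0) (lQ2 s s0)).
  have li1 := L1_indic_mul mA (lI1 s t s0 st).
  have li2 := L1_indic_mul mA (lI2 s t s0 st).
  have e1 := Ex_scaleB 4^-1 lq1 lq2; have e2 := Ex_scaleB 4^-1 li1 li2.
  rewrite (hQ1 s t A s0 st FA) (hQ2 s t A s0 st FA) in e1.
  have e3 := etrans e1 (esym e2).
  rewrite (@eq_Ex _ _ _ _ _ (fun w => 4^-1 * (\1_A w * (Q1 t w - Q1 s w)) -
    4^-1 * (\1_A w * (Q2 t w - Q2 s w)))); last by move=> w; rewrite /Q; ring.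
  rewrite e3; apply: eq_Ex => w; rewrite (IE s t w s0).
  move: (\int[mu]_(v in _) carre (p + q) _ _) (\int[mu]_(v in _) carre (p - q) _ _) => x y.
  ring.
exists Q; split; last exact: (compensatorP HF ca cc ac aa la aQ cQ lQ hQ).
(* An [L^1] error of [eps * eta] is what Markov's inequality turns into probability [eta] of an
   error at least [eps]; the two polarized parts enter with weight [1 / 4] each. *)
split => // t t0 eps eta eps0 eta0; have e0 : 0 < eps * eta by rewrite mulr_gt0.
have [dl1 dl10 h1] := vQ1 t _ t0 e0; have [dl2 dl20 h2] := vQ2 t _ t0 e0.
exists (Num.min dl1 dl2); first by rewrite lt_min dl10.
move=> s hs ms; have wp := itv_partition_weak hs.
pose u := nth t (0 :: s).
have u0 i : 0 <= u i by exact: (weak_partition_ge0 i wp).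
have m1 : mesh_below u (size s) dl1 by move=> i /ms; rewrite lt_min => /andP[].
have m2 : mesh_below u (size s) dl2 by move=> i /ms; rewrite lt_min => /andP[].
have {}h1 := h1 _ _ wp m1; have {}h2 := h2 _ _ wp m2.
pose S r w := \sum_(i < size s) (M r (u i.+1) w - M r (u i) w) ^+ 2.
have lS r : P1 r -> L1 (S r).
  move=> hr; apply: L1_sum => i.
  have lM j := M_L2 HF HPP HT HTfin HX (PP1 hr) (PP1M hr hr) (PP1M (P1g hr) (P1g hr)) (u0 j).
  by have [] := L2B (lM i.+1) (lM i).
have SE w : covariation_sum (M p) (M q) t s w - Q t w =
    4^-1 * (S (p + q) w - Q1 t w) - 4^-1 * (S (p - q) w - Q2 t w).
  have cE : covariation_sum (M p) (M q) t s w = 4^-1 * S (p + q) w - 4^-1 * S (p - q) w.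
    rewrite /covariation_sum big_mkord /S mulr_sumr [X in _ = _ - X]mulr_sumr -sumrB.
    apply: eq_bigr => i _.
    rewrite -/u (M_D w hp hq (u0 i.+1)) (M_D w hp hq (u0 i)).
    rewrite (M_B w hp hq (u0 i.+1)) (M_B w hp hq (u0 i)).
    by move: (M p _ w) (M q _ w) (M p _ w) (M q _ w) => x y x' y'; field.
  rewrite cE /Q; move: (S _ w) (S _ w) => x y; ring.
have l1 := L1B (lS _ hD) (lQ1 t t0); have l2 := L1B (lS _ hB) (lQ2 t t0).
have lT : L1 (fun w => covariation_sum (M p) (M q) t s w - Q t w).
  by under eq_fun do rewrite SE; apply: L1B; exact: L1Z.
apply: (markov_L1 lT eps0).
apply: (@le_trans _ _ (Ex (fun w => 4^-1 * `|S (p + q) w - Q1 t w| +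
  4^-1 * `|S (p - q) w - Q2 t w|))).
  apply: le_Ex => [||w]; first exact: L1_norm.
    by apply: L1D; apply: L1Z; exact: L1_norm.
  by rewrite SE (le_trans (ler_normB _ _))// !normrM !(ger0_norm i4).
rewrite ExD; [|by apply: L1Z; exact: L1_norm|by apply: L1Z; exact: L1_norm].
rewrite !ExZ; [|exact: L1_norm|exact: L1_norm].
move: h1 h2 e0; rewrite -/(S _ _).
move: (eps * eta) => e.
move: (Ex _) (Ex _) => x y; lra.
Qed.

End covariation_of_polynomials.

Theorem theorem5p3 (R : realType) (d : measure_display)
  (Omega : measurableType d) (Pr : probability Omega R)
  (F : R -> set (set Omega)) (HF : is_filtration F)
  (E : Type) (HE : inhabited E)
  (PP : set (E -> R)) (deg : (E -> R) -> nat)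
  (HPP : polynomial_space PP deg)
  (L : set (E -> R))
  (HL : is_complement L (poly_le PP deg 0) (poly_le PP deg 1))
  (T : R -> (E -> R) -> (E -> R))
  (HT : polynomial_action PP deg T)
  (HTfin : locally_finite_action PP T)
  (H11 : products (poly_le PP deg 1) (poly_le PP deg 1) `<=` poly_le PP deg 2)
  (H12 : products (poly_le PP deg 2) (poly_le PP deg 2) `<=` PP \/
         spanned_by_positive (poly_le PP deg 2))
  (X : R -> Omega -> E) (HX : polynomial_process Pr F PP T X) :
  (forall (t : R) (p : E -> R), 0 <= t -> L p ->
     (\int[Pr]_w \int[lebesgue_measure]_(r in `[0%R, t])
        (`|generator PP T p (X r w)|%R)%:E < +oo)%E) /\
  (forall p q : E -> R, L p -> L q ->
     is_compensated_covariation Pr F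
       (M_process PP T X p) (M_process PP T X q)
       (fun t w => \int[lebesgue_measure]_(s in `[0, t])
                     carre_du_champ PP T p q (X s w))).
Proof.
have [_ LP1 _ _] := HL; split=> [t p t0 /LP1 hp|p q /LP1 hp /LP1 hq].
  exact: (drift_integrable HF HPP HT HTfin H11 HX t0 hp).
exact: (compensated_covariation HF HPP HT HTfin H11 H12 HX hp hq).
Qed.
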